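(* Let $\mathcal{C}$ be a finitary $2$-category and let $A,B$ be two coalgebra $1$-morphisms in $\underline{\mathcal{C}}$. Then $\mathrm{comod}_{\underline{\mathcal{C}}}(A)$ and $\mathrm{comod}_{\underline{\mathcal{C}}}(B)$ are equivalent as $2$-representations of $\underline{\mathcal{C}}$ if and only if there exist biinjective bicomodule $1$-morphisms $M={}_AM_B$ and $N={}_BN_A$ in $\underline{\mathcal{C}}$ and bicomodule $2$-isomorphisms $$f\colon A\overset{\cong}{\longrightarrow}M\square_BN\quad\text{and}\quad g\colon B\overset{\cong}{\longrightarrow}N\square_AM$$ such that $$(\mathrm{id}_M\square g)\circ_1\rho_M=(f\square\mathrm{id}_M)\circ_1\lambda_M\colon M\to M\square_BN\square_AM,$$ $$(\mathrm{id}_N\square f)\circ_1\rho_N=(g\square\mathrm{id}_N)\circ_1\lambda_N\colon N\to N\square_AM\square_BN,$$ where $\lambda_M\colon M\to A\square_AM$, $\rho_M\colon M\to M\square_BB$, $\lambda_N\colon N\to B\square_BN$, $\rho_N\colon N\to N\square_AA$ are the isomorphisms defined by the coactions.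
   Context: Fix an algebraically closed field $\mathbb{k}$; all ($2$-)categories and ($2$-)functors are $\mathbb{k}$-linear. Composition of $1$-morphisms is $\circ$ (or juxtaposition), horizontal and vertical compositions of $2$-morphisms are $\circ_0$ and $\circ_1$. A category is finitary if it is additive, $\mathbb{k}$-linear, has split idempotents, finitely many isomorphism classes of indecomposable objects and finite dimensional morphism spaces. A $2$-category $\mathcal{C}$ is finitary if it has finitely many objects, every $\mathcal{C}(\mathtt{i},\mathtt{j})$ is finitary, horizontal composition is additive and $\mathbb{k}$-linear, and every identity $1$-morphism $\mathbb{1}_{\mathtt{i}}$ is indecomposable. Injective abelianization. For a finitary category $\mathcal{A}$, objects of $\underline{\mathcal{A}}$ are tuples $(X,k,Y_i,f_i)_{i\ge1}$ with $k\in\mathbb{Z}_{\ge0}$, $X,Y_i\in\mathcal{A}$, $f_i\colon X\to Y_i$ and $Y_i=0$ for $i>k$. Morphisms to $(X',k',Y_i',f_i')$ are tuples $(g\colon X\to X',\,h_{i,j}\colon Y_i\to Y_j')$ with $f_i'g=\sum_jh_{j,i}f_j$ for all $i$, modulo those tuples for which there are $q_i\colon Y_i\to X'$ with $\sum_iq_if_i=g$; composition is $(g'g,\sum_kh'_{k,j}h_{i,k})$. This category is abelian, and $X\mapsto(X,0,0,0)$ identifies $\mathcal{A}$ with the injective objects of $\underline{\mathcal{A}}$. The $2$-category $\underline{\mathcal{C}}$ has the objects of $\mathcal{C}$, $\underline{\mathcal{C}}(\mathtt{i},\mathtt{j})=\underline{\mathcal{C}(\mathtt{i},\mathtt{j})}$,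 and composition $(\mathrm{F},k,\mathrm{G}_i,\alpha_i)\circ(\mathrm{F}',k',\mathrm{G}_i',\alpha_i')=(\mathrm{F}\mathrm{F}',k+k',\mathrm{H}_i,\beta_i)$ with $\mathrm{H}_i=\mathrm{F}\mathrm{G}'_i$, $\beta_i=\mathrm{id}_{\mathrm{F}}\circ_0\alpha'_i$ for $1\le i\le k'$, and $\mathrm{H}_i=\mathrm{G}_{i-k'}\mathrm{F}'$, $\beta_i=\alpha_{i-k'}\circ_0\mathrm{id}_{\mathrm{F}'}$ for $k'<i\le k'+k$, zero otherwise; horizontal composition of $2$-morphisms is component-wise. Coalgebras, comodules, bicomodules. A coalgebra $1$-morphism in $\underline{\mathcal{C}}$ is $A\in\underline{\mathcal{C}}(\mathtt{i},\mathtt{i})$ (for some object $\mathtt{i}$) with comultiplication $A\to A\circ A$ and counit $A\to\mathbb{1}_{\mathtt{i}}$ that are coassociative and counital. A right $A$-comodule $1$-morphism is $X\in\coprod_{\mathtt{j}}\underline{\mathcal{C}}(\mathtt{i},\mathtt{j})$ with a coassociative, counital coaction $X\to X\circ A$; left comodules are defined similarly. $\mathrm{comod}_{\underline{\mathcal{C}}}(A)$ is the category of right $A$-comodule $1$-morphisms; it is a $2$-representation of $\underline{\mathcal{C}}$ (a $2$-functor from $\underline{\mathcal{C}}$ to categories) via left composition, with value at $\mathtt{j}$ the comodules in $\underline{\mathcal{C}}(\mathtt{i},\mathtt{j})$. Morphisms of $2$-representations are $2$-natural transformations (commuting with the action up to coherent natural isomorphism); $2$-representations are equivalent if there is such a morphism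 all of whose components are equivalences of categories. An $A$-$B$ bicomodule $1$-morphism $M={}_AM_B$ is a $1$-morphism with commuting left coaction $\lambda_M\colon M\to A\circ M$ and right coaction $\rho_M\colon M\to M\circ B$. For bicomodules ${}_AM_B$, ${}_BN_A$, the cotensor product $M\square_BN$ is the kernel of $\rho_M\circ_0\mathrm{id}_N-\mathrm{id}_M\circ_0\lambda_N\colon M\circ N\to M\circ B\circ N$, an $A$-$A$ bicomodule $1$-morphism; $N\square_AM$ and other cotensor products are defined similarly. The cotensor product is associative up to canonical isomorphism (suppressed in the notation), and $\lambda_M$, $\rho_M$ induce bicomodule isomorphisms $M\cong A\square_AM$ and $M\cong M\square_BB$, denoted by the same symbols (similarly for $N$). A bicomodule $1$-morphism is biinjective if it is injective as a left comodule $1$-morphism and as a right comodule $1$-morphism (not necessarily as a bicomodule $1$-morphism). *)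

(* Defs.v *)
From HB Require Import structures.
From mathcomp Require Import all_boot all_order all_algebra.
From mathcomp Require Import generic_quotient boolp classical_sets cardinality.

Set Implicit Arguments.
Unset Strict Implicit.
Unset Printing Implicit Defensive.

Import GRing.Theory.
Local Open Scope ring_scope.
Local Open Scope quotient_scope.

Record linCat (k : fieldType) := LinCat {
  lobj :> Type;
  arr : lobj -> lobj -> lmodType k;
  idm : forall X, arr X X;
  vcomp : forall X Y Z, arr Y Z -> arr X Y -> arr X Z;
  vcompPl : forall X Y Z (a : k) (g g' : arr Y Z) (f : arr X Y),
    vcomp (a *: g + g') f = a *: vcomp g f + vcomp g' f;
  vcompPr : forall X Y Z (a : k) (g : arr Y Z) (f f' : arr X Y),
    vcomp g (a *: f + f') = a *: vcomp g f + vcomp g f';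
  vcompA : forall X Y Z W (h : arr Z W) (g : arr Y Z) (f : arr X Y),
    vcomp h (vcomp g f) = vcomp (vcomp h g) f;
  vcomp1l : forall X Y (f : arr X Y), vcomp (idm Y) f = f;
  vcomp1r : forall X Y (f : arr X Y), vcomp f (idm X) = f }.

Arguments arr {k l} _ _.
Arguments idm {k l} X.
Arguments vcomp {k l X Y Z} _ _.
Notation "g \o1 f" := (vcomp g f) (at level 39, left associativity).

Section LinCatTheory.
Variables (k : fieldType) (L : linCat k).
Implicit Types X Y Z W : L.

Lemma vcompDl X Y Z (g g' : arr Y Z) (f : arr X Y) :
  (g + g') \o1 f = g \o1 f + g' \o1 f.
Proof. by have := vcompPl 1 g g' f; rewrite !scale1r. Qed.
Lemma vcompDr X Y Z (g : arr Y Z) (f f' : arr X Y) :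
  g \o1 (f + f') = g \o1 f + g \o1 f'.
Proof. by have := vcompPr 1 g f f'; rewrite !scale1r. Qed.
Lemma vcomp0l X Y Z (f : arr X Y) : (0 : arr Y Z) \o1 f = 0.
Proof. by apply: (@addrI _ (0 \o1 f)); rewrite -vcompDl !addr0. Qed.
Lemma vcomp0r X Y Z (g : arr Y Z) : g \o1 (0 : arr X Y) = 0.
Proof. by apply: (@addrI _ (g \o1 0)); rewrite -vcompDr !addr0. Qed.
Lemma vcompZl X Y Z a (g : arr Y Z) (f : arr X Y) : (a *: g) \o1 f = a *: (g \o1 f).
Proof. by have := vcompPl a g 0 f; rewrite vcomp0l !addr0. Qed.
Lemma vcompZr X Y Z a (g : arr Y Z) (f : arr X Y) : g \o1 (a *: f) = a *: (g \o1 f).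
Proof. by have := vcompPr a g f 0; rewrite vcomp0r !addr0. Qed.
Lemma vcompNl X Y Z (g : arr Y Z) (f : arr X Y) : (- g) \o1 f = - (g \o1 f).
Proof. by rewrite -scaleN1r vcompZl scaleN1r. Qed.
Lemma vcompNr X Y Z (g : arr Y Z) (f : arr X Y) : g \o1 (- f) = - (g \o1 f).
Proof. by rewrite -scaleN1r vcompZr scaleN1r. Qed.
Lemma vcompBl X Y Z (g g' : arr Y Z) (f : arr X Y) :
  (g - g') \o1 f = g \o1 f - g' \o1 f.
Proof. by rewrite vcompDl vcompNl. Qed.
Lemma vcompBr X Y Z (g : arr Y Z) (f f' : arr X Y) :
  g \o1 (f - f') = g \o1 f - g \o1 f'.
Proof. by rewrite vcompDr vcompNr. Qed.
Lemma vcomp_suml I (r : seq I) (P : pred I) X Y Z (g : I -> arr Y Z) (f : arr X Y) :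
  (\sum_(i <- r | P i) g i) \o1 f = \sum_(i <- r | P i) (g i \o1 f).
Proof.
apply: (big_morph (fun u : arr Y Z => u \o1 f)); last exact: vcomp0l.
by move=> u v; exact: vcompDl.
Qed.
Lemma vcomp_sumr I (r : seq I) (P : pred I) X Y Z (g : arr Y Z) (f : I -> arr X Y) :
  g \o1 (\sum_(i <- r | P i) f i) = \sum_(i <- r | P i) (g \o1 f i).
Proof.
apply: (big_morph (fun u : arr X Y => g \o1 u)); last exact: vcomp0r.
by move=> u v; exact: vcompDr.
Qed.

Definition is_iso X Y (f : arr X Y) : Prop :=
  exists g : arr Y X, g \o1 f = idm X /\ f \o1 g = idm Y.
Definition isomorphic X Y : Prop := exists f : arr X Y, is_iso f.

Definition is_mono X Y (f : arr X Y) : Prop :=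
  forall Z (u v : arr Z X), f \o1 u = f \o1 v -> u = v.

Definition injective_obj X : Prop :=
  forall Y Z (m : arr Y Z) (f : arr Y X), is_mono m -> exists g : arr Z X, g \o1 m = f.

Definition is_kernel X Y K (u : arr X Y) (i : arr K X) : Prop :=
  u \o1 i = 0 /\
  forall Z (v : arr Z X), u \o1 v = 0 -> exists! w : arr Z K, i \o1 w = v.

Definition eqhom X Y (e : X = Y) : arr X Y :=
  match e in _ = Z return arr X Z with erefl => idm X end.

Definition is_zero_obj X : Prop := idm X = 0.

Definition is_biproduct X Y S : Prop :=
  exists (i1 : arr X S) (i2 : arr Y S) (p1 : arr S X) (p2 : arr S Y),
    [/\ p1 \o1 i1 = idm X, p2 \o1 i2 = idm Y, p2 \o1 i1 = 0, p1 \o1 i2 = 0 &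
        i1 \o1 p1 + i2 \o1 p2 = idm S].

Definition additive_cat : Prop :=
  (exists Z, is_zero_obj Z) /\ forall X Y, exists S, is_biproduct X Y S.

Definition split_idempotents : Prop :=
  forall X (e : arr X X), e \o1 e = e ->
    exists Y (r : arr X Y) (s : arr Y X), r \o1 s = idm Y /\ s \o1 r = e.

Definition indecomposable X : Prop :=
  ~ is_zero_obj X /\
  forall Y Z, is_biproduct Y Z X -> is_zero_obj Y \/ is_zero_obj Z.

Definition finitary_cat : Prop :=
  [/\ additive_cat, split_idempotents,
      exists (n : nat) (I : 'I_n -> L),
        forall X, indecomposable X -> exists i, isomorphic X (I i) &
      forall X Y, exists n, inhabited (Vector.axiom n (arr X Y))].

End LinCatTheory.

Record linFunctor (k : fieldType) (L L' : linCat k) := LinFunctor {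
  fobj :> L -> L';
  fmap : forall X Y, arr X Y -> arr (fobj X) (fobj Y);
  fmapP : forall X Y (a : k) (f g : arr X Y), fmap (a *: f + g) = a *: fmap f + fmap g;
  fmap1 : forall X, fmap (idm X) = idm (fobj X);
  fmapM : forall X Y Z (g : arr Y Z) (f : arr X Y), fmap (g \o1 f) = fmap g \o1 fmap f }.
Arguments fmap {k L L'} l {X Y} _.

(** The functors are given by their actions on morphisms, so that identities and
    composites need not be packaged as [linFunctor]s. *)
Definition nat_iso_to (k : fieldType) (L L' : linCat k) (F G : L -> L')
    (Fm : forall X Y, arr X Y -> arr (F X) (F Y))
    (Gm : forall X Y, arr X Y -> arr (G X) (G Y)) : Prop :=
  exists t : forall X, arr (F X) (G X),
    (forall X, is_iso (t X)) /\
    forall X Y (f : arr X Y), t Y \o1 Fm _ _ f = Gm _ _ f \o1 t X.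

Definition is_equivalence (k : fieldType) (L L' : linCat k) (F : linFunctor L L') : Prop :=
  exists G : linFunctor L' L,
    nat_iso_to (fun X Y (f : arr X Y) => fmap G (fmap F f)) (fun X Y f => f) /\
    nat_iso_to (fun X Y (f : arr X Y) => fmap F (fmap G f)) (fun X Y f => f).

(** 2-categories are strict: the coherence axioms [hcompA], [hcomp1l], [hcomp1r] say
    that horizontal composition of 2-morphisms is strictly associative and
    unital, up to transport along the equalities of 1-morphisms. *)

Record twoCat (k : fieldType) := TwoCat {
  ob :> Type;
  mor : ob -> ob -> linCat k;
  one : forall i, mor i i;
  comp1 : forall i j l, mor j l -> mor i j -> mor i l;
  hcomp : forall i j l (F F' : mor j l) (G G' : mor i j),
    arr F F' -> arr G G' -> arr (comp1 F G) (comp1 F' G');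
  hcompPl : forall i j l (F F' : mor j l) (G G' : mor i j) c
    (a a' : arr F F') (b : arr G G'),
    hcomp (c *: a + a') b = c *: hcomp a b + hcomp a' b;
  hcompPr : forall i j l (F F' : mor j l) (G G' : mor i j) c
    (a : arr F F') (b b' : arr G G'),
    hcomp a (c *: b + b') = c *: hcomp a b + hcomp a b';
  hcomp_id : forall i j l (F : mor j l) (G : mor i j),
    hcomp (idm F) (idm G) = idm (comp1 F G);
  interchange : forall i j l (F F' F'' : mor j l) (G G' G'' : mor i j)
    (a' : arr F' F'') (a : arr F F') (b' : arr G' G'') (b : arr G G'),
    hcomp (a' \o1 a) (b' \o1 b) = hcomp a' b' \o1 hcomp a b;
  comp1A : forall i j l m (F : mor l m) (G : mor j l) (H : mor i j),
    comp1 F (comp1 G H) = comp1 (comp1 F G) H;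
  comp1_1l : forall i j (F : mor i j), comp1 (one j) F = F;
  comp1_1r : forall i j (F : mor i j), comp1 F (one i) = F;
  hcompA : forall i j l m (F F' : mor l m) (G G' : mor j l) (H H' : mor i j)
    (a : arr F F') (b : arr G G') (c : arr H H'),
    eqhom (comp1A F' G' H') \o1 hcomp a (hcomp b c) =
    hcomp (hcomp a b) c \o1 eqhom (comp1A F G H);
  hcomp1l : forall i j (F F' : mor i j) (a : arr F F'),
    eqhom (comp1_1l F') \o1 hcomp (idm (one j)) a = a \o1 eqhom (comp1_1l F);
  hcomp1r : forall i j (F F' : mor i j) (a : arr F F'),
    eqhom (comp1_1r F') \o1 hcomp a (idm (one i)) = a \o1 eqhom (comp1_1r F) }.

Arguments mor {k t} _ _.
Arguments one {k t} i.
Arguments comp1 {k t i j l} _ _.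
Arguments hcomp {k t i j l F F' G G'} _ _.
Arguments comp1A {k t i j l m} F G H.
Arguments comp1_1l {k t i j} F.
Arguments comp1_1r {k t i j} F.
Notation "F ** G" := (comp1 F G) (at level 38, left associativity).
Notation "a \o0 b" := (hcomp a b) (at level 38, left associativity).

Definition finitary2 (k : fieldType) (C : twoCat k) : Prop :=
  [/\ finite_set [set: C],
      forall i j : C, finitary_cat (mor i j) &
      forall i : C, indecomposable (one i)].

Section TwoCatTheory.
Variables (k : fieldType) (C : twoCat k).

Section Bilin.
Variables (i j l : C) (F F' : mor j l) (G G' : mor i j).
Implicit Types (a : arr F F') (b : arr G G').
Lemma hcompDl a a' b : (a + a') \o0 b = a \o0 b + a' \o0 b.
Proof. by have := hcompPl 1 a a' b; rewrite !scale1r. Qed.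
Lemma hcompDr a b b' : a \o0 (b + b') = a \o0 b + a \o0 b'.
Proof. by have := hcompPr 1 a b b'; rewrite !scale1r. Qed.
Lemma hcomp0l b : (0 : arr F F') \o0 b = 0.
Proof. by apply: (@addrI _ (0 \o0 b)); rewrite -hcompDl !addr0. Qed.
Lemma hcomp0r a : a \o0 (0 : arr G G') = 0.
Proof. by apply: (@addrI _ (a \o0 0)); rewrite -hcompDr !addr0. Qed.
Lemma hcompZl c a b : (c *: a) \o0 b = c *: (a \o0 b).
Proof. by have := hcompPl c a 0 b; rewrite hcomp0l !addr0. Qed.
Lemma hcompZr c a b : a \o0 (c *: b) = c *: (a \o0 b).
Proof. by have := hcompPr c a b 0; rewrite hcomp0r !addr0. Qed.
Lemma hcompBl a a' b : (a - a') \o0 b = a \o0 b - a' \o0 b.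
Proof. by rewrite hcompDl -[- a']scaleN1r hcompZl scaleN1r. Qed.
Lemma hcompBr a b b' : a \o0 (b - b') = a \o0 b - a \o0 b'.
Proof. by rewrite hcompDr -[- b']scaleN1r hcompZr scaleN1r. Qed.
Lemma hcomp_suml I (r : seq I) (P : pred I) (f : I -> arr F F') b :
  (\sum_(x <- r | P x) f x) \o0 b = \sum_(x <- r | P x) (f x \o0 b).
Proof.
apply: (big_morph (fun u : arr F F' => u \o0 b)); last exact: hcomp0l.
by move=> u v; exact: hcompDl.
Qed.
Lemma hcomp_sumr I (r : seq I) (P : pred I) a (f : I -> arr G G') :
  a \o0 (\sum_(x <- r | P x) f x) = \sum_(x <- r | P x) (a \o0 f x).
Proof.
apply: (big_morph (fun u : arr G G' => a \o0 u)); last exact: hcomp0r.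
by move=> u v; exact: hcompDr.
Qed.
End Bilin.

Definition asc i j l m (F : mor l m) (G : mor j l) (H : mor i j) :
  arr (F ** (G ** H)) ((F ** G) ** H) := eqhom (comp1A F G H : _ = _ :> @mor k C i m).
Definition unl i j (F : mor i j) : arr (one j ** F) F :=
  eqhom (comp1_1l F : _ = _ :> @mor k C i j).
Definition unr i j (F : mor i j) : arr (F ** one i) F :=
  eqhom (comp1_1r F : _ = _ :> @mor k C i j).
End TwoCatTheory.

Section EqHom.
Variables (k : fieldType).

Section OneCat.
Variable L : linCat k.
Implicit Types X Y Z W : L.

Lemma eqhom_irr X (e : X = X) : eqhom e = idm X.
Proof. by rewrite (Prop_irrelevance e erefl). Qed.
Lemma eqhomK X Y (e : X = Y) : eqhom (esym e) \o1 eqhom e = idm X.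
Proof. by case: Y / e; exact: vcomp1l. Qed.
Lemma eqhomVK X Y (e : X = Y) : eqhom e \o1 eqhom (esym e) = idm Y.
Proof. by case: Y / e; exact: vcomp1l. Qed.
Lemma eqhom_iso X Y (e : X = Y) : is_iso (eqhom e).
Proof. by exists (eqhom (esym e)); rewrite eqhomK eqhomVK. Qed.

(** Equality of morphisms up to transport along equalities of objects. *)
Definition heq X Y X' Y' (f : arr X Y) (g : arr X' Y') : Prop :=
  exists (eX : X = X') (eY : Y = Y'), eqhom eY \o1 f = g \o1 eqhom eX.

Lemma heq_refl X Y (f : arr X Y) : heq f f.
Proof. by exists erefl, erefl; rewrite /= vcomp1l vcomp1r. Qed.
Lemma heq_eq X Y (f g : arr X Y) : heq f g -> f = g.
Proof. by case=> e [e']; rewrite !eqhom_irr vcomp1l vcomp1r. Qed.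
Lemma eq_heq X Y (f g : arr X Y) : f = g -> heq f g.
Proof. by move=> ->; exact: heq_refl. Qed.
Lemma heq_sym X Y X' Y' (f : arr X Y) (g : arr X' Y') : heq f g -> heq g f.
Proof.
case=> e [e']; case: X' / e g => g; case: Y' / e' g => g /=.
by rewrite vcomp1l vcomp1r => ->; exact: heq_refl.
Qed.
Lemma heq_trans X Y X' Y' X'' Y'' (f : arr X Y) (g : arr X' Y') (h : arr X'' Y'') :
  heq f g -> heq g h -> heq f h.
Proof.
case=> e [e']; case: X' / e g => g; case: Y' / e' g => g /=.
by rewrite vcomp1l vcomp1r => ->.
Qed.
Lemma heq_comp X Y Z X' Y' Z' (g : arr Y Z) (f : arr X Y) (g' : arr Y' Z') (f' : arr X' Y') :
  heq g g' -> heq f f' -> heq (g \o1 f) (g' \o1 f').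
Proof.
case=> e [e']; case: Y' / e g' f' => g' f'; case: Z' / e' g' => g' /=.
rewrite vcomp1l vcomp1r => -> {g}.
case=> e [e']; case: X' / e f' => f'; rewrite (Prop_irrelevance e' erefl) /=.
by rewrite vcomp1l vcomp1r => ->; exact: heq_refl.
Qed.
Lemma heq_idm X Y : X = Y -> heq (idm X) (idm Y).
Proof. by move=> ->; exact: heq_refl. Qed.
Lemma heq_eqhom X Y (e : X = Y) : heq (eqhom e) (idm X).
Proof. by case: Y / e; exact: heq_refl. Qed.
Lemma heq_eqhoml X Y Z (e : Y = Z) (f : arr X Y) : heq (eqhom e \o1 f) f.
Proof. by case: Z / e; rewrite /= vcomp1l; exact: heq_refl. Qed.
Lemma heq_eqhomr X Y Z (e : X = Y) (f : arr Y Z) : heq (f \o1 eqhom e) f.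
Proof. by case: Y / e f => f; rewrite /= vcomp1r; exact: heq_refl. Qed.
Lemma heq_zero X Y X' Y' (f : arr X Y) (g : arr X' Y') : heq f g -> f = 0 -> g = 0.
Proof.
case=> e [e']; case: X' / e g => g; case: Y' / e' g => g /=.
by rewrite vcomp1l vcomp1r => ->.
Qed.
Lemma heq_kernel X Y K X' Y' K' (u : arr X Y) (i : arr K X) (u' : arr X' Y')
    (i' : arr K' X') :
  heq u u' -> heq i i' -> is_kernel u i -> is_kernel u' i'.
Proof.
case=> e [e']; case: X' / e u' i' => u' i'; case: Y' / e' u' => u' /=.
rewrite vcomp1l vcomp1r => -> {u}.
case=> e [e']; case: K' / e i' => i'; rewrite (Prop_irrelevance e' erefl) /=.
by rewrite vcomp1l vcomp1r => ->.
Qed.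

Lemma kernel_mono X Y K (u : arr X Y) (i : arr K X) : is_kernel u i -> is_mono i.
Proof.
case=> ui0 ki Z v w vw.
have [|t [_ tP]] := ki Z (i \o1 v); first by rewrite vcompA ui0 vcomp0l.
by rewrite -(tP v erefl) -(tP w (esym vw)).
Qed.

Lemma mono_comp X Y Z (f : arr Y Z) (g : arr X Y) :
  is_mono f -> is_mono g -> is_mono (f \o1 g).
Proof. by move=> mf mg W u v; rewrite -!vcompA => /mf /mg. Qed.

Lemma kernel_lift X Y K (u : arr X Y) (i : arr K X) (ki : is_kernel u i)
    Z (v : arr Z X) (uv : u \o1 v = 0) : exists w : arr Z K, i \o1 w = v.
Proof. by case: ki => _ /(_ Z v uv) [w [wP _]]; exists w. Qed.

Definition klift X Y K (u : arr X Y) (i : arr K X) (ki : is_kernel u i)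
    Z (v : arr Z X) (uv : u \o1 v = 0) : arr Z K :=
  sval (cid (kernel_lift ki uv)).
Lemma kliftE X Y K (u : arr X Y) (i : arr K X) (ki : is_kernel u i)
    Z (v : arr Z X) (uv : u \o1 v = 0) : i \o1 klift ki uv = v.
Proof. by rewrite /klift; case: cid. Qed.
End OneCat.

Section TwoCat.
Variable C : twoCat k.

Lemma heq_hcomp (i j l : C) (F F' F1 F1' : mor j l) (G G' G1 G1' : mor i j)
    (a : arr F F') (b : arr G G') (a1 : arr F1 F1') (b1 : arr G1 G1') :
  heq a a1 -> heq b b1 -> heq (a \o0 b) (a1 \o0 b1).
Proof.
case=> e [e']; case: F1 / e a1 => a1; case: F1' / e' a1 => a1 /=.
rewrite vcomp1l vcomp1r => -> {a}.
case=> e [e']; case: G1 / e b1 => b1; case: G1' / e' b1 => b1 /=.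
by rewrite vcomp1l vcomp1r => ->; exact: heq_refl.
Qed.

Lemma heqA (i j l m : C) (F F' : mor l m) (G G' : mor j l) (H H' : mor i j)
    (a : arr F F') (b : arr G G') (c : arr H H') :
  heq (a \o0 (b \o0 c)) (a \o0 b \o0 c).
Proof. by exists (comp1A F G H), (comp1A F' G' H'); rewrite hcompA. Qed.
Lemma heq1l (i j : C) (F F' : mor i j) (a : arr F F') : heq (idm (one j) \o0 a) a.
Proof. by exists (comp1_1l F), (comp1_1l F'); rewrite hcomp1l. Qed.
Lemma heq1r (i j : C) (F F' : mor i j) (a : arr F F') : heq (a \o0 idm (one i)) a.
Proof. by exists (comp1_1r F), (comp1_1r F'); rewrite hcomp1r. Qed.
End TwoCat.
End EqHom.

(** The injective abelianization: an object [(X, n, Y, f)] stores only the [n]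
    entries that are not required to vanish. *)

Section Abelianization.
Variables (k : fieldType) (L : linCat k).

Record abObj := AbObj {
  abX : L;
  abn : nat;
  abY : 'I_abn -> L;
  abf : forall i, arr abX (abY i) }.

Lemma abObj_eq (V W : abObj) (e : abX V = abX W) (en : abn V = abn W)
    (eY : forall i, abY (cast_ord en i) = abY i) :
  (forall i, eqhom (eY i) \o1 (abf (cast_ord en i) \o1 eqhom e) = abf i) -> V = W.
Proof.
case: V W e en eY => [X n Y f] [X' n' Y' f'] /= e.
case: X' / e f' => f' en.
case: n' / en Y' f' => Y' f' eY.
have EY : Y' = Y by apply: funext => i; rewrite -(eY i) cast_ord_id.
case: Y / EY f eY => f eY H; congr AbObj; apply: functional_extensionality_dep => i.
have := H i; rewrite /= vcomp1r => <-.
move: (eY i); rewrite cast_ord_id => e.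
by rewrite eqhom_irr vcomp1l.
Qed.

Lemma abObj_heq (V W : abObj) (e : abX V = abX W) (en : abn V = abn W) :
  (forall i, heq (abf (cast_ord en i)) (@abf V i)) -> V = W.
Proof.
move=> H.
have eY i : abY (cast_ord en i) = abY i by case: (H i) => ? [].
apply: (abObj_eq (e := e) (en := en) (eY := eY)) => i; apply: heq_eq.
apply: heq_trans (heq_eqhoml _ _) _; apply: heq_trans (heq_eqhomr _ _) _; exact: H.
Qed.

Record abTuple (V W : abObj) := AbTuple {
  tg : arr (abX V) (abX W);
  th : forall i j, arr (@abY V i) (@abY W j);
  tP : forall j, @abf W j \o1 tg = \sum_i th i j \o1 @abf V i }.

Definition abnull (V W : abObj) (g : arr (abX V) (abX W)) : Prop :=
  exists q : forall i, arr (@abY V i) (abX W), \sum_i q i \o1 @abf V i = g.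

Section Null.
Variables V W : abObj.
Implicit Types g : arr (abX V) (abX W).
Lemma abnull0 : @abnull V W 0.
Proof. by exists (fun=> 0); apply: big1 => i _; rewrite vcomp0l. Qed.
Lemma abnullP a g g' : abnull g -> abnull g' -> abnull (a *: g + g').
Proof.
case=> q <- [q' <-]; exists (fun i => a *: q i + q' i).
by rewrite scaler_sumr -big_split; apply: eq_bigr => i _; rewrite vcompPl.
Qed.
Lemma abnullD g g' : abnull g -> abnull g' -> abnull (g + g').
Proof. by move=> h h'; rewrite -[g]scale1r; exact: abnullP. Qed.
Lemma abnullZ a g : abnull g -> abnull (a *: g).
Proof. by move=> h; rewrite -[_ *: _]addr0; apply: abnullP => //; exact: abnull0. Qed.
Lemma abnullN g : abnull g -> abnull (- g).
Proof. by rewrite -scaleN1r; exact: abnullZ. Qed.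
End Null.

Lemma abnull_compl U V W (g : arr (abX V) (abX W)) (t : abTuple U V) :
  abnull g -> @abnull U W (g \o1 tg t).
Proof.
case=> q <-; exists (fun i => \sum_j q j \o1 th t i j).
transitivity (\sum_i \sum_j q j \o1 (th t i j \o1 @abf U i)).
  apply: eq_bigr => i _; rewrite vcomp_suml.
  by apply: eq_bigr => j _; rewrite vcompA.
rewrite exchange_big vcomp_suml; apply: eq_bigr => j _.
by rewrite -vcompA tP vcomp_sumr.
Qed.
Lemma abnull_compr U V W (g : arr (abX V) (abX W)) (g' : arr (abX U) (abX V)) :
  @abnull U V g' -> @abnull U W (g \o1 g').
Proof.
case=> q <-; exists (fun i => g \o1 q i).
by rewrite vcomp_sumr; apply: eq_bigr => i _; rewrite vcompA.
Qed.

Section Arr.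
Variables V W : abObj.

HB.instance Definition _ := gen_eqMixin (abTuple V W).
HB.instance Definition _ := gen_choiceMixin (abTuple V W).

Definition abrel (s t : abTuple V W) : bool := `[< abnull (tg s - tg t) >].
Lemma abrel_refl : reflexive abrel.
Proof. by move=> s; apply/asboolP; rewrite subrr; exact: abnull0. Qed.
Lemma abrel_sym : symmetric abrel.
Proof.
by move=> s t; apply/asboolP/asboolP => h; rewrite -opprB; exact: abnullN.
Qed.
Lemma abrel_trans : transitive abrel.
Proof.
move=> s t u /asboolP h /asboolP h'; apply/asboolP.
by rewrite -(subrK (tg s) (tg t)) -addrA; exact: abnullD.
Qed.
Canonical abequiv := EquivRel abrel abrel_refl abrel_sym abrel_trans.

Definition abHom : Type := {eq_quot abequiv}.
HB.instance Definition _ := Choice.on abHom.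

Definition abcl (t : abTuple V W) : abHom := \pi_{eq_quot abequiv} t.
Definition abrep (x : abHom) : abTuple V W := repr (x : {eq_quot abequiv}).
Definition abg (x : abHom) : arr (abX V) (abX W) := tg (abrep x).

Lemma abrepK x : abcl (abrep x) = x. Proof. exact: reprK. Qed.
Lemma abclP s t : abcl s = abcl t <-> abnull (tg s - tg t).
Proof. by split=> [/eqmodP /asboolP | h]; last by apply/eqmodP/asboolP. Qed.
Lemma abgK t : abnull (abg (abcl t) - tg t).
Proof. by apply/abclP; rewrite abrepK. Qed.
Lemma abcl_eq s t : tg s = tg t -> abcl s = abcl t.
Proof. by move=> h; apply/abclP; rewrite h subrr; exact: abnull0. Qed.
Lemma abHomP (x y : abHom) : x = y <-> abnull (abg x - abg y).
Proof. by rewrite -[x in x = _]abrepK -[y in _ = y]abrepK abclP. Qed.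

Lemma tlin_subproof a (s t : abTuple V W) j :
  @abf W j \o1 (a *: tg s + tg t) = \sum_i (a *: th s i j + th t i j) \o1 @abf V i.
Proof.
rewrite vcompPr !tP scaler_sumr -big_split.
by apply: eq_bigr => i _; rewrite vcompPl.
Qed.
Definition tlin a s t : abTuple V W := AbTuple (tlin_subproof a s t).

Lemma tzero_subproof j : @abf W j \o1 (0 : arr (abX V) _) = \sum_i 0 \o1 @abf V i.
Proof. by rewrite vcomp0r big1 // => i _; rewrite vcomp0l. Qed.
Definition tzero : abTuple V W := AbTuple tzero_subproof.

Definition abadd (x y : abHom) : abHom := abcl (tlin 1 (abrep x) (abrep y)).
Definition abzero : abHom := abcl tzero.
Definition abscale a (x : abHom) : abHom := abcl (tlin a (abrep x) tzero).
Definition abopp (x : abHom) : abHom := abscale (-1) x.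

Lemma abadd_cl s t : abadd (abcl s) (abcl t) = abcl (tlin 1 s t).
Proof.
apply/abclP; rewrite /= !scale1r opprD addrACA.
by apply: abnullD; exact: abgK.
Qed.
Lemma abscale_cl a s : abscale a (abcl s) = abcl (tlin a s tzero).
Proof.
by apply/abclP; rewrite /= !addr0 -scalerBr; apply: abnullZ; exact: abgK.
Qed.

Lemma abaddA : associative abadd.
Proof.
move=> x y z; rewrite -[x]abrepK -[y]abrepK -[z]abrepK !abadd_cl.
by apply: abcl_eq; rewrite /= !scale1r addrA.
Qed.
Lemma abaddC : commutative abadd.
Proof. by move=> x y; apply: abcl_eq; rewrite /= !scale1r addrC. Qed.
Lemma abadd0 : left_id abzero abadd.
Proof.
by move=> x; rewrite -[x]abrepK abadd_cl; apply: abcl_eq; rewrite /= scaler0 add0r.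
Qed.
Lemma abaddN : left_inverse abzero abopp abadd.
Proof.
move=> x; rewrite -[x]abrepK /abopp abscale_cl abadd_cl.
by apply: abcl_eq; rewrite /= addr0 scaleN1r scalerN scale1r addNr.
Qed.
HB.instance Definition _ := GRing.isZmodule.Build abHom abaddA abaddC abadd0 abaddN.

Lemma abaddE s t : abcl s + abcl t = abcl (tlin 1 s t).
Proof. exact: abadd_cl. Qed.

Lemma abscaleA a b (x : abHom) : abscale a (abscale b x) = abscale (a * b) x.
Proof.
rewrite -[x]abrepK !abscale_cl; apply: abcl_eq.
by rewrite /= !addr0 scalerA.
Qed.
Lemma abscale1 : left_id 1 abscale.
Proof.
by move=> x; rewrite -[x]abrepK abscale_cl; apply: abcl_eq; rewrite /= addr0 scale1r.
Qed.
Lemma abscaleDr : right_distributive abscale +%R.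
Proof.
move=> a x y; rewrite -[x]abrepK -[y]abrepK.
rewrite !(abscale_cl, abaddE).
by apply: abcl_eq; rewrite /= !addr0 !scale1r scalerDr.
Qed.
Lemma abscaleDl x : {morph abscale^~ x : a b / a + b}.
Proof.
move=> a b; rewrite -[x]abrepK.
rewrite !(abscale_cl, abaddE).
by apply: abcl_eq; rewrite /= !addr0 !scale1r scalerDl.
Qed.
HB.instance Definition _ :=
  GRing.Zmodule_isLmodule.Build k abHom abscaleA abscale1 abscaleDr abscaleDl.

Lemma ablin a (s t : abTuple V W) : a *: abcl s + abcl t = abcl (tlin a s t).
Proof.
rewrite -[a *: _]/(abscale _ _) abscale_cl abaddE.
by apply: abcl_eq; rewrite /= addr0 scale1r.
Qed.
Lemma ab0E : (0 : abHom) = abcl tzero. Proof. by []. Qed.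
End Arr.

Definition cdelta n (Y : 'I_n -> L) (i j : 'I_n) : arr (Y i) (Y j) :=
  if eqP is ReflectT e then eqhom (congr1 Y e) else 0.
Lemma cdelta_sum n X (Y : 'I_n -> L) (f : forall i, arr X (Y i)) j :
  \sum_i cdelta Y i j \o1 f i = f j.
Proof.
rewrite (bigD1 j) //= big1 ?addr0 => [|i ij]; rewrite /cdelta; case: eqP => e //.
- by rewrite eqhom_irr vcomp1l.
- by rewrite e eqxx in ij.
- by rewrite vcomp0l.
Qed.

Lemma tid_subproof V j :
  @abf V j \o1 idm (abX V) = \sum_i cdelta (@abY V) i j \o1 @abf V i.
Proof. by rewrite vcomp1r cdelta_sum. Qed.
Definition tid V : abTuple V V := AbTuple (@tid_subproof V).

Lemma tcomp_subproof U V W (t : abTuple V W) (s : abTuple U V) j :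
  @abf W j \o1 (tg t \o1 tg s) =
  \sum_i (\sum_l th t l j \o1 th s i l) \o1 @abf U i.
Proof.
rewrite vcompA tP vcomp_suml.
transitivity (\sum_l \sum_i th t l j \o1 (th s i l \o1 @abf U i)).
  by apply: eq_bigr => l _; rewrite -vcompA tP vcomp_sumr.
rewrite exchange_big; apply: eq_bigr => i _; rewrite vcomp_suml.
by apply: eq_bigr => l _; rewrite vcompA.
Qed.
Definition tcomp U V W (t : abTuple V W) (s : abTuple U V) : abTuple U W :=
  AbTuple (tcomp_subproof t s).

Definition abcomp U V W (y : abHom V W) (x : abHom U V) : abHom U W :=
  abcl (tcomp (abrep y) (abrep x)).

Lemma abcomp_cl U V W (t : abTuple V W) (s : abTuple U V) :
  abcomp (abcl t) (abcl s) = abcl (tcomp t s).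
Proof.
apply/abclP => /=; set t' := abrep _; set s' := abrep _.
have -> : tg t' \o1 tg s' - tg t \o1 tg s =
    (tg t' - tg t) \o1 tg s' + tg t \o1 (tg s' - tg s).
  by rewrite vcompBl vcompBr addrA subrK.
by apply: abnullD; [apply: abnull_compl | apply: abnull_compr]; exact: abgK.
Qed.

Lemma abcompPl U V W a (y y' : abHom V W) (x : abHom U V) :
  abcomp (a *: y + y') x = a *: abcomp y x + abcomp y' x.
Proof.
rewrite -[x]abrepK -[y]abrepK -[y']abrepK ?(ablin, abcomp_cl).
by apply: abcl_eq; exact: vcompPl.
Qed.
Lemma abcompPr U V W a (y : abHom V W) (x x' : abHom U V) :
  abcomp y (a *: x + x') = a *: abcomp y x + abcomp y x'.
Proof.
rewrite -[x]abrepK -[y]abrepK -[x']abrepK ?(ablin, abcomp_cl).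
by apply: abcl_eq; exact: vcompPr.
Qed.
Lemma abcompA U V W Z (z : abHom W Z) (y : abHom V W) (x : abHom U V) :
  abcomp z (abcomp y x) = abcomp (abcomp z y) x.
Proof.
rewrite -[x]abrepK -[y]abrepK -[z]abrepK !abcomp_cl.
by apply: abcl_eq; exact: vcompA.
Qed.
Lemma abcomp1l V W (x : abHom V W) : abcomp (abcl (tid W)) x = x.
Proof. by rewrite -[x]abrepK abcomp_cl; apply: abcl_eq; exact: vcomp1l. Qed.
Lemma abcomp1r V W (x : abHom V W) : abcomp x (abcl (tid V)) = x.
Proof. by rewrite -[x]abrepK abcomp_cl; apply: abcl_eq; exact: vcomp1r. Qed.

Definition abCat : linCat k :=
  LinCat abcompPl abcompPr abcompA abcomp1l abcomp1r.

Lemma abcompE (U V W : abCat) (t : abTuple V W) (s : abTuple U V) :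
  (abcl t : arr (V : abCat) W) \o1 (abcl s : arr (U : abCat) V) = abcl (tcomp t s).
Proof. exact: abcomp_cl. Qed.

Lemma abeqhomE (V W : abCat) (e : V = W) :
  exists2 t : abTuple V W,
    (eqhom e : abHom V W) = abcl t & tg t = eqhom (congr1 abX e).
Proof. by case: W / e; exists (tid V). Qed.

Lemma abX_irr (V W : abCat) (e : V = W) (e' : abX V = abX W) :
  exists2 t : abTuple V W, (eqhom e : abHom V W) = abcl t & tg t = eqhom e'.
Proof. by rewrite (Prop_irrelevance e' (congr1 abX e)); exact: abeqhomE. Qed.

End Abelianization.
Arguments AbObj {k L} abX abn abY abf.

Lemma split_lshift m n (a : 'I_m) : split (lshift n a) = inl a.
Proof. exact: (@unsplitK m n (inl a)). Qed.
Lemma split_rshift m n (b : 'I_n) : split (rshift m b) = inr b.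
Proof. exact: (@unsplitK m n (inr b)). Qed.
Lemma sum_split (V : zmodType) m n (F : 'I_m + 'I_n -> V) :
  \sum_(i < m + n) F (split i) = \sum_a F (inl a) + \sum_b F (inr b).
Proof.
rewrite big_split_ord /=; congr (_ + _); apply: eq_bigr => i _.
  by rewrite split_lshift.
by rewrite split_rshift.
Qed.

Section Emb.
Variables (k : fieldType) (L : linCat k).
Definition abEmb (X : L) : abObj L := AbObj X 0 (fun=> X) (fun=> 0).

(** The kernel of [t : V -> W] adjoins the component [tg t] to the entries of [V]. *)
Section Kernel.
Variables (V W : abObj L) (t : abTuple V W).
Definition kerY (s : 'I_(abn V) + 'I_1) : L :=
  match s with inl a => abY a | inr _ => abX W end.
Definition kerf (s : 'I_(abn V) + 'I_1) : arr (abX V) (kerY s) :=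
  match s with inl a => abf a | inr _ => tg t end.
Definition abKer : abObj L :=
  AbObj (abX V) (abn V + 1) (fun i => kerY (split i)) (fun i => kerf (split i)).
Definition kerh (s : 'I_(abn V) + 'I_1) j : arr (kerY s) (@abY _ _ V j) :=
  match s with inl a => cdelta (@abY _ _ V) a j | inr _ => 0 end.
Lemma keri_subproof j :
  @abf _ _ V j \o1 idm _ = \sum_i kerh (split i) j \o1 @abf _ _ abKer i.
Proof.
rewrite (sum_split (fun s => kerh s j \o1 kerf s)) big_ord1 /= vcomp0l addr0.
by rewrite vcomp1r cdelta_sum.
Qed.
Definition kertup : abTuple abKer V :=
  @AbTuple _ _ abKer V (idm _) (fun i j => kerh (split i) j) keri_subproof.
End Kernel.

Lemma abnull_ker (V W : abObj L) (t : abTuple V W) : @abnull _ _ (abKer t) W (tg t).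
Proof.
pose q (s : 'I_(abn V) + 'I_1) : arr (kerY W s) (abX W) :=
  match s with inl a => 0 | inr _ => idm _ end.
exists (fun i => q (split i)).
rewrite (sum_split (fun s => q s \o1 kerf t s)) big_ord1 /= vcomp1l.
by rewrite big1 ?add0r // => i _; rewrite vcomp0l.
Qed.

Definition abker (V W : abCat L) (u : arr V W) : abCat L := abKer (abrep u).
Definition abkeri (V W : abCat L) (u : arr V W) : arr (abker u) V := abcl (kertup (abrep u)).
End Emb.

Section Ab2.
Variables (k : fieldType) (C : twoCat k).

Section Comp1.
Variables (i j l : C) (V : abObj (mor j l)) (V' : abObj (mor i j)).
Definition compY (s : 'I_(abn V') + 'I_(abn V)) : mor i l :=
  match s with inl a => abX V ** abY a | inr b => abY b ** abX V' end.
Definition compf (s : 'I_(abn V') + 'I_(abn V)) : arr (abX V ** abX V') (compY s) :=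
  match s with inl a => idm _ \o0 abf a | inr b => abf b \o0 idm _ end.
Definition abcomp1 : abObj (mor i l) :=
  AbObj (abX V ** abX V') (abn V' + abn V)
    (fun x => compY (split x)) (fun x => compf (split x)).

Lemma abnull_comp1 (W : abObj (mor i l)) (g : arr (abX V ** abX V') (abX W))
    (q' : forall a, arr (abX V ** @abY _ _ V' a) (abX W))
    (q : forall b, arr (@abY _ _ V b ** abX V') (abX W)) :
  \sum_a q' a \o1 (idm _ \o0 abf a) + \sum_b q b \o1 (abf b \o0 idm _) = g ->
  @abnull _ _ abcomp1 W g.
Proof.
pose p (s : 'I_(abn V') + 'I_(abn V)) : arr (compY s) (abX W) :=
  match s with inl a => q' a | inr b => q b end.
move=> <-; exists (fun x => p (split x)).
exact: (sum_split (fun s => p s \o1 compf s)).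
Qed.
End Comp1.

Section HComp.
Variables (i j l : C) (V W : abObj (mor j l)) (V' W' : abObj (mor i j)).
Definition hcomph (t : abTuple V W) (t' : abTuple V' W') s s' :
    arr (compY s) (compY s') :=
  match s, s' with
  | inl a, inl a' => tg t \o0 th t' a a'
  | inr b, inr b' => th t b b' \o0 tg t'
  | _, _ => 0
  end.
Lemma thcomp_subproof (t : abTuple V W) (t' : abTuple V' W') y :
  @abf _ _ (abcomp1 W W') y \o1 (tg t \o0 tg t') =
  \sum_x hcomph t t' (split x) (split y) \o1 @abf _ _ (abcomp1 V V') x.
Proof.
rewrite (sum_split (fun s => hcomph t t' s (split y) \o1 compf s)) /=.
case: (split y) => [a|b] /=; rewrite -interchange.
- rewrite vcomp1l tP hcomp_sumr [X in _ + X]big1 => [|b _]; last exact: vcomp0l.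
  by rewrite addr0; apply: eq_bigr => x _; rewrite -interchange vcomp1r.
- rewrite vcomp1l tP hcomp_suml [X in X + _]big1 => [|a _]; last exact: vcomp0l.
  by rewrite add0r; apply: eq_bigr => x _; rewrite -interchange vcomp1r.
Qed.
Definition thcomp (t : abTuple V W) (t' : abTuple V' W') :
  abTuple (abcomp1 V V') (abcomp1 W W') :=
  @AbTuple _ _ (abcomp1 V V') (abcomp1 W W') (tg t \o0 tg t')
    (fun x y => hcomph t t' (split x) (split y)) (thcomp_subproof t t').

Definition abhcomp (x : abHom V W) (x' : abHom V' W') :
  abHom (abcomp1 V V') (abcomp1 W W') := abcl (thcomp (abrep x) (abrep x')).

Lemma abnull_hl g (g' : arr (abX V') (abX W')) :
  @abnull _ _ V W g -> @abnull _ _ (abcomp1 V V') (abcomp1 W W') (g \o0 g').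
Proof.
case=> q <-; apply: (abnull_comp1 (W := abcomp1 W W') (q' := fun=> 0) (q := fun b => q b \o0 g')).
rewrite big1 ?add0r => [|a _]; last exact: vcomp0l.
by rewrite hcomp_suml; apply: eq_bigr => x _; rewrite -interchange vcomp1r.
Qed.
Lemma abnull_hr (g : arr (abX V) (abX W)) g' :
  @abnull _ _ V' W' g' -> @abnull _ _ (abcomp1 V V') (abcomp1 W W') (g \o0 g').
Proof.
case=> q <-; apply: (abnull_comp1 (W := abcomp1 W W') (q' := fun b => g \o0 q b) (q := fun=> 0)).
rewrite [X in _ + X]big1 ?addr0 => [|a _]; last exact: vcomp0l.
by rewrite hcomp_sumr; apply: eq_bigr => x _; rewrite -interchange vcomp1r.
Qed.

Lemma abhcomp_cl (t : abTuple V W) (t' : abTuple V' W') :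
  abhcomp (abcl t) (abcl t') = abcl (thcomp t t').
Proof.
apply/abclP => /=; set s := abrep _; set s' := abrep _.
have -> : tg s \o0 tg s' - tg t \o0 tg t' =
    (tg s - tg t) \o0 tg s' + tg t \o0 (tg s' - tg t').
  by rewrite hcompBl hcompBr addrA subrK.
by apply: abnullD; [apply: abnull_hl | apply: abnull_hr]; exact: abgK.
Qed.

Lemma abhcompPl c (x y : abHom V W) (z : abHom V' W') :
  abhcomp (c *: x + y) z = c *: abhcomp x z + abhcomp y z.
Proof.
rewrite -[x]abrepK -[y]abrepK -[z]abrepK ?(ablin, abhcomp_cl).
by apply: abcl_eq; exact: hcompPl.
Qed.
Lemma abhcompPr c (x : abHom V W) (y z : abHom V' W') :
  abhcomp x (c *: y + z) = c *: abhcomp x y + abhcomp x z.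
Proof.
rewrite -[x]abrepK -[y]abrepK -[z]abrepK ?(ablin, abhcomp_cl).
by apply: abcl_eq; exact: hcompPr.
Qed.
End HComp.

Lemma abhcomp_id (i j l : C) (V : abCat (mor j l)) (V' : abCat (mor i j)) :
  abhcomp (idm V) (idm V') = idm (abcomp1 V V' : abCat (mor i l)).
Proof. by rewrite abhcomp_cl; apply: abcl_eq; exact: hcomp_id. Qed.

Lemma abinterchange (i j l : C) (V W U : abCat (mor j l)) (V' W' U' : abCat (mor i j))
    (y : arr W U) (x : arr V W) (y' : arr W' U') (x' : arr V' W') :
  abhcomp (y \o1 x) (y' \o1 x') =
  (abhcomp y y' : arr (abcomp1 W W' : abCat _) (abcomp1 U U')) \o1
  (abhcomp x x' : arr (abcomp1 V V' : abCat _) (abcomp1 W W')).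
Proof.
rewrite -[y]abrepK -[x]abrepK -[y']abrepK -[x']abrepK.
rewrite !(abcompE, abhcomp_cl).
by apply: abcl_eq; exact: interchange.
Qed.

Lemma abcomp1A (i j l m : C) (V : abObj (mor l m)) (V' : abObj (mor j l))
    (V'' : abObj (mor i j)) :
  abcomp1 V (abcomp1 V' V'') = abcomp1 (abcomp1 V V') V''.
Proof.
apply: (@abObj_heq _ _ (abcomp1 V (abcomp1 V' V'')) (abcomp1 (abcomp1 V V') V'')
  (comp1A _ _ _) (esym (addnA _ _ _))) => /= x.
case: (split_ordP x) => y -> /=; last first.
  have -> : cast_ord (esym (addnA (abn V'') (abn V') (abn V))) (rshift _ y) =
            rshift _ (rshift _ y) by apply: val_inj; rewrite /= addnA.
  rewrite !(split_lshift, split_rshift) /= ?(split_lshift, split_rshift) /=.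
  apply: heq_sym; apply: heq_trans _ (heqA _ _ _).
  by rewrite hcomp_id; exact: heq_refl.
case: (split_ordP y) => z -> /=.
  have -> : cast_ord (esym (addnA (abn V'') (abn V') (abn V))) (lshift _ (lshift _ z)) =
            lshift _ z by apply: val_inj.
  rewrite !(split_lshift, split_rshift) /= ?(split_lshift, split_rshift) /=.
  apply: heq_sym; apply: heq_trans (heqA _ _ _) _.
  by rewrite hcomp_id; exact: heq_refl.
have -> : cast_ord (esym (addnA (abn V'') (abn V') (abn V))) (lshift _ (rshift _ z)) =
          rshift _ (lshift _ z) by apply: val_inj.
rewrite !(split_lshift, split_rshift) /= ?(split_lshift, split_rshift) /=.
by apply: heq_sym; exact: heqA.
Qed.

Lemma abcomp1_1l (i j : C) (V : abObj (mor i j)) : abcomp1 (abEmb (one j)) V = V.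
Proof.
apply: (@abObj_heq _ _ (abcomp1 (abEmb (one j)) V) V (comp1_1l _) (addn0 _)) => /= x.
case: (split_ordP x) => [y -> | []//] /=; rewrite ?split_lshift /=.
have -> : cast_ord (addn0 (abn V)) (lshift 0 y) = y by apply: val_inj.
by apply: heq_sym; exact: heq1l.
Qed.
Lemma abcomp1_1r (i j : C) (V : abObj (mor i j)) : abcomp1 V (abEmb (one i)) = V.
Proof.
apply: (@abObj_heq _ _ (abcomp1 V (abEmb (one i))) V (comp1_1r _) (add0n _)) => /= x.
case: (split_ordP x) => [[]// | y ->] /=; rewrite ?split_rshift /=.
have -> : cast_ord (add0n (abn V)) (rshift 0 y) = y by apply: val_inj.
by apply: heq_sym; exact: heq1r.
Qed.

Definition abc1 (i j l : C) (V : abCat (mor j l)) (V' : abCat (mor i j)) :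
  abCat (mor i l) := abcomp1 V V'.
Definition abh (i j l : C) (V W : abCat (mor j l)) (V' W' : abCat (mor i j))
  (x : arr V W) (x' : arr V' W') : arr (abc1 V V') (abc1 W W') := abhcomp x x'.
Lemma abhE (i j l : C) (V W : abCat (mor j l)) (V' W' : abCat (mor i j))
    (t : abTuple V W) (t' : abTuple V' W') :
  abh (abcl t : arr V W) (abcl t' : arr V' W') = abcl (thcomp t t').
Proof. exact: abhcomp_cl. Qed.
Definition abone (i : C) : abCat (mor i i) := abEmb (one i).
Definition abc1A (i j l m : C) (V : abCat (mor l m)) (V' : abCat (mor j l))
    (V'' : abCat (mor i j)) : abc1 V (abc1 V' V'') = abc1 (abc1 V V') V'' :=
  abcomp1A V V' V''.
Definition abc1_1l (i j : C) (V : abCat (mor i j)) : abc1 (abone j) V = V :=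
  abcomp1_1l V.
Definition abc1_1r (i j : C) (V : abCat (mor i j)) : abc1 V (abone i) = V :=
  abcomp1_1r V.

Lemma abhcompA (i j l m : C) (V W : abCat (mor l m)) (V' W' : abCat (mor j l))
    (V'' W'' : abCat (mor i j)) (x : arr V W) (x' : arr V' W') (x'' : arr V'' W'') :
  eqhom (abc1A W W' W'') \o1 abh x (abh x' x'') =
  abh (abh x x') x'' \o1 eqhom (abc1A V V' V'').
Proof.
have [e -> eE] := abX_irr (abc1A W W' W'') (comp1A (abX W) (abX W') (abX W'')).
have [e' -> eE'] := abX_irr (abc1A V V' V'') (comp1A (abX V) (abX V') (abX V'')).
rewrite -[x]abrepK -[x']abrepK -[x'']abrepK !abhE !abcompE.
by apply: abcl_eq; rewrite /= eE eE'; exact: hcompA.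
Qed.

Lemma abhcomp1l (i j : C) (V W : abCat (mor i j)) (x : arr V W) :
  eqhom (abc1_1l W) \o1 abh (idm (abone j)) x = x \o1 eqhom (abc1_1l V).
Proof.
have [e -> eE] := abX_irr (abc1_1l W) (comp1_1l (abX W)).
have [e' -> eE'] := abX_irr (abc1_1l V) (comp1_1l (abX V)).
rewrite -[x]abrepK abhE !abcompE.
by apply: abcl_eq; rewrite /= eE eE'; exact: hcomp1l.
Qed.
Lemma abhcomp1r (i j : C) (V W : abCat (mor i j)) (x : arr V W) :
  eqhom (abc1_1r W) \o1 abh x (idm (abone i)) = x \o1 eqhom (abc1_1r V).
Proof.
have [e -> eE] := abX_irr (abc1_1r W) (comp1_1r (abX W)).
have [e' -> eE'] := abX_irr (abc1_1r V) (comp1_1r (abX V)).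
rewrite -[x]abrepK abhE !abcompE.
by apply: abcl_eq; rewrite /= eE eE'; exact: hcomp1r.
Qed.

Definition ab2 : twoCat k := {|
  mor i j := abCat (mor i j);
  one := abone;
  comp1 := abc1;
  hcomp := abh;
  hcompPl := abhcompPl;
  hcompPr := abhcompPr;
  hcomp_id := abhcomp_id;
  interchange := abinterchange;
  comp1A := abc1A;
  comp1_1l := abc1_1l;
  comp1_1r := abc1_1r;
  hcompA := abhcompA;
  hcomp1l := abhcomp1l;
  hcomp1r := abhcomp1r |}.
End Ab2.

Section AbKernel.
Variables (k : fieldType) (L : linCat k).

Lemma ab_is_kernel (V W : abObj L) n Y f (t : abTuple V W)
    (s : abTuple (AbObj (abX V) n Y f) V) :
  tg s = idm (abX V) ->
  @abnull _ _ (AbObj (abX V) n Y f) W (tg t) ->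
  (forall T (v : abTuple T V), @abnull _ _ T W (tg t \o1 tg v) -> forall a,
     exists h : forall i, arr (@abY _ _ T i) (Y a), f a \o1 tg v = \sum_i h i \o1 @abf _ _ T i) ->
  @is_kernel _ (abCat L) V W (AbObj (abX V) n Y f) (abcl t) (abcl s).
Proof.
move=> s1 t0 lift; split.
  rewrite abcompE -[RHS]/(abcl (tzero _ _)); apply/abclP => /=.
  by rewrite subr0 s1 vcomp1r.
move=> T v; rewrite -[v]abrepK abcompE -[RHS]/(abcl (tzero _ _)) => /abclP /=.
rewrite subr0 => /lift {}lift.
pose h a := sval (cid (lift a)).
have hP a : f a \o1 tg (abrep v) = \sum_i h a i \o1 @abf _ _ T i by rewrite /h; case: cid.
pose w : abTuple T (AbObj (abX V) n Y f) :=
  @AbTuple _ _ T (AbObj (abX V) n Y f) (tg (abrep v)) (fun i a => h a i) hP.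
exists (abcl w); split.
  by apply: etrans (abcompE _ _) _; apply: abcl_eq; rewrite /= s1 vcomp1l.
move=> w'; rewrite -[w']abrepK => /(etrans (esym (abcompE _ _))) /abclP /= H.
apply/abclP => /=.
rewrite -opprB; apply: abnullN.
by move: H; rewrite s1 vcomp1l.
Qed.

Lemma abkerP (V W : abCat L) (u : arr V W) : is_kernel u (abkeri u).
Proof.
rewrite -[u in is_kernel u _]abrepK; apply: ab_is_kernel => //; first exact: abnull_ker.
move=> T v [q qP] a; case: (split a) => y /=.
  by exists (fun i => th v i y); exact: tP.
by exists q; rewrite qP.
Qed.
End AbKernel.

Section AbKernel2.
Variables (k : fieldType) (C : twoCat k).

Lemma tP_comp (i j l : C) (V : abObj (mor j l)) (V' : abObj (mor i j)) T
    (v : abTuple T (abcomp1 V V')) (s : 'I_(abn V') + 'I_(abn V)) :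
  exists h : forall x, arr (@abY _ _ T x) (compY s),
    compf s \o1 tg v = \sum_x h x \o1 @abf _ _ T x.
Proof.
by rewrite -(unsplitK s); exists (fun x => th v x (unsplit s)); exact: (tP v (unsplit s)).
Qed.

Lemma ab2_ker_l (i j l : C) (F : @mor _ (ab2 C) j l) (X Y : @mor _ (ab2 C) i j) (u : arr X Y) :
  is_kernel (idm F \o0 u) (idm F \o0 (abkeri u : arr (abker u : @mor _ (ab2 C) i j) X)).
Proof.
rewrite -[u in is_kernel (_ \o0 u) _]abrepK.
rewrite -[X in is_kernel X _]/(abh _ _) -[X in is_kernel _ X]/(abh _ _) !abhE.
apply: ab_is_kernel => //=; first exact: hcomp_id.
  by apply: (@abnull_hr _ _ _ _ _ F F (abKer (abrep u)) Y); exact: abnull_ker.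
move=> T v [q qP] a; case: (split a) => [b|b] /=; last exact: tP_comp v (inr b).
case: (split b) => c /=; last by exists q; rewrite qP.
exact: tP_comp v (inl c).
Qed.

Lemma ab2_ker_r (i j l : C) (F : @mor _ (ab2 C) i j) (X Y : @mor _ (ab2 C) j l) (u : arr X Y) :
  is_kernel (u \o0 idm F) ((abkeri u : arr (abker u : @mor _ (ab2 C) j l) X) \o0 idm F).
Proof.
rewrite -[u in is_kernel (u \o0 _) _]abrepK.
rewrite -[X in is_kernel X _]/(abh _ _) -[X in is_kernel _ X]/(abh _ _) !abhE.
apply: ab_is_kernel => //=; first exact: hcomp_id.
  by apply: (@abnull_hl _ _ _ _ _ (abKer (abrep u)) Y F F); exact: abnull_ker.
move=> T v [q qP] a; case: (split a) => [b|b] /=; first exact: tP_comp v (inl b).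
case: (split b) => c /=; last by exists q; rewrite qP.
exact: tP_comp v (inr c).
Qed.
End AbKernel2.

(** Preservation of the chosen kernels by composition with 1-morphisms on either
    side is what makes the cotensor product of bicomodules a bicomodule. *)
Record lexTwoCat (k : fieldType) := LexTwoCat {
  lex_twoCat :> twoCat k;
  kern : forall (i j : lex_twoCat) (X Y : mor i j), arr X Y -> mor i j;
  kerni : forall (i j : lex_twoCat) (X Y : mor i j) (u : arr X Y), arr (kern u) X;
  kerP : forall (i j : lex_twoCat) (X Y : mor i j) (u : arr X Y), is_kernel u (kerni u);
  ker_l : forall (i j l : lex_twoCat) (F : mor j l) (X Y : mor i j) (u : arr X Y),
    is_kernel (idm F \o0 u) (idm F \o0 kerni u);
  ker_r : forall (i j l : lex_twoCat) (F : mor i j) (X Y : mor j l) (u : arr X Y),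
    is_kernel (u \o0 idm F) (kerni u \o0 idm F) }.
Arguments kern {k C i j X Y} u : rename.
Arguments kerni {k C i j X Y} u : rename.

Definition abelianization (k : fieldType) (C : twoCat k) : lexTwoCat k :=
  @LexTwoCat k (ab2 C) (fun i j X Y u => @abker k (@mor _ C i j) X Y u)
    (fun i j X Y u => @abkeri k (@mor _ C i j) X Y u) (fun i j X Y u => abkerP u)
    (@ab2_ker_l k C) (@ab2_ker_r k C).

Record homStruct (k : fieldType) (L : linCat k) := HomStruct {
  carr : Type;
  forget : carr -> L;
  pres : forall X Y : carr, arr (forget X) (forget Y) -> Prop;
  pres0 : forall X Y, pres (0 : arr (forget X) (forget Y));
  presP : forall X Y a (f g : arr (forget X) (forget Y)),
    pres f -> pres g -> pres (a *: f + g);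
  pres1 : forall X, pres (idm (forget X));
  presM : forall X Y Z (g : arr (forget Y) (forget Z)) (f : arr (forget X) (forget Y)),
    pres g -> pres f -> pres (g \o1 f) }.

Section StructCat.
Variables (k : fieldType) (L : linCat k) (S : homStruct L).

Section Arr.
Variables X Y : carr S.
Record shom := SHom { shval :> arr (forget X) (forget Y); shvalP : pres shval }.
Lemma shom_inj (f g : shom) : shval f = shval g -> f = g.
Proof. by case: f g => f fP [g gP] /= e; case: g / e gP => gP; congr SHom. Qed.
HB.instance Definition _ := gen_eqMixin shom.
HB.instance Definition _ := gen_choiceMixin shom.
Definition slin a (f g : shom) : shom := SHom (presP a (shvalP f) (shvalP g)).
Definition szero : shom := SHom (pres0 X Y).
Definition sadd f g := slin 1 f g.
Definition sscale a f := slin a f szero.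
Definition sopp f := sscale (-1) f.
Lemma saddA : associative sadd.
Proof. by move=> f g h; apply: shom_inj; rewrite /= !scale1r addrA. Qed.
Lemma saddC : commutative sadd.
Proof. by move=> f g; apply: shom_inj; rewrite /= !scale1r addrC. Qed.
Lemma sadd0 : left_id szero sadd.
Proof. by move=> f; apply: shom_inj; rewrite /= scale1r add0r. Qed.
Lemma saddN : left_inverse szero sopp sadd.
Proof. by move=> f; apply: shom_inj; rewrite /= scale1r addr0 scaleN1r addNr. Qed.
HB.instance Definition _ := GRing.isZmodule.Build shom saddA saddC sadd0 saddN.
Lemma sscaleA a b f : sscale a (sscale b f) = sscale (a * b) f.
Proof. by apply: shom_inj; rewrite /= !addr0 scalerA. Qed.
Lemma sscale1 : left_id 1 sscale.
Proof. by move=> f; apply: shom_inj; rewrite /= addr0 scale1r. Qed.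
Lemma sscaleDr : right_distributive sscale +%R.
Proof. by move=> a f g; apply: shom_inj; rewrite /= !addr0 !scale1r scalerDr. Qed.
Lemma sscaleDl f : {morph sscale^~ f : a b / a + b}.
Proof. by move=> a b; apply: shom_inj; rewrite /= !addr0 scale1r scalerDl. Qed.
HB.instance Definition _ :=
  GRing.Zmodule_isLmodule.Build k shom sscaleA sscale1 sscaleDr sscaleDl.
Lemma shvalE a (f g : shom) : shval (a *: f + g) = a *: shval f + shval g.
Proof. by rewrite /= scale1r addr0. Qed.
End Arr.

Definition scomp X Y Z (g : shom Y Z) (f : shom X Y) : shom X Z :=
  SHom (presM (shvalP g) (shvalP f)).
Lemma scompPl X Y Z a (g g' : shom Y Z) (f : shom X Y) :
  scomp (a *: g + g') f = a *: scomp g f + scomp g' f.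
Proof. by apply: shom_inj; rewrite shvalE /= addr0 scale1r vcompPl. Qed.
Lemma scompPr X Y Z a (g : shom Y Z) (f f' : shom X Y) :
  scomp g (a *: f + f') = a *: scomp g f + scomp g f'.
Proof. by apply: shom_inj; rewrite shvalE /= addr0 scale1r vcompPr. Qed.
Lemma scompA X Y Z W (h : shom Z W) (g : shom Y Z) (f : shom X Y) :
  scomp h (scomp g f) = scomp (scomp h g) f.
Proof. by apply: shom_inj; exact: vcompA. Qed.
Lemma scomp1l X Y (f : shom X Y) : scomp (SHom (pres1 Y)) f = f.
Proof. by apply: shom_inj; exact: vcomp1l. Qed.
Lemma scomp1r X Y (f : shom X Y) : scomp f (SHom (pres1 X)) = f.
Proof. by apply: shom_inj; exact: vcomp1r. Qed.
Definition structCat : linCat k := LinCat scompPl scompPr scompA scomp1l scomp1r.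

Lemma shval_eqhom (X Y : structCat) (e : X = Y) :
  shval (eqhom e : shom X Y) = eqhom (congr1 (@forget _ _ S) e).
Proof. by case: Y / e. Qed.
End StructCat.
Arguments shval {k L S X Y}.

(** A 2-representation: a 2-functor from [C] to linear categories, given by its action
    [F, X |-> F . X] on 1-morphisms and objects together with the joint action on
    2-morphisms and morphisms; the natural transformation attached to
    [a : F -> F'] is [act2 a (idm X)]. *)

Record rep2 (k : fieldType) (C : twoCat k) := Rep2 {
  rcat :> C -> linCat k;
  act : forall i j, @mor k C i j -> rcat i -> rcat j;
  act2 : forall i j (F F' : mor i j) (X X' : rcat i),
    arr F F' -> arr X X' -> arr (act F X) (act F' X');
  act2Pl : forall i j (F F' : mor i j) (X X' : rcat i) c (a a' : arr F F') (f : arr X X'),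
    act2 (c *: a + a') f = c *: act2 a f + act2 a' f;
  act2Pr : forall i j (F F' : mor i j) (X X' : rcat i) c (a : arr F F') (f f' : arr X X'),
    act2 a (c *: f + f') = c *: act2 a f + act2 a f';
  act2_id : forall i j (F : mor i j) (X : rcat i), act2 (idm F) (idm X) = idm (act F X);
  act2M : forall i j (F F' F'' : mor i j) (X X' X'' : rcat i)
    (a' : arr F' F'') (a : arr F F') (f' : arr X' X'') (f : arr X X'),
    act2 (a' \o1 a) (f' \o1 f) = act2 a' f' \o1 act2 a f;
  actA : forall i j l (F : mor j l) (G : mor i j) (X : rcat i),
    act F (act G X) = act (F ** G) X;
  act1 : forall i (X : rcat i), act (one i) X = X;
  act2A : forall i j l (F F' : mor j l) (G G' : mor i j) (X X' : rcat i)
    (a : arr F F') (b : arr G G') (f : arr X X'),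
    eqhom (actA F' G' X') \o1 act2 a (act2 b f) =
    act2 (a \o0 b) f \o1 eqhom (actA F G X);
  act2_1 : forall i (X X' : rcat i) (f : arr X X'),
    eqhom (act1 X') \o1 act2 (idm (one i)) f = f \o1 eqhom (act1 X) }.
Arguments act {k C r i j} F X.
Arguments act2 {k C r i j F F' X X'} a f.
Arguments actA {k C r i j l} F G X.
Arguments act1 {k C r i} X.

Record repMor (k : fieldType) (C : twoCat k) (R R' : rep2 C) := RepMor {
  rfun :> forall i : C, linFunctor (R i) (R' i);
  rcomm : forall (i j : C) (F : mor i j) (X : R i), arr (rfun j (act F X)) (act F (rfun i X));
  rcomm_iso : forall (i j : C) (F : mor i j) (X : R i), is_iso (rcomm F X);
  rcomm_nat : forall (i j : C) (F F' : mor i j) (X X' : R i) (a : arr F F') (f : arr X X'),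
    rcomm F' X' \o1 fmap (rfun j) (act2 a f) = act2 a (fmap (rfun i) f) \o1 rcomm F X;
  rcommA : forall (i j l : C) (F : mor j l) (G : mor i j) (X : R i),
    rcomm (F ** G) X \o1 fmap (rfun l) (eqhom (actA F G X)) =
    eqhom (actA F G (rfun i X)) \o1 (act2 (idm F) (rcomm G X) \o1 rcomm F (act G X));
  rcomm1 : forall (i : C) (X : R i),
    eqhom (act1 (rfun i X)) \o1 rcomm (one i) X = fmap (rfun i) (eqhom (act1 X)) }.

Definition rep_equivalent (k : fieldType) (C : twoCat k) (R R' : rep2 C) : Prop :=
  exists Phi : repMor R R', forall i, is_equivalence (Phi i).

Section Comodules.
Variables (k : fieldType) (C : twoCat k).

Record coalg (i : C) := Coalg {
  cmor :> @mor k C i i;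
  comul : arr cmor (cmor ** cmor);
  counit : arr cmor (one i);
  coassoc : asc _ _ _ \o1 ((idm cmor \o0 comul) \o1 comul) =
            (comul \o0 idm cmor) \o1 comul;
  counitl : unl _ \o1 ((counit \o0 idm cmor) \o1 comul) = idm cmor;
  counitr : unr _ \o1 ((idm cmor \o0 counit) \o1 comul) = idm cmor }.
Arguments comul {i} c.
Arguments counit {i} c.

Definition is_rcoaction (i j : C) (A : coalg i) (X : mor i j) (rho : arr X (X ** A)) : Prop :=
  (rho \o0 idm A) \o1 rho = asc _ _ _ \o1 ((idm X \o0 comul A) \o1 rho) /\
  unr _ \o1 ((idm X \o0 counit A) \o1 rho) = idm X.
Definition is_lcoaction (i j : C) (A : coalg i) (X : mor j i) (lam : arr X (A ** X)) : Prop :=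
  asc _ _ _ \o1 ((idm A \o0 lam) \o1 lam) = (comul A \o0 idm X) \o1 lam /\
  unl _ \o1 ((counit A \o0 idm X) \o1 lam) = idm X.

Definition rcomod_hom (i j : C) (A : coalg i) (X Y : mor i j)
    (rX : arr X (X ** A)) (rY : arr Y (Y ** A)) (f : arr X Y) : Prop :=
  rY \o1 f = (f \o0 idm A) \o1 rX.
Definition lcomod_hom (i j : C) (A : coalg i) (X Y : mor j i)
    (lX : arr X (A ** X)) (lY : arr Y (A ** Y)) (f : arr X Y) : Prop :=
  lY \o1 f = (idm A \o0 f) \o1 lX.

Section HomClosed.
Variables (i j : C) (A : coalg i).
Section R.
Variables (X Y Z : mor i j) (rX : arr X (X ** A)) (rY : arr Y (Y ** A)) (rZ : arr Z (Z ** A)).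
Lemma rcomod_hom0 : rcomod_hom rX rY 0.
Proof. by rewrite /rcomod_hom vcomp0r hcomp0l vcomp0l. Qed.
Lemma rcomod_homP a f g :
  rcomod_hom rX rY f -> rcomod_hom rX rY g -> rcomod_hom rX rY (a *: f + g).
Proof. by rewrite /rcomod_hom vcompPr hcompPl vcompPl => -> ->. Qed.
Lemma rcomod_hom1 : rcomod_hom rX rX (idm X).
Proof. by rewrite /rcomod_hom hcomp_id vcomp1l vcomp1r. Qed.
Lemma rcomod_homM g f :
  rcomod_hom rY rZ g -> rcomod_hom rX rY f -> rcomod_hom rX rZ (g \o1 f).
Proof.
rewrite /rcomod_hom => gP fP; rewrite vcompA gP -vcompA fP vcompA.
by rewrite -interchange vcomp1l.
Qed.
End R.
Section L.
Variables (X Y Z : mor j i) (lX : arr X (A ** X)) (lY : arr Y (A ** Y)) (lZ : arr Z (A ** Z)).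
Lemma lcomod_hom0 : lcomod_hom lX lY 0.
Proof. by rewrite /lcomod_hom vcomp0r hcomp0r vcomp0l. Qed.
Lemma lcomod_homP a f g :
  lcomod_hom lX lY f -> lcomod_hom lX lY g -> lcomod_hom lX lY (a *: f + g).
Proof. by rewrite /lcomod_hom vcompPr hcompPr vcompPl => -> ->. Qed.
Lemma lcomod_hom1 : lcomod_hom lX lX (idm X).
Proof. by rewrite /lcomod_hom hcomp_id vcomp1l vcomp1r. Qed.
Lemma lcomod_homM g f :
  lcomod_hom lY lZ g -> lcomod_hom lX lY f -> lcomod_hom lX lZ (g \o1 f).
Proof.
rewrite /lcomod_hom => gP fP; rewrite vcompA gP -vcompA fP vcompA.
by rewrite -interchange vcomp1l.
Qed.
End L.
End HomClosed.

Record rcomod (i j : C) (A : coalg i) := RComod {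
  rcmor :> @mor k C i j;
  rho : arr rcmor (rcmor ** A);
  rhoP : is_rcoaction rho }.
Record lcomod (i j : C) (A : coalg i) := LComod {
  lcmor :> @mor k C j i;
  lam : arr lcmor (A ** lcmor);
  lamP : is_lcoaction lam }.
Record bicomod (i j : C) (A : coalg i) (B : coalg j) := BiComod {
  bcmor :> @mor k C j i;
  blam : arr bcmor (A ** bcmor);
  brho : arr bcmor (bcmor ** B);
  blamP : is_lcoaction blam;
  brhoP : is_rcoaction brho;
  bcommP : asc _ _ _ \o1 ((idm A \o0 brho) \o1 blam) = (blam \o0 idm B) \o1 brho }.

Definition rcomodStruct (i j : C) (A : coalg i) : homStruct (mor i j) := {|
  forget := @rcmor i j A;
  pres X Y f := rcomod_hom (rho X) (rho Y) f;
  pres0 X Y := rcomod_hom0 (rho X) (rho Y);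
  presP X Y := @rcomod_homP _ _ _ _ _ (rho X) (rho Y);
  pres1 X := rcomod_hom1 (rho X);
  presM X Y Z := @rcomod_homM _ _ _ _ _ _ (rho X) (rho Y) (rho Z) |}.
Definition lcomodStruct (i j : C) (A : coalg i) : homStruct (mor j i) := {|
  forget := @lcmor i j A;
  pres X Y f := lcomod_hom (lam X) (lam Y) f;
  pres0 X Y := lcomod_hom0 (lam X) (lam Y);
  presP X Y := @lcomod_homP _ _ _ _ _ (lam X) (lam Y);
  pres1 X := lcomod_hom1 (lam X);
  presM X Y Z := @lcomod_homM _ _ _ _ _ _ (lam X) (lam Y) (lam Z) |}.

Definition bicomod_hom (i j : C) (A : coalg i) (B : coalg j) (M N : bicomod A B)
    (f : arr M N) : Prop :=
  lcomod_hom (blam M) (blam N) f /\ rcomod_hom (brho M) (brho N) f.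
Lemma bicomod_hom0 (i j : C) (A : coalg i) (B : coalg j) (M N : bicomod A B) :
  bicomod_hom (0 : arr M N).
Proof. by split; [exact: lcomod_hom0 | exact: rcomod_hom0]. Qed.
Lemma bicomod_homP (i j : C) (A : coalg i) (B : coalg j) (M N : bicomod A B) a
    (f g : arr M N) : bicomod_hom f -> bicomod_hom g -> bicomod_hom (a *: f + g).
Proof. by move=> [? ?] [? ?]; split; [exact: lcomod_homP | exact: rcomod_homP]. Qed.
Lemma bicomod_hom1 (i j : C) (A : coalg i) (B : coalg j) (M : bicomod A B) :
  bicomod_hom (idm M).
Proof. by split; [exact: lcomod_hom1 | exact: rcomod_hom1]. Qed.
Lemma bicomod_homM (i j : C) (A : coalg i) (B : coalg j) (M N P : bicomod A B)
    (g : arr N P) (f : arr M N) :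
  bicomod_hom g -> bicomod_hom f -> bicomod_hom (g \o1 f).
Proof.
move=> [gl gr] [fl fr]; split; [exact: lcomod_homM gl fl | exact: rcomod_homM gr fr].
Qed.
Definition bicomodStruct (i j : C) (A : coalg i) (B : coalg j) : homStruct (mor j i) := {|
  forget := @bcmor i j A B;
  pres := @bicomod_hom i j A B;
  pres0 := @bicomod_hom0 i j A B;
  presP := @bicomod_homP i j A B;
  pres1 := @bicomod_hom1 i j A B;
  presM := @bicomod_homM i j A B |}.

Definition rcomodCat (i j : C) (A : coalg i) : linCat k := structCat (rcomodStruct j A).
Definition lcomodCat (i j : C) (A : coalg i) : linCat k := structCat (lcomodStruct j A).
Definition bicomodCat (i j : C) (A : coalg i) (B : coalg j) : linCat k :=
  structCat (bicomodStruct A B).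

Definition biinjective (i j : C) (A : coalg i) (B : coalg j) (M : bicomod A B) : Prop :=
  injective_obj (LComod (blamP M) : lcomodCat j A) /\
  injective_obj (RComod (brhoP M) : rcomodCat i B).

Lemma regular_r (i : C) (A : coalg i) : is_rcoaction (comul A).
Proof. by split; [exact: esym (coassoc A) | exact: counitr]. Qed.
Lemma regular_l (i : C) (A : coalg i) : is_lcoaction (comul A).
Proof. by split; [exact: coassoc | exact: counitl]. Qed.
Definition regularBicomod (i : C) (A : coalg i) : bicomod A A :=
  BiComod (regular_l A) (regular_r A) (coassoc A).

Lemma whisker_l (i j l : C) (F : mor j l) (X Y Z : mor i j) (g : arr Y Z) (f : arr X Y) :
  idm F \o0 (g \o1 f) = (idm F \o0 g) \o1 (idm F \o0 f).
Proof. by rewrite -interchange vcomp1l. Qed.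
Lemma whisker_r (i j l : C) (F : mor i j) (X Y Z : mor j l) (g : arr Y Z) (f : arr X Y) :
  (g \o1 f) \o0 idm F = (g \o0 idm F) \o1 (f \o0 idm F).
Proof. by rewrite -interchange vcomp1l. Qed.

Section Action.
Variables (i : C) (A : coalg i).

Lemma rcomod_heq (j : C) (X Y : rcomod j A) : heq (rho X) (rho Y) -> X = Y.
Proof.
case: X Y => [X r rP] [Y s sP] /= H.
case: (H) => e _; case: Y / e s sP H => s sP /heq_eq H.
by case: s / H sP => sP; congr RComod.
Qed.

Definition act_rho (j l : C) (F : mor j l) (X : rcomod j A) :
  arr (F ** X) (F ** X ** A) := asc _ _ _ \o1 (idm F \o0 rho X).

Lemma act_rho_heq (j l : C) (F : mor j l) (X : rcomod j A) :
  heq (act_rho F X) (idm F \o0 rho X).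
Proof. exact: heq_eqhoml. Qed.

Lemma act_rhoP (j l : C) (F : mor j l) (X : rcomod j A) : is_rcoaction (act_rho F X).
Proof.
have [rA r1] := rhoP X; split; apply: heq_eq.
- apply: (heq_trans (g := (idm F \o0 (rho X \o0 idm A)) \o1 (idm F \o0 rho X))).
    apply: heq_comp (act_rho_heq _ _).
    apply: heq_trans (heq_hcomp (act_rho_heq _ _) (heq_refl _)) _.
    by apply: heq_sym; exact: heqA.
  rewrite -whisker_l rA; apply: heq_sym.
  apply: heq_trans (heq_eqhoml _ _) _.
  apply: (heq_trans (g := (idm F \o0 (idm X \o0 comul A)) \o1 (idm F \o0 rho X))).
    apply: heq_comp (act_rho_heq _ _).
    by rewrite -hcomp_id; apply: heq_sym; exact: heqA.
  rewrite -whisker_l; apply: heq_hcomp (heq_refl _) _.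
  by apply: heq_sym; exact: heq_eqhoml.
- apply: heq_trans (heq_eqhoml _ _) _.
  apply: (heq_trans (g := (idm F \o0 (idm X \o0 counit A)) \o1 (idm F \o0 rho X))).
    apply: heq_comp (act_rho_heq _ _).
    by rewrite -hcomp_id; apply: heq_sym; exact: heqA.
  rewrite -whisker_l -hcomp_id; apply: heq_hcomp (heq_refl _) _.
  exact: heq_trans (heq_sym (heq_eqhoml _ _)) (eq_heq r1).
Qed.

Definition ract (j l : C) (F : mor j l) (X : rcomodCat j A) : rcomodCat l A :=
  RComod (act_rhoP F X).

Lemma ract2P (j l : C) (F F' : mor j l) (X X' : rcomodCat j A) (a : arr F F')
    (f : shom X X') :
  rcomod_hom (rho (ract F X)) (rho (ract F' X')) (a \o0 shval f).
Proof.
rewrite /rcomod_hom /= /act_rho -vcompA -interchange vcomp1l (shvalP f).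
rewrite -[a in LHS]vcomp1r interchange !vcompA; congr (_ \o1 _).
exact: hcompA.
Qed.
Definition ract2 (j l : C) (F F' : mor j l) (X X' : rcomodCat j A) (a : arr F F')
  (f : arr X X') : arr (ract F X) (ract F' X') :=
  @SHom _ _ (rcomodStruct l A) (ract F X) (ract F' X') (a \o0 shval f) (ract2P a f).

Lemma ract2Pl (j l : C) (F F' : mor j l) (X X' : rcomodCat j A) c (a a' : arr F F')
  (f : arr X X') : ract2 (c *: a + a') f = c *: ract2 a f + ract2 a' f.
Proof. by apply: shom_inj; rewrite shvalE; exact: hcompPl. Qed.
Lemma ract2Pr (j l : C) (F F' : mor j l) (X X' : rcomodCat j A) c (a : arr F F')
  (f f' : arr X X') : ract2 a (c *: f + f') = c *: ract2 a f + ract2 a f'.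
Proof. by apply: shom_inj; rewrite shvalE /= addr0 scale1r; exact: hcompPr. Qed.
Lemma ract2_id (j l : C) (F : mor j l) (X : rcomodCat j A) :
  ract2 (idm F) (idm X) = idm (ract F X).
Proof. by apply: shom_inj; exact: hcomp_id. Qed.
Lemma ract2M (j l : C) (F F' F'' : mor j l) (X X' X'' : rcomodCat j A)
    (a' : arr F' F'') (a : arr F F') (f' : arr X' X'') (f : arr X X') :
  ract2 (a' \o1 a) (f' \o1 f) = ract2 a' f' \o1 ract2 a f.
Proof. by apply: shom_inj; exact: interchange. Qed.
Lemma ractA (j l m : C) (F : mor l m) (G : mor j l) (X : rcomodCat j A) :
  ract F (ract G X) = ract (F ** G) X.
Proof.
apply: rcomod_heq; apply: heq_trans (act_rho_heq _ _) _.
apply: heq_trans (heq_hcomp (heq_refl _) (act_rho_heq _ _)) _.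
apply: heq_trans (heqA _ _ _) _.
by apply: heq_sym; rewrite hcomp_id; exact: act_rho_heq.
Qed.
Lemma ract1 (j : C) (X : rcomodCat j A) : ract (one j) X = X.
Proof. by apply: rcomod_heq; apply: heq_trans (act_rho_heq _ _) _; exact: heq1l. Qed.
Lemma ract2A (j l m : C) (F F' : mor l m) (G G' : mor j l) (X X' : rcomodCat j A)
    (a : arr F F') (b : arr G G') (f : arr X X') :
  eqhom (ractA F' G' X') \o1 ract2 a (ract2 b f) =
  ract2 (a \o0 b) f \o1 eqhom (ractA F G X).
Proof.
apply: shom_inj; rewrite /= !shval_eqhom.
rewrite (Prop_irrelevance (congr1 _ (ractA F G X)) (comp1A F G (rcmor X))).
rewrite (Prop_irrelevance (congr1 _ (ractA F' G' X')) (comp1A F' G' (rcmor X'))).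
exact: hcompA.
Qed.
Lemma ract2_1 (j : C) (X X' : rcomodCat j A) (f : arr X X') :
  eqhom (ract1 X') \o1 ract2 (idm (one j)) f = f \o1 eqhom (ract1 X).
Proof.
apply: shom_inj; rewrite /= !shval_eqhom.
rewrite (Prop_irrelevance (congr1 _ (ract1 X)) (comp1_1l (rcmor X))).
rewrite (Prop_irrelevance (congr1 _ (ract1 X')) (comp1_1l (rcmor X'))).
exact: hcomp1l.
Qed.

Definition comod : rep2 C := {|
  rcat j := rcomodCat j A;
  act := ract;
  act2 := ract2;
  act2Pl := ract2Pl;
  act2Pr := ract2Pr;
  act2_id := ract2_id;
  act2M := ract2M;
  actA := ractA;
  act1 := ract1;
  act2A := ract2A;
  act2_1 := ract2_1 |}.
End Action.

End Comodules.
Arguments comul {k C i} c.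
Arguments counit {k C i} c.

Section Cotensor.
Variables (k : fieldType) (D : lexTwoCat k).

Lemma iso_kernel (L : linCat k) (X Y K K' : L) (u : arr X Y) (i : arr K X) (p : arr K' K) :
  is_iso p -> is_kernel u i -> is_kernel u (i \o1 p).
Proof.
move=> [q [qp pq]] [ui ki]; split; first by rewrite vcompA ui vcomp0l.
move=> Z v uv; have [w [wE wP]] := ki Z v uv; exists (q \o1 w); split.
  by rewrite -vcompA (vcompA p) pq vcomp1l.
move=> w'; rewrite -vcompA => /wP ->.
by rewrite vcompA qp vcomp1l.
Qed.

Lemma kernel_uniq (L : linCat k) (X Y K K' : L) (u : arr X Y) (i : arr K X) (i' : arr K' X) :
  is_kernel u i -> is_kernel u i' -> exists p : arr K' K, is_iso p /\ i' = i \o1 p.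
Proof.
move=> ki ki'; have mi := kernel_mono ki; have mi' := kernel_mono ki'.
have [p pE] := kernel_lift ki (proj1 ki'); have [q qE] := kernel_lift ki' (proj1 ki).
exists p; split => //; exists q; split; [apply: mi' | apply: mi].
  by rewrite vcompA qE pE vcomp1r.
by rewrite vcompA pE qE vcomp1r.
Qed.

Lemma kernel_l (i j l : D) (F : mor j l) (X Y K : mor i j) (u : arr X Y) (v : arr K X) :
  is_kernel u v -> is_kernel (idm F \o0 u) (idm F \o0 v).
Proof.
move=> kv; have [p [[q [qp pq]] ->]] := kernel_uniq (kerP u) kv.
rewrite whisker_l; apply: iso_kernel (ker_l _ _).
by exists (idm F \o0 q); rewrite -!whisker_l qp pq !hcomp_id.
Qed.
Lemma kernel_r (i j l : D) (F : mor i j) (X Y K : mor j l) (u : arr X Y) (v : arr K X) :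
  is_kernel u v -> is_kernel (u \o0 idm F) (v \o0 idm F).
Proof.
move=> kv; have [p [[q [qp pq]] ->]] := kernel_uniq (kerP u) kv.
rewrite whisker_r; apply: iso_kernel (ker_r _ _).
by exists (q \o0 idm F); rewrite -!whisker_r qp pq !hcomp_id.
Qed.

Section Cot.
Variables (h j m : D) (B : coalg j).
Variables (X : mor j m) (rX : arr X (X ** B)) (Y : mor h j) (lY : arr Y (B ** Y)).

Definition cotdiff : arr (X ** Y) (X ** B ** Y) :=
  rX \o0 idm Y - asc _ _ _ \o1 (idm X \o0 lY).
Definition cot : mor h m := kern cotdiff.
Definition coti : arr cot (X ** Y) := kerni cotdiff.

Lemma cotdiff_eq0 Z (v : arr Z (X ** Y)) :
  heq ((rX \o0 idm Y) \o1 v) ((idm X \o0 lY) \o1 v) -> cotdiff \o1 v = 0.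
Proof.
move=> H; apply/eqP; rewrite vcompBl subr_eq0 -vcompA; apply/eqP.
by apply: heq_eq; apply: heq_trans H (heq_sym (heq_eqhoml _ _)).
Qed.
Lemma coti_heq : heq ((rX \o0 idm Y) \o1 coti) ((idm X \o0 lY) \o1 coti).
Proof.
have [/eqP] := kerP cotdiff; rewrite vcompBl subr_eq0 -vcompA => /eqP H _.
by apply: heq_trans (eq_heq H) (heq_eqhoml _ _).
Qed.
Lemma coti_mono : is_mono coti.
Proof. exact: kernel_mono (kerP _). Qed.
End Cot.

Section CotMap.
Variables (h j m : D) (B : coalg j) (X X' : mor j m) (Y Y' : mor h j).
Variables (rX : arr X (X ** B)) (rX' : arr X' (X' ** B)).
Variables (lY : arr Y (B ** Y)) (lY' : arr Y' (B ** Y')).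
Variables (u : arr X X') (v : arr Y Y').
Hypotheses (uP : rcomod_hom rX rX' u) (vP : lcomod_hom lY lY' v).

Lemma cotmap_subproof : cotdiff rX' lY' \o1 ((u \o0 v) \o1 coti rX lY) = 0.
Proof.
apply: cotdiff_eq0; rewrite !vcompA -!interchange !vcomp1l uP vP.
have -> : ((u \o0 idm B) \o1 rX) \o0 v = ((u \o0 idm B) \o0 v) \o1 (rX \o0 idm Y).
  by rewrite -interchange vcomp1r.
have -> : u \o0 ((idm B \o0 v) \o1 lY) = (u \o0 (idm B \o0 v)) \o1 (idm X \o0 lY).
  by rewrite -interchange vcomp1r.
rewrite -!vcompA.
apply: heq_comp (coti_heq _ _); exact: heq_sym (heqA _ _ _).
Qed.
Definition cotmap : arr (cot rX lY) (cot rX' lY') := klift (kerP _) cotmap_subproof.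
End CotMap.

Section BicomodCot.
Variables (h i j : D) (A : coalg i) (B : coalg j) (E : coalg h).
Variables (M : bicomod A B) (N : bicomod B E).

Let P : mor h i := cot (brho M) (blam N).
Let io : arr P (M ** N) := coti (brho M) (blam N).

Let v : arr (M ** N) (A ** (M ** N)) :=
  eqhom (esym (comp1A _ _ _)) \o1 (blam M \o0 idm N).
Let w : arr (M ** N) (M ** N ** E) := asc _ _ _ \o1 (idm M \o0 brho N).

Lemma cot_v_heq : heq v (blam M \o0 idm N). Proof. exact: heq_eqhoml. Qed.
Lemma cot_w_heq : heq w (idm M \o0 brho N). Proof. exact: heq_eqhoml. Qed.

Lemma bicomod_comm_heq : heq ((idm A \o0 brho M) \o1 blam M) ((blam M \o0 idm B) \o1 brho M).
Proof. exact: heq_trans (heq_sym (heq_eqhoml _ _)) (eq_heq (bcommP M)). Qed.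
Lemma bicomod_comm_heq' : heq ((idm B \o0 brho N) \o1 blam N) ((blam N \o0 idm E) \o1 brho N).
Proof. exact: heq_trans (heq_sym (heq_eqhoml _ _)) (eq_heq (bcommP N)). Qed.

Lemma cotdiff_whisker_l (o : D) (F : mor i o) Z (s : arr Z (F ** (M ** N))) :
  heq ((idm F \o0 (brho M \o0 idm N)) \o1 s) ((idm F \o0 (idm M \o0 blam N)) \o1 s) ->
  (idm F \o0 cotdiff (brho M) (blam N)) \o1 s = 0.
Proof.
move=> H; apply/eqP; rewrite hcompBr vcompBl subr_eq0 whisker_l -vcompA; apply/eqP.
apply: heq_eq; apply: heq_trans H _; apply: heq_sym.
have K : heq (idm F \o0 asc M B N) (idm (F ** (M ** (B ** N)))).
  by rewrite -hcomp_id; exact: heq_hcomp (heq_refl _) (heq_eqhom _).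
by apply: heq_trans (heq_comp K (heq_refl _)) _; rewrite vcomp1l; exact: heq_refl.
Qed.
Lemma cotdiff_whisker_r (o : D) (F : mor o h) Z (s : arr Z (M ** N ** F)) :
  heq (((brho M \o0 idm N) \o0 idm F) \o1 s) (((idm M \o0 blam N) \o0 idm F) \o1 s) ->
  (cotdiff (brho M) (blam N) \o0 idm F) \o1 s = 0.
Proof.
move=> H; apply/eqP; rewrite hcompBl vcompBl subr_eq0 whisker_r -vcompA; apply/eqP.
apply: heq_eq; apply: heq_trans H _; apply: heq_sym.
have K : heq (asc M B N \o0 idm F) (idm (M ** (B ** N) ** F)).
  by rewrite -hcomp_id; exact: heq_hcomp (heq_eqhom _) (heq_refl _).
by apply: heq_trans (heq_comp K (heq_refl _)) _; rewrite vcomp1l; exact: heq_refl.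
Qed.

Lemma cot_lam_subproof : (idm A \o0 cotdiff (brho M) (blam N)) \o1 (v \o1 io) = 0.
Proof.
apply: cotdiff_whisker_l.
apply: (heq_trans (g := (blam M \o0 blam N) \o1 io)).
- apply: (heq_trans (g := ((((idm A \o0 brho M) \o1 blam M) \o0 idm N) \o1 io))).
    rewrite whisker_r -vcompA; apply: heq_comp (heqA _ _ _) _.
    exact: heq_comp cot_v_heq (heq_refl _).
  apply: heq_trans (heq_comp (heq_hcomp bicomod_comm_heq (heq_refl _)) (heq_refl _)) _.
  rewrite whisker_r -vcompA.
  apply: heq_trans (heq_comp (heq_sym (heqA _ _ _)) (coti_heq _ _)) _.
  by rewrite vcompA -interchange vcomp1r hcomp_id vcomp1l; exact: heq_refl.
- apply: heq_sym.
  apply: heq_trans (heq_comp (heqA _ _ _) (heq_comp cot_v_heq (heq_refl _))) _.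
  by rewrite vcompA -interchange hcomp_id !vcomp1l vcomp1r; exact: heq_refl.
Qed.
Definition cot_lam : arr P (A ** P) := klift (kernel_l A (kerP _)) cot_lam_subproof.
Lemma cot_lamE : heq ((idm A \o0 io) \o1 cot_lam) ((blam M \o0 idm N) \o1 io).
Proof.
by apply: heq_trans (eq_heq (kliftE _ _)) _; exact: heq_comp cot_v_heq (heq_refl _).
Qed.

Lemma cot_rho_subproof : (cotdiff (brho M) (blam N) \o0 idm E) \o1 (w \o1 io) = 0.
Proof.
apply: cotdiff_whisker_r; apply: heq_sym.
apply: (heq_trans (g := (brho M \o0 brho N) \o1 io)).
- apply: (heq_trans (g := ((idm M \o0 ((blam N \o0 idm E) \o1 brho N)) \o1 io))).
    rewrite whisker_l -vcompA; apply: heq_comp (heq_sym (heqA _ _ _)) _.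
    exact: heq_comp cot_w_heq (heq_refl _).
  apply: heq_trans (heq_comp (heq_hcomp (heq_refl _) (heq_sym bicomod_comm_heq')) (heq_refl _)) _.
  rewrite whisker_l -vcompA.
  apply: heq_trans (heq_comp (heqA _ _ _) (heq_sym (coti_heq _ _))) _.
  by rewrite vcompA -interchange vcomp1r hcomp_id vcomp1l; exact: heq_refl.
- apply: heq_sym.
  apply: heq_trans (heq_comp (heq_sym (heqA _ _ _)) (heq_comp cot_w_heq (heq_refl _))) _.
  by rewrite vcompA -interchange hcomp_id !vcomp1l vcomp1r; exact: heq_refl.
Qed.
Definition cot_rho : arr P (P ** E) := klift (kernel_r E (kerP _)) cot_rho_subproof.
Lemma cot_rhoE : heq ((io \o0 idm E) \o1 cot_rho) ((idm M \o0 brho N) \o1 io).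
Proof.
by apply: heq_trans (eq_heq (kliftE _ _)) _; exact: heq_comp cot_w_heq (heq_refl _).
Qed.

Lemma coti_mono_l (o : D) (F : mor i o) : is_mono (idm F \o0 io).
Proof. exact: kernel_mono (kernel_l F (kerP _)). Qed.
Lemma coti_mono_r (o : D) (F : mor o h) : is_mono (io \o0 idm F).
Proof. exact: kernel_mono (kernel_r F (kerP _)). Qed.

Lemma cot_lamP : is_lcoaction cot_lam.
Proof.
have [lA l1] := blamP M; split; apply: heq_eq.
- apply/eq_heq/(@coti_mono_l _ (A ** A)); apply: heq_eq.
  apply: (heq_trans (g := (((comul A \o0 idm M) \o1 blam M) \o0 idm N) \o1 io)).
    have K : heq (idm (A ** A) \o0 io) (idm A \o0 (idm A \o0 io)).
      by rewrite -hcomp_id; exact: heq_sym (heqA _ _ _).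
    apply: heq_trans (heq_comp K (heq_eqhoml _ _)) _.
    rewrite vcompA -whisker_l.
    apply: heq_trans (heq_comp (heq_hcomp (heq_refl _) cot_lamE) (heq_refl _)) _.
    rewrite whisker_l -vcompA.
    apply: heq_trans (heq_comp (heqA _ _ _) cot_lamE) _.
    rewrite vcompA -whisker_r.
    apply: heq_comp (heq_hcomp _ (heq_refl _)) (heq_refl _).
    exact: heq_trans (heq_sym (heq_eqhoml _ _)) (eq_heq lA).
  apply: heq_sym.
  rewrite vcompA -interchange vcomp1l vcomp1r -[comul A in X in heq X _]vcomp1r.
  rewrite -[io in X in heq X _]vcomp1l interchange -vcompA whisker_r -vcompA.
  apply: heq_comp cot_lamE.
  by rewrite -hcomp_id; exact: heqA.
- apply/eq_heq/coti_mono; apply: heq_eq; rewrite vcomp1r.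
  apply: (heq_trans (g := (((counit A \o0 idm M) \o1 blam M) \o0 idm N) \o1 io)).
    rewrite (vcompA (coti _ _)) /unl -hcomp1l -vcompA; apply: heq_trans (heq_eqhoml _ _) _.
    rewrite vcompA -interchange vcomp1l vcomp1r -[counit A in X in heq X _]vcomp1r.
    rewrite -[coti _ _ in X in heq X _]vcomp1l interchange -vcompA whisker_r -vcompA.
    apply: heq_comp cot_lamE.
    by rewrite -hcomp_id; exact: heqA.
  have K : heq ((counit A \o0 idm M) \o1 blam M) (idm M).
    exact: heq_trans (heq_sym (heq_eqhoml _ _)) (eq_heq l1).
  apply: heq_trans (heq_comp (heq_hcomp K (heq_refl _)) (heq_refl _)) _.
  by rewrite hcomp_id vcomp1l; exact: heq_refl.
Qed.

Lemma cot_rhoP : is_rcoaction cot_rho.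
Proof.
have [rA r1] := brhoP N; split; apply: heq_eq.
- rewrite /asc; apply: heq_sym; apply: heq_trans (heq_eqhoml _ _) _; apply: heq_sym.
  apply: heq_trans (heq_sym (heq_eqhoml (esym (comp1A _ _ _)) _)) _.
  apply/eq_heq/(@coti_mono_r _ (E ** E)); apply: heq_eq.
  apply: (heq_trans (g := (idm M \o0 ((idm N \o0 comul E) \o1 brho N)) \o1 io)).
    have K : heq (io \o0 idm (E ** E)) ((io \o0 idm E) \o0 idm E).
      by rewrite -hcomp_id; exact: heqA.
    apply: heq_trans (heq_comp K (heq_eqhoml _ _)) _.
    rewrite vcompA -whisker_r.
    apply: heq_trans (heq_comp (heq_hcomp cot_rhoE (heq_refl _)) (heq_refl _)) _.
    rewrite whisker_r -vcompA.
    apply: heq_trans (heq_comp (heq_sym (heqA _ _ _)) cot_rhoE) _.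
    rewrite vcompA -whisker_l.
    apply: heq_comp (heq_hcomp (heq_refl _) _) (heq_refl _).
    exact: heq_trans (eq_heq rA) (heq_eqhoml _ _).
  apply: heq_sym.
  rewrite vcompA -interchange vcomp1l vcomp1r -[comul E in X in heq X _]vcomp1r.
  rewrite -[io in X in heq X _]vcomp1l interchange -vcompA whisker_l -vcompA.
  apply: heq_comp cot_rhoE.
  by rewrite -hcomp_id; exact: heq_sym (heqA _ _ _).
- apply/eq_heq/coti_mono; apply: heq_eq; rewrite vcomp1r.
  apply: (heq_trans (g := (idm M \o0 ((idm N \o0 counit E) \o1 brho N)) \o1 io)).
    rewrite (vcompA (coti _ _)) /unr -hcomp1r -vcompA; apply: heq_trans (heq_eqhoml _ _) _.
    rewrite vcompA -interchange vcomp1l vcomp1r -[counit E in X in heq X _]vcomp1r.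
    rewrite -[coti _ _ in X in heq X _]vcomp1l interchange -vcompA whisker_l -vcompA.
    apply: heq_comp cot_rhoE.
    by rewrite -hcomp_id; exact: heq_sym (heqA _ _ _).
  have K : heq ((idm N \o0 counit E) \o1 brho N) (idm N).
    exact: heq_trans (heq_sym (heq_eqhoml _ _)) (eq_heq r1).
  apply: heq_trans (heq_comp (heq_hcomp (heq_refl _) K) (heq_refl _)) _.
  by rewrite hcomp_id vcomp1l; exact: heq_refl.
Qed.

Lemma cot_commP :
  asc _ _ _ \o1 ((idm A \o0 cot_rho) \o1 cot_lam) = (cot_lam \o0 idm E) \o1 cot_rho.
Proof.
have m : is_mono ((idm A \o0 io) \o0 idm E).
  exact: kernel_mono (kernel_r E (kernel_l A (kerP _))).
apply: m; apply: heq_eq.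
apply: (heq_trans (g := (blam M \o0 brho N) \o1 io)).
- apply: heq_trans (heq_comp (heq_sym (heqA _ _ _)) (heq_eqhoml _ _)) _.
  rewrite vcompA -whisker_l.
  apply: heq_trans (heq_comp (heq_hcomp (heq_refl _) cot_rhoE) (heq_refl _)) _.
  rewrite whisker_l -vcompA.
  apply: heq_trans (heq_comp (heqA _ _ _) cot_lamE) _.
  by rewrite vcompA -interchange hcomp_id vcomp1l vcomp1r; exact: heq_refl.
- apply: heq_sym; rewrite vcompA -whisker_r.
  apply: heq_trans (heq_comp (heq_hcomp cot_lamE (heq_refl _)) (heq_refl _)) _.
  rewrite whisker_r -vcompA.
  apply: heq_trans (heq_comp (heq_sym (heqA _ _ _)) cot_rhoE) _.
  by rewrite vcompA -interchange hcomp_id vcomp1l vcomp1r; exact: heq_refl.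
Qed.

Definition cotensor : bicomod A E := BiComod cot_lamP cot_rhoP cot_commP.
End BicomodCot.

Definition cotm (h i j : D) (A : coalg i) (B : coalg j) (E : coalg h)
    (M M' : bicomodCat A B) (N N' : bicomodCat B E) (u : arr M M') (v : arr N N') :
  arr (cotensor M N : mor h i) (cotensor M' N') :=
  cotmap (proj2 (shvalP u)) (proj1 (shvalP v)).

Section Unitors.
Variables (i j : D) (A : coalg i) (B : coalg j) (M : bicomod A B).
Lemma lamc_subproof : cotdiff (comul A) (blam M) \o1 blam M = 0.
Proof. by apply/eqP; rewrite vcompBl subr_eq0 -vcompA (proj1 (blamP M)). Qed.
Lemma rhoc_subproof : cotdiff (brho M) (comul B) \o1 brho M = 0.
Proof. by apply/eqP; rewrite vcompBl subr_eq0 -vcompA (proj1 (brhoP M)). Qed.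

(** The factorizations of the coactions through [A [] M] and [M [] B]. *)
Definition lamc : arr (M : mor j i) (cotensor (regularBicomod A) M) :=
  klift (kerP _) lamc_subproof.
Definition rhoc : arr (M : mor j i) (cotensor M (regularBicomod B)) :=
  klift (kerP _) rhoc_subproof.
End Unitors.

(** The associativity isomorphism [(M [] N) [] Q -> M [] (N [] Q)]: both sides
    are subobjects of [M ** N ** Q], and it is the comparison map ([cotAE]). *)
Section Associator.
Variables (g h i j : D) (A : coalg i) (B : coalg j) (E : coalg h) (G : coalg g).
Variables (M : bicomod A B) (N : bicomod B E) (Q : bicomod E G).

Let iMN := coti (brho M) (blam N).
Let iNQ := coti (brho N) (blam Q).
Let iMN_Q := coti (brho (cotensor M N)) (blam Q).
Let iM_NQ := coti (brho M) (blam (cotensor N Q)).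

Let s := (iMN \o0 idm Q) \o1 iMN_Q.
Let s' := (idm M \o0 iNQ) \o1 iM_NQ.

Lemma cotA_src_mono : is_mono s.
Proof. by apply: mono_comp; [exact: coti_mono_r | exact: coti_mono]. Qed.
Lemma cotA_tgt_mono : is_mono s'.
Proof. by apply: mono_comp; [exact: coti_mono_l | exact: coti_mono]. Qed.

Lemma cotA_src_left :
  heq (((brho M \o0 idm N) \o0 idm Q) \o1 s)
    (((idm M \o0 blam N) \o0 idm Q) \o1 s).
Proof.
rewrite !vcompA -!whisker_r.
exact: heq_comp (heq_hcomp (coti_heq _ _) (heq_refl _)) (heq_refl _).
Qed.
Lemma cotA_src_right :
  heq (((idm M \o0 brho N) \o0 idm Q) \o1 s)
    (((idm M \o0 idm N) \o0 blam Q) \o1 s).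
Proof.
apply: (heq_trans (g := (iMN \o0 blam Q) \o1 iMN_Q)).
- rewrite vcompA -whisker_r.
  apply: heq_trans (heq_comp (heq_hcomp (heq_sym (cot_rhoE _ _)) (heq_refl _)) (heq_refl _)) _.
  rewrite whisker_r -vcompA.
  apply: heq_trans (heq_comp (heq_sym (heqA _ _ _)) (coti_heq _ _)) _.
  by rewrite vcompA -interchange hcomp_id vcomp1l vcomp1r; exact: heq_refl.
- by rewrite vcompA -interchange hcomp_id vcomp1l vcomp1r; exact: heq_refl.
Qed.
Lemma cotA_tgt_right :
  heq ((idm M \o0 (brho N \o0 idm Q)) \o1 s')
    ((idm M \o0 (idm N \o0 blam Q)) \o1 s').
Proof.
rewrite !vcompA -!whisker_l.
exact: heq_comp (heq_hcomp (heq_refl _) (coti_heq _ _)) (heq_refl _).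
Qed.
Lemma cotA_tgt_left :
  heq ((brho M \o0 (idm N \o0 idm Q)) \o1 s')
    ((idm M \o0 (blam N \o0 idm Q)) \o1 s').
Proof.
apply: (heq_trans (g := (brho M \o0 iNQ) \o1 iM_NQ)).
  by rewrite vcompA -interchange hcomp_id vcomp1l vcomp1r; exact: heq_refl.
apply: heq_sym; rewrite vcompA -whisker_l.
apply: heq_trans (heq_comp (heq_hcomp (heq_refl _) (heq_sym (cot_lamE _ _))) (heq_refl _)) _.
rewrite whisker_l -vcompA.
apply: heq_trans (heq_comp (heqA _ _ _) (heq_sym (coti_heq _ _))) _.
by rewrite vcompA -interchange hcomp_id vcomp1l vcomp1r; exact: heq_refl.
Qed.

Let t := eqhom (esym (comp1A _ _ _)) \o1 s.
Let t' := asc _ _ _ \o1 s'.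
Lemma cotA_t_heq : heq t s. Proof. exact: heq_eqhoml. Qed.
Lemma cotA_t'_heq : heq t' s'. Proof. exact: heq_eqhoml. Qed.

Lemma cotA1_subproof : (idm M \o0 cotdiff (brho N) (blam Q)) \o1 t = 0.
Proof.
apply: cotdiff_whisker_l.
apply: heq_trans (heq_comp (heqA _ _ _) cotA_t_heq) _; apply: heq_trans cotA_src_right _.
by apply: heq_sym; exact: heq_comp (heqA _ _ _) cotA_t_heq.
Qed.
Let cotA1 := klift (kernel_l M (kerP _)) cotA1_subproof.
Lemma cotA1E : heq ((idm M \o0 iNQ) \o1 cotA1) s.
Proof. by apply: heq_trans (eq_heq (kliftE _ _)) cotA_t_heq. Qed.

Lemma cotA_subproof : cotdiff (brho M) (blam (cotensor N Q)) \o1 cotA1 = 0.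
Proof.
apply/eqP; rewrite vcompBl subr_eq0 -vcompA; apply/eqP.
apply: (coti_mono_l (F := M ** B)); apply: heq_eq; rewrite -/iNQ.
apply: (heq_trans (g := ((brho M \o0 idm N) \o0 idm Q) \o1 s)).
- rewrite vcompA -interchange vcomp1l vcomp1r -[brho M in X in heq X _]vcomp1r.
  rewrite -[iNQ in X in heq X _]vcomp1l interchange -vcompA; apply: heq_comp cotA1E.
  by rewrite -hcomp_id; exact: heqA.
- apply: heq_trans cotA_src_left _; apply: heq_sym.
  have K : heq (idm (M ** B) \o0 iNQ) (idm M \o0 (idm B \o0 iNQ)).
    by rewrite -hcomp_id; exact: heq_sym (heqA _ _ _).
  apply: heq_trans (heq_comp K (heq_eqhoml _ _)) _.
  rewrite vcompA -whisker_l.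
  apply: heq_trans (heq_comp (heq_hcomp (heq_refl _) (cot_lamE _ _)) (heq_refl _)) _.
  by rewrite whisker_l -vcompA; apply: heq_comp (heqA _ _ _) cotA1E.
Qed.
Definition cotA : arr (cotensor (cotensor M N) Q : mor g i) (cotensor M (cotensor N Q)) :=
  klift (kerP _) cotA_subproof.
Lemma cotA_heq : heq (s' \o1 cotA) s.
Proof.
rewrite -vcompA; apply: heq_trans cotA1E.
by apply: heq_comp (heq_refl _) _; apply: eq_heq; exact: kliftE.
Qed.
Lemma cotAE :
  asc _ _ _ \o1 ((idm M \o0 coti (brho N) (blam Q)) \o1
    (coti (brho M) (blam (cotensor N Q)) \o1 cotA)) =
  (coti (brho M) (blam N) \o0 idm Q) \o1 coti (brho (cotensor M N)) (blam Q).
Proof.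
apply: heq_eq; apply: heq_trans (heq_eqhoml _ _) _; rewrite vcompA; exact: cotA_heq.
Qed.

Lemma cotB1_subproof : (cotdiff (brho M) (blam N) \o0 idm Q) \o1 t' = 0.
Proof.
apply: cotdiff_whisker_r.
apply: heq_trans (heq_comp (heq_sym (heqA _ _ _)) cotA_t'_heq) _; apply: heq_trans cotA_tgt_left _.
by apply: heq_sym; exact: heq_comp (heq_sym (heqA _ _ _)) cotA_t'_heq.
Qed.
Let cotB1 := klift (kernel_r Q (kerP _)) cotB1_subproof.
Lemma cotB1E : heq ((iMN \o0 idm Q) \o1 cotB1) s'.
Proof. by apply: heq_trans (eq_heq (kliftE _ _)) cotA_t'_heq. Qed.

Lemma cotB_subproof : cotdiff (brho (cotensor M N)) (blam Q) \o1 cotB1 = 0.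
Proof.
have m : is_mono ((iMN \o0 idm E) \o0 idm Q).
  exact: kernel_mono (kernel_r Q (kernel_r E (kerP _))).
apply/eqP; rewrite vcompBl subr_eq0 -vcompA; apply/eqP.
apply: m; apply: heq_eq.
apply: (heq_trans (g := (idm M \o0 (brho N \o0 idm Q)) \o1 s')).
- rewrite vcompA -whisker_r.
  apply: heq_trans (heq_comp (heq_hcomp (cot_rhoE _ _) (heq_refl _)) (heq_refl _)) _.
  by rewrite whisker_r -vcompA; apply: heq_comp (heq_sym (heqA _ _ _)) cotB1E.
- apply: heq_trans cotA_tgt_right _; apply: heq_sym.
  apply: heq_trans (heq_comp (heq_sym (heqA _ _ _)) (heq_eqhoml _ _)) _.
  rewrite vcompA -interchange hcomp_id vcomp1l vcomp1r.
  rewrite -[iMN in X in heq X _]vcomp1l -[blam Q in X in heq X _]vcomp1r interchange.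
  rewrite -vcompA; apply: heq_comp cotB1E.
  by rewrite -hcomp_id; exact: heq_sym (heqA _ _ _).
Qed.
Let cotB := klift (kerP _) cotB_subproof.
Lemma cotB_heq : heq (s \o1 cotB) s'.
Proof.
rewrite -vcompA; apply: heq_trans cotB1E.
by apply: heq_comp (heq_refl _) _; apply: eq_heq; exact: kliftE.
Qed.

Lemma cotA_iso : is_iso cotA.
Proof.
exists cotB; split.
  apply: cotA_src_mono; apply: heq_eq; rewrite vcompA vcomp1r.
  exact: heq_trans (heq_comp cotB_heq (heq_refl _)) cotA_heq.
apply: cotA_tgt_mono; apply: heq_eq; rewrite vcompA vcomp1r.
exact: heq_trans (heq_comp cotA_heq (heq_refl _)) cotB_heq.
Qed.
End Associator.
End Cotensor.

(* Main.v *)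
(** The theorem is the Morita-Takeuchi argument, carried out in a strict 2-category with
    kernels that are preserved by composition with 1-morphisms.  If [f] and [g] are
    isomorphisms, then [- [] M] is a morphism of 2-representations and [- [] N] is
    inverse to it, by associativity of the cotensor product.
    Conversely, let [Phi] be an equivalence.  Put [M := Phi A], with left coaction [Phi]
    of the comultiplication of [A].  Every comodule [X] is the kernel of [XA => XAA], and
    [Phi] preserves kernels, so [Phi X = X [] M].  Choose [N] with [theta : Phi N = B].
    As [Phi] is fully faithful, morphisms [X -> F N] of [A]-comodules are the same as
    morphisms [Phi X -> F B] of [B]-comodules ([hat]); the left coaction of [N] and the map
    [A -> M N] are defined as the preimages of the coactions of [B] and [M], and all their
    identities can be checked after applying [hat].
    For injectivity, [A] is an injective right comodule because the unit 1-morphism is an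
    injective object of the abelianization; hence so is [M = Phi A], and so is [N], as
    [Phi N = B].  For the left structures, the compatibility conditions on [f] and [g]
    reduce extension of a map [Y -> M] along [Y -> Z] to extension of
    [N [] Y -> N [] M = B -> 1] along [N [] Y -> N [] Z]. *)

Require Import Defs.
From mathcomp Require Import all_boot all_algebra.
From mathcomp Require Import boolp.
(* [all_boot] and [all_algebra] shadow [one] and [interchange]. *)
Import Defs.

Set Implicit Arguments.
Unset Strict Implicit.
Unset Printing Implicit Defensive.

Import GRing.Theory.
Local Open Scope ring_scope.

(** * Linear categories and equivalences *)

Section LinCatLemmas.
Variables (k : fieldType) (L : linCat k).
Implicit Types X Y Z : L.

Lemma iso_comp X Y Z (g : arr Y Z) (f : arr X Y) : is_iso g -> is_iso f -> is_iso (g \o1 f).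
Proof.
move=> [g' [gK Kg]] [f' [fK Kf]]; exists (f' \o1 g'); split.
  by rewrite -vcompA (vcompA g') gK vcomp1l fK.
by rewrite -vcompA (vcompA f) Kf vcomp1l Kg.
Qed.

Lemma iso_mono X Y (f : arr X Y) : is_iso f -> is_mono f.
Proof.
by move=> [g [gf _]] Z u v e; rewrite -[u]vcomp1l -[v]vcomp1l -gf -!vcompA e.
Qed.

Lemma iso_cancel_r X Y Z (f : arr X Y) (u v : arr Y Z) :
  is_iso f -> u \o1 f = v \o1 f -> u = v.
Proof. by move=> [g [_ fg]] e; rewrite -[u]vcomp1r -[v]vcomp1r -fg !vcompA e. Qed.

Lemma kernelI X Y K (u : arr X Y) (i : arr K X) : u \o1 i = 0 -> is_mono i ->
  (forall Z (v : arr Z X), u \o1 v = 0 -> exists w, i \o1 w = v) -> is_kernel u i.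
Proof.
move=> ui mi lift; split=> // Z v /lift [w wE]; exists w; split=> // w' w'E.
by apply: mi; rewrite wE.
Qed.

Lemma kernel_isos X Y K X' Y' K' (u : arr X Y) (i : arr K X) (u' : arr X' Y')
    (i' : arr K' X') (x : arr X X') (y : arr Y Y') (z : arr K K') :
  is_iso x -> is_iso y -> is_iso z -> u' \o1 x = y \o1 u -> i' \o1 z = x \o1 i ->
  is_kernel u i -> is_kernel u' i'.
Proof.
move=> [x' [xK Kx]] iy iz ux iz' ki; have [y' [yK Ky]] := iy; have [z' [zK Kz]] := iz.
have iE : i' = x \o1 i \o1 z' by rewrite -iz' -vcompA Kz vcomp1r.
apply: kernelI.
- apply: (iso_cancel_r iz); rewrite vcomp0l -vcompA iz' vcompA ux -vcompA.
  by rewrite (proj1 ki) vcomp0r.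
- rewrite iE; apply: mono_comp (iso_mono _); last by exists z.
  by apply: mono_comp (kernel_mono ki); apply: iso_mono; exists x'.
- move=> Z v uv; have [|w wE] := kernel_lift ki (v := x' \o1 v).
    apply: (iso_mono iy); rewrite vcompA -ux vcomp0r -vcompA (vcompA x) Kx vcomp1l.
    exact: uv.
  by exists (z \o1 w); rewrite vcompA iz' -vcompA wE vcompA Kx vcomp1l.
Qed.

Lemma mono_eq0 X Y (m : arr X Y) : is_mono m <-> forall Z (v : arr Z X), m \o1 v = 0 -> v = 0.
Proof.
split=> [mm Z v | mm Z u v e].
  by rewrite -[X in _ = X -> _](vcomp0r _ m) => /mm.
by apply/eqP; rewrite -subr_eq0; apply/eqP/mm; rewrite vcompBr e subrr.
Qed.

Lemma mono_kernel X Y K (u : arr X Y) (i : arr K X) : is_kernel u i -> is_mono u <-> i = 0.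
Proof.
move=> ki; split=> [/mono_eq0 mu | i0]; first exact/mu/(proj1 ki).
by apply/mono_eq0 => Z v /(kernel_lift ki) [w <-]; rewrite i0 vcomp0l.
Qed.

Lemma mono_factor X Y Z (g : arr Y Z) (f : arr X Y) : is_mono (g \o1 f) -> is_mono f.
Proof. by move=> m W u v e; apply: m; rewrite -!vcompA e. Qed.

Lemma injective_iso X Y (f : arr X Y) : is_iso f -> injective_obj X -> injective_obj Y.
Proof.
move=> [f' [fK Kf]] iX U V m g mm; have [h hE] := iX _ _ _ (f' \o1 g) mm.
by exists (f \o1 h); rewrite -vcompA hE vcompA Kf vcomp1l.
Qed.

End LinCatLemmas.

Section Functors.
Variables (k : fieldType) (L L' : linCat k) (F : linFunctor L L').
Implicit Types X Y Z : L.

Lemma fmap0 X Y : fmap F (0 : arr X Y) = 0.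
Proof.
by have := fmapP F (-1) (0 : arr X Y) 0; rewrite scaler0 addr0 scaleN1r addNr.
Qed.

Lemma fmapB X Y (f g : arr X Y) : fmap F (f - g) = fmap F f - fmap F g.
Proof. by have := fmapP F (-1) g f; rewrite !scaleN1r ![- _ + _]addrC. Qed.

Hypothesis F_equiv : is_equivalence F.

Lemma equiv_sym : exists2 G : linFunctor L' L, is_equivalence G &
  forall X, isomorphic (G (F X)) X.
Proof.
have [G [GF FG]] := F_equiv; exists G; first by exists F; split.
by move=> X; have [t [ti _]] := GF; exists (t X).
Qed.

Lemma equiv_faithful X Y (f g : arr X Y) : fmap F f = fmap F g -> f = g.
Proof.
have [G [[t [ti tn]] _]] := F_equiv => e; apply: (iso_cancel_r (ti X)).
by rewrite -!tn e.
Qed.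

Lemma equiv_esurj (Y : L') : exists X, isomorphic (F X) Y.
Proof. by have [G [_ [t [ti _]]]] := F_equiv; exists (G Y), (t Y). Qed.
End Functors.

Section Equivalences.
Variables (k : fieldType) (L L' : linCat k) (F : linFunctor L L').
Hypothesis F_equiv : is_equivalence F.
Implicit Types X Y Z : L.

Lemma equiv_full X Y (h : arr (F X) (F Y)) : exists f, fmap F f = h.
Proof.
have [G [[t [ti tn]] FG]] := F_equiv.
have Ge : is_equivalence G by exists F; split=> //; exists t.
have [t' [tK Kt]] := ti X.
(* Naturality of [t] forces this preimage. The quasi-inverse [G] is faithful too, so the images
   under [G] may be compared, after composition with [t Y]. *)
exists (t Y \o1 fmap G h \o1 t'); apply: (equiv_faithful Ge); apply: (iso_mono (ti Y)).
by rewrite tn -vcompA tK vcomp1r.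
Qed.

Lemma equiv_mono X Y (m : arr X Y) : is_mono m -> is_mono (fmap F m).
Proof.
move=> mm Z u v; have [Z' [e ei]] := equiv_esurj F_equiv Z.
have [u' uE] := equiv_full (u \o1 e); have [v' vE] := equiv_full (v \o1 e).
move=> E; apply: (iso_cancel_r ei); rewrite -uE -vE; congr fmap; apply: mm.
by apply: (equiv_faithful F_equiv); rewrite !fmapM uE vE !vcompA E.
Qed.

Lemma equiv_kernel X Y K (u : arr X Y) (i : arr K X) :
  is_kernel u i -> is_kernel (fmap F u) (fmap F i).
Proof.
move=> ki; apply: kernelI.
- by rewrite -fmapM (proj1 ki) fmap0.
- exact/equiv_mono/(kernel_mono ki).
move=> Z v uv; have [Z' [e [e' [eK Ke]]]] := equiv_esurj F_equiv Z.
have [v' vE] := equiv_full (v \o1 e).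
have [|w wE] := kernel_lift ki (v := v').
  by apply: (equiv_faithful F_equiv); rewrite fmapM vE vcompA uv vcomp0l fmap0.
by exists (fmap F w \o1 e'); rewrite vcompA -fmapM wE vE -vcompA Ke vcomp1r.
Qed.

Lemma equiv_kernel_reflect X Y K (u : arr X Y) (i : arr K X) :
  is_kernel (fmap F u) (fmap F i) -> is_kernel u i.
Proof.
move=> ki; apply: kernelI.
- by apply: (equiv_faithful F_equiv); rewrite fmapM (proj1 ki) fmap0.
- move=> Z v w e; apply: (equiv_faithful F_equiv); apply: (kernel_mono ki).
  by rewrite -!fmapM e.
move=> Z v uv; have [|w wE] := kernel_lift ki (v := fmap F v).
  by rewrite -fmapM uv fmap0.
have [w' w'E] := equiv_full w; exists w'.
by apply: (equiv_faithful F_equiv); rewrite fmapM w'E.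
Qed.

Lemma equiv_injective_reflect X : injective_obj (F X) -> injective_obj X.
Proof.
move=> iX Y Z m f mm; have [h hE] := iX _ _ _ (fmap F f) (equiv_mono mm).
have [h' h'E] := equiv_full h; exists h'.
by apply: (equiv_faithful F_equiv); rewrite fmapM h'E.
Qed.
End Equivalences.

(** Reflection of injectivity, applied to the quasi-inverse [G]: the object [G (F X)] is isomorphic
    to [X]. *)
Lemma equiv_injective (k : fieldType) (L L' : linCat k) (F : linFunctor L L') (X : L) :
  is_equivalence F -> injective_obj X -> injective_obj (F X).
Proof.
move=> Fe iX; have [G Ge GF] := equiv_sym Fe; have [t [t' [tK Kt]]] := GF X.
apply: (equiv_injective_reflect Ge); apply: (injective_iso (f := t')) iX; by exists t.
Qed.

(** * Comodules and kernels *)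

Section TwoCatLemmas.
Variables (k : fieldType) (C : twoCat k).

Lemma heq_hcomp_l (i j l : C) (F : mor j l) (G G' G1 G1' : mor i j) (b : arr G G')
    (b1 : arr G1 G1') : heq b b1 -> heq (idm F \o0 b) (idm F \o0 b1).
Proof. exact: heq_hcomp (heq_refl _). Qed.
Lemma heq_hcomp_r (i j l : C) (F : mor i j) (G G' G1 G1' : mor j l) (b : arr G G')
    (b1 : arr G1 G1') : heq b b1 -> heq (b \o0 idm F) (b1 \o0 idm F).
Proof. by move=> h; exact: heq_hcomp (heq_refl _). Qed.
Lemma heq_whisker_ll (i j l m : C) (F : mor l m) (G : mor j l) (H H' : mor i j)
    (a : arr H H') : heq (idm F \o0 (idm G \o0 a)) (idm (F ** G) \o0 a).
Proof. by rewrite -hcomp_id; exact: heqA. Qed.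
Lemma heq_whisker_rr (i j l m : C) (F F' : mor l m) (G : mor j l) (H : mor i j)
    (a : arr F F') : heq (a \o0 idm (G ** H)) (a \o0 idm G \o0 idm H).
Proof. by rewrite -hcomp_id; exact: heqA. Qed.
Lemma whisker_exch (i j l : C) (F F' : mor j l) (G G' : mor i j) (a : arr F F') (b : arr G G') :
  (a \o0 idm G') \o1 (idm F \o0 b) = (idm F' \o0 b) \o1 (a \o0 idm G).
Proof. by rewrite -!interchange !vcomp1l !vcomp1r. Qed.
End TwoCatLemmas.

Section LexLemmas.
Variables (k : fieldType) (D : lexTwoCat k).

(** Whiskering preserves the chosen kernels, and a morphism is monic exactly when its kernel
    inclusion is zero. *)
Lemma mono_l (i j l : D) (F : mor j l) (X Y : mor i j) (m : arr X Y) :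
  is_mono m -> is_mono (idm F \o0 m).
Proof.
move=> /(mono_kernel (kerP m)) m0; apply/(mono_kernel (ker_l F m)).
by rewrite m0 hcomp0r.
Qed.
Lemma mono_r (i j l : D) (F : mor i j) (X Y : mor j l) (m : arr X Y) :
  is_mono m -> is_mono (m \o0 idm F).
Proof.
move=> /(mono_kernel (kerP m)) m0; apply/(mono_kernel (ker_r F m)).
by rewrite m0 hcomp0l.
Qed.

Section Coactions.
Variables (i j : D) (A : coalg i).

Lemma lcoactionA (X : mor j i) (l : arr X (A ** X)) :
  is_lcoaction l -> heq ((idm A \o0 l) \o1 l) ((comul A \o0 idm X) \o1 l).
Proof. by move=> [e _]; exact: heq_trans (heq_sym (heq_eqhoml _ _)) (eq_heq e). Qed.
Lemma rcoactionA (X : mor i j) (r : arr X (X ** A)) :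
  is_rcoaction r -> heq ((r \o0 idm A) \o1 r) ((idm X \o0 comul A) \o1 r).
Proof. by move=> [e _]; exact: heq_trans (eq_heq e) (heq_eqhoml _ _). Qed.
Lemma rcoaction1 (X : mor i j) (r : arr X (X ** A)) :
  is_rcoaction r -> heq ((idm X \o0 counit A) \o1 r) (idm X).
Proof. by move=> [_ e]; exact: heq_trans (heq_sym (heq_eqhoml _ _)) (eq_heq e). Qed.
End Coactions.

Section Comod.
Variables (i j : D) (A : coalg i).

Lemma lcomod_hom_lift (X Y Z : mor j i) (lX : arr X (A ** X)) (lY : arr Y (A ** Y))
    (lZ : arr Z (A ** Z)) (m : arr Y Z) (w : arr X Y) :
  is_mono m -> lcomod_hom lY lZ m -> lcomod_hom lX lZ (m \o1 w) -> lcomod_hom lX lY w.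
Proof.
move=> /(mono_l (F := A)) mm mP; rewrite /lcomod_hom vcompA mP whisker_l -!vcompA; exact: mm.
Qed.
Lemma rcomod_hom_lift (X Y Z : mor i j) (rX : arr X (X ** A)) (rY : arr Y (Y ** A))
    (rZ : arr Z (Z ** A)) (m : arr Y Z) (w : arr X Y) :
  is_mono m -> rcomod_hom rY rZ m -> rcomod_hom rX rZ (m \o1 w) -> rcomod_hom rX rY w.
Proof.
move=> /(mono_r (F := A)) mm mP; rewrite /rcomod_hom vcompA mP whisker_r -!vcompA; exact: mm.
Qed.

(** A subobject to which the coaction restricts inherits the axioms, because they can be tested
    after the monomorphisms induced by [m]. *)
Lemma lcoaction_restrict (X Y : mor j i) (lX : arr X (A ** X)) (lY : arr Y (A ** Y)) (m : arr X Y) :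
  is_mono m -> lcomod_hom lX lY m -> is_lcoaction lY -> is_lcoaction lX.
Proof.
rewrite /lcomod_hom => mm mP YP; have [cY uY] := YP; split.
- apply: (mono_l (F := A ** A) mm); apply: heq_eq.
  apply: (heq_trans (g := (idm A \o0 lY) \o1 lY \o1 m)).
    have K := heq_sym (heq_whisker_ll A A m).
    apply: heq_trans (heq_comp K (heq_eqhoml _ _)) _.
    by rewrite vcompA -whisker_l -mP whisker_l -!vcompA mP; exact: heq_refl.
  apply: heq_trans (heq_comp (lcoactionA YP) (heq_refl _)) _.
  by rewrite vcompA -whisker_exch -!vcompA mP; exact: heq_refl.
- apply: mm; rewrite vcomp1r vcompA /unl -hcomp1l -vcompA (vcompA (idm _ \o0 m)).
  by rewrite -whisker_exch -vcompA -mP (vcompA _ lY) vcompA uY vcomp1l.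
Qed.

Lemma rcoaction_restrict (X Y : mor i j) (rX : arr X (X ** A)) (rY : arr Y (Y ** A)) (m : arr X Y) :
  is_mono m -> rcomod_hom rX rY m -> is_rcoaction rY -> is_rcoaction rX.
Proof.
rewrite /rcomod_hom => mm mP [cY uY]; split.
- apply: (mono_r (F := A) (mono_r (F := A) mm)); apply: heq_eq.
  rewrite vcompA -whisker_r -mP whisker_r -vcompA -mP vcompA cY.
  apply: (heq_trans (g := (idm Y \o0 comul A) \o1 rY \o1 m)).
    by rewrite -!vcompA; exact: heq_eqhoml.
  rewrite -vcompA mP vcompA -whisker_exch -vcompA.
  exact: heq_comp (heq_whisker_rr _ _ _) (heq_sym (heq_eqhoml _ _)).
- apply: mm; rewrite vcomp1r vcompA /unr -hcomp1r -vcompA (vcompA (m \o0 idm _)).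
  by rewrite whisker_exch -vcompA -mP (vcompA _ rY) vcompA uY vcomp1l.
Qed.

(** Composition with [A] preserves the kernel of the underlying 2-morphism, so this kernel is a
    subcomodule. Its inclusion is a comodule morphism annihilated by [f], hence zero. *)
Lemma lcomod_mono (X Y : lcomodCat j A) (f : arr X Y) :
  is_mono f -> is_mono (shval f : arr (lcmor X) (lcmor Y)).
Proof.
move=> mf; apply/(mono_kernel (kerP _)); set m := kerni _.
have mm : is_mono m := kernel_mono (kerP _).
have s : (idm A \o0 shval f) \o1 (lam X \o1 m) = 0.
  by rewrite vcompA -(shvalP f) -vcompA (proj1 (kerP _)) vcomp0r.
pose K : lcomodCat j A := LComod (lcoaction_restrict mm
  (esym (kliftE (kernel_l A (kerP (shval f : arr (lcmor X) (lcmor Y)))) s)) (lamP X)).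
pose m' : arr K X := @SHom _ _ (lcomodStruct j A) K X m (esym (kliftE _ _)).
suff -> : m = shval m' by rewrite (_ : m' = 0) //; apply/mf/shom_inj; rewrite vcomp0r;
  exact: (proj1 (kerP _)).
by [].
Qed.

Lemma rcomod_mono (X Y : rcomodCat j A) (f : arr X Y) :
  is_mono f -> is_mono (shval f : arr (rcmor X) (rcmor Y)).
Proof.
move=> mf; apply/(mono_kernel (kerP _)); set m := kerni _.
have mm : is_mono m := kernel_mono (kerP _).
have s : (shval f \o0 idm A) \o1 (rho X \o1 m) = 0.
  by rewrite vcompA -(shvalP f) -vcompA (proj1 (kerP _)) vcomp0r.
pose K : rcomodCat j A := RComod (rcoaction_restrict mm
  (esym (kliftE (kernel_r A (kerP (shval f : arr (rcmor X) (rcmor Y)))) s)) (rhoP X)).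
pose m' : arr K X := @SHom _ _ (rcomodStruct j A) K X m (esym (kliftE _ _)).
suff -> : m = shval m' by rewrite (_ : m' = 0) //; apply/mf/shom_inj; rewrite vcomp0r;
  exact: (proj1 (kerP _)).
by [].
Qed.

(** A lift found in the underlying category is again a comodule morphism, because [v] stays monic
    after whiskering with [A]. *)
Lemma rcomod_kernel (X Y K : rcomodCat j A) (u : arr X Y) (v : arr K X) :
  @is_kernel _ (mor i j) (rcmor X) (rcmor Y) (rcmor K) (shval u) (shval v) -> is_kernel u v.
Proof.
move=> kv; have mv := kernel_mono kv; apply: kernelI.
- by apply: shom_inj; exact: (proj1 kv).
- by move=> Z a b e; apply: shom_inj; apply: mv; exact: (congr1 shval e).
move=> Z w /(congr1 shval) /(kernel_lift kv) [x xE].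
have xP : rcomod_hom (rho Z) (rho K) x.
  by apply: rcomod_hom_lift mv (shvalP v) _; rewrite xE; exact: (shvalP w).
by exists (@SHom _ _ (rcomodStruct j A) Z K x xP); apply: shom_inj.
Qed.

Lemma rcomod_iso (X Y : rcomodCat j A) (f : arr X Y) :
  @is_iso _ (mor i j) (rcmor X) (rcmor Y) (shval f) -> is_iso f.
Proof.
move=> fi; have mf := iso_mono fi; have [g [gf fg]] := fi.
have gP : rcomod_hom (rho Y) (rho X) g.
  by apply: rcomod_hom_lift mf (shvalP f) _; rewrite fg; exact: rcomod_hom1.
by exists (@SHom _ _ (rcomodStruct j A) Y X g gP); split; apply: shom_inj.
Qed.

Lemma rcomod_iso_val (X Y : rcomodCat j A) (f : arr X Y) :
  is_iso f -> @is_iso _ (mor i j) (rcmor X) (rcmor Y) (shval f).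
Proof.
by move=> [g [gf fg]]; exists (shval g); split;
  [exact: (congr1 shval gf) | exact: (congr1 shval fg)].
Qed.

(** The equalizer is split by the counit: [idm X \o0 counit A] retracts [rX], and applied to a [v]
    that equalizes the two maps it yields the lift. In other words, [X] is [X [] A]. *)
Lemma coaction_kernel (X : mor i j) (rX : arr X (X ** A)) :
  is_rcoaction rX -> is_kernel (cotdiff rX (comul A)) rX.
Proof.
move=> [cX uX].
have mX : is_mono rX.
  apply: (@mono_factor _ _ _ _ _ (unr X \o1 (idm X \o0 counit A))).
  by rewrite -vcompA uX => Z u v; rewrite !vcomp1l.
apply: kernelI => //; first by apply: cotdiff_eq0; rewrite cX; exact: heq_eqhoml.
move=> Z v /eqP; rewrite vcompBl subr_eq0 -vcompA => /eqP e.
exists (unr X \o1 ((idm X \o0 counit A) \o1 v)).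
(* The coaction is moved past the counit by interchange; then [e] trades it for the
   comultiplication, and the right counit law of [A] applies. *)
apply: heq_eq; rewrite vcompA [rX \o1 _](_ : _ = unr _ \o1 (rX \o0 idm (one i))); last first.
  by rewrite [RHS]hcomp1r.
rewrite -!vcompA; apply: heq_trans (heq_eqhoml _ _) _.
rewrite vcompA whisker_exch -vcompA e.
apply: (heq_trans (g := (idm X \o0 ((idm A \o0 counit A) \o1 comul A)) \o1 v)).
  rewrite whisker_l -vcompA.
  by apply: heq_comp (heq_sym (heq_whisker_ll _ _ _)) (heq_eqhoml _ _).
have K := rcoaction1 (regular_r A).
apply: heq_trans (heq_comp (heq_hcomp_l _ K) (heq_refl _)) _.
by rewrite hcomp_id vcomp1l; exact: heq_refl.
Qed.
End Comod.

Lemma bicomod_iso (i j : D) (A : coalg i) (B : coalg j) (X Y : bicomodCat A B) (f : arr X Y) :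
  @is_iso _ (mor j i) (bcmor X) (bcmor Y) (shval f) -> is_iso f.
Proof.
move=> fi; have mf := iso_mono fi; have [g [gf fg]] := fi; have [fl fr] := shvalP f.
have gP : bicomod_hom g.
  split; [apply: lcomod_hom_lift mf fl _ | apply: rcomod_hom_lift mf fr _]; rewrite fg.
    exact: lcomod_hom1.
  exact: rcomod_hom1.
by exists (@SHom _ _ (bicomodStruct A B) Y X g gP); split; apply: shom_inj.
Qed.

Lemma bicomod_iso_val (i j : D) (A : coalg i) (B : coalg j) (X Y : bicomodCat A B) (f : arr X Y) :
  is_iso f -> @is_iso _ (mor j i) (bcmor X) (bcmor Y) (shval f).
Proof.
by move=> [g [gf fg]]; exists (shval g); split;
  [exact: (congr1 shval gf) | exact: (congr1 shval fg)].
Qed.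
End LexLemmas.

(** * Cotensor products and left injectivity *)

Section Cot.
Variables (k : fieldType) (D : lexTwoCat k).

Section CotMap.
Variables (h j m : D) (B : coalg j) (X X' : mor j m) (Y Y' : mor h j).
Variables (rX : arr X (X ** B)) (rX' : arr X' (X' ** B)).
Variables (lY : arr Y (B ** Y)) (lY' : arr Y' (B ** Y')).
Variables (u : arr X X') (v : arr Y Y').
Hypotheses (uP : rcomod_hom rX rX' u) (vP : lcomod_hom lY lY' v).

Lemma cotmapE : coti rX' lY' \o1 cotmap uP vP = (u \o0 v) \o1 coti rX lY.
Proof. exact: kliftE. Qed.

Lemma cotmap_mono : is_mono (u \o0 v) -> is_mono (cotmap uP vP).
Proof.
move=> m_uv; apply: (@mono_factor _ _ _ _ _ (coti rX' lY')).
by rewrite cotmapE; apply: mono_comp m_uv (coti_mono (rX := rX) (lY := lY)).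
Qed.
End CotMap.

Lemma cotmap_iso (h j m : D) (B : coalg j) (X X' : mor j m) (Y Y' : mor h j)
    (rX : arr X (X ** B)) (rX' : arr X' (X' ** B))
    (lY : arr Y (B ** Y)) (lY' : arr Y' (B ** Y')) (u : arr X X') (v : arr Y Y')
    (uP : rcomod_hom rX rX' u) (vP : lcomod_hom lY lY' v) :
  is_iso u -> is_iso v -> is_iso (cotmap uP vP).
Proof.
move=> iu iv; have mu := iso_mono iu; have mv := iso_mono iv.
have [u' [uK Ku]] := iu; have [v' [vK Kv]] := iv.
have uP' : rcomod_hom rX' rX u' by apply: rcomod_hom_lift mu uP _; rewrite Ku; exact: rcomod_hom1.
have vP' : lcomod_hom lY' lY v' by apply: lcomod_hom_lift mv vP _; rewrite Kv; exact: lcomod_hom1.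
exists (cotmap uP' vP'); split; apply: coti_mono; rewrite vcompA cotmapE -vcompA cotmapE.
  by rewrite vcompA -interchange uK vK hcomp_id vcomp1l vcomp1r.
by rewrite vcompA -interchange Ku Kv hcomp_id vcomp1l vcomp1r.
Qed.

Section Units.
Variables (i j : D) (A : coalg i) (B : coalg j) (M : bicomod A B).
Lemma rhocE : coti (brho M) (comul B) \o1 rhoc M = brho M.
Proof. exact: kliftE. Qed.
Lemma lamcE : coti (comul A) (blam M) \o1 lamc M = blam M.
Proof. exact: kliftE. Qed.
(** The inclusion of the cotensor product and the coaction are kernels of the same morphism; as the
    inclusion is monic, the comparison map is [rhoc M]. *)
Lemma rhoc_iso : is_iso (rhoc M).
Proof.
have [p [ip pE]] := kernel_uniq (kerP _) (coaction_kernel (brhoP M)).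
suff -> : rhoc M = p by [].
by apply: (coti_mono (rX := brho M) (lY := comul B)); apply: etrans rhocE pE.
Qed.
End Units.

(** * The compatibility conditions and injectivity of left comodules *)

Section Morita.
Variables (i j : D) (A : coalg i) (B : coalg j) (M : bicomod A B) (N : bicomod B A).

(** The target [M [] (N [] M)] embeds in [M ** (N ** M)], and [cotA] respects the embeddings of its
    source and target. Comparing there removes associator and unitors and leaves only the composites
    of [f] and [g] with the inclusions. *)
Lemma morita_condP (f : arr (regularBicomod A : bicomodCat A A) (cotensor M N))
    (g : arr (regularBicomod B : bicomodCat B B) (cotensor N M)) :
  cotm (idm (M : bicomodCat A B)) g \o1 rhoc M =
    cotA M N M \o1 (cotm f (idm (M : bicomodCat A B)) \o1 lamc M) <->
  heq ((idm M \o0 (coti (brho N) (blam M) \o1 shval g)) \o1 brho M)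
    (((coti (brho M) (blam N) \o1 shval f) \o0 idm M) \o1 blam M).
Proof.
have L : (idm M \o0 coti (brho N) (blam M)) \o1 coti (brho M) (blam (cotensor N M)) \o1
    (cotm (idm (M : bicomodCat A B)) g \o1 rhoc M) =
    (idm M \o0 (coti (brho N) (blam M) \o1 shval g)) \o1 brho M.
  rewrite whisker_l -!vcompA; congr (_ \o1 _).
  by rewrite vcompA cotmapE -vcompA; congr (_ \o1 _); exact: rhocE.
have R : heq ((idm M \o0 coti (brho N) (blam M)) \o1 coti (brho M) (blam (cotensor N M)) \o1
    (cotA M N M \o1 (cotm f (idm (M : bicomodCat A B)) \o1 lamc M)))
    (((coti (brho M) (blam N) \o1 shval f) \o0 idm M) \o1 blam M).
  rewrite [X in heq X _]vcompA; apply: heq_trans (heq_comp (cotA_heq _ _ _) (heq_refl _)) _.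
  rewrite whisker_r -!vcompA; apply: heq_comp (heq_refl _) _; apply: eq_heq.
  by rewrite vcompA cotmapE -vcompA; congr (_ \o1 _); exact: lamcE.
split=> [e | H]; first by rewrite -L e; exact: R.
by apply: (@cotA_tgt_mono _ _ _ _ _ _ _ _ _ _ M N M); apply: heq_eq; apply: heq_trans (heq_sym R); rewrite L.
Qed.

Variables (f' : arr (A : mor i i) (M ** N)) (g : arr (B : mor j j) (cotensor N M)).
Let g' : arr (B : mor j j) (N ** M) := coti (brho N) (blam M) \o1 g.
Hypothesis f'l : heq ((idm A \o0 f') \o1 comul A) ((blam M \o0 idm N) \o1 f').
Hypothesis f'r : heq ((f' \o0 idm A) \o1 comul A) ((idm M \o0 brho N) \o1 f').
Hypothesis fg : heq ((idm M \o0 g') \o1 brho M) ((f' \o0 idm M) \o1 blam M).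
Hypothesis g_iso : is_iso g.

(** By [f'r] the coaction of [N] turns into the comultiplication of [A], and by coassociativity of
    [lam Y] this equals a second coaction on [Y]. So the right-hand map factors through the kernel
    defining [N [] Y], which composition with [M] preserves. *)
Lemma kappa_subproof (h : D) (Y : lcomod h A) :
  exists x : arr (Y : mor h i) (M ** cot (brho N) (lam Y)),
    heq ((idm M \o0 coti (brho N) (lam Y)) \o1 x) ((f' \o0 idm Y) \o1 lam Y).
Proof.
pose x0 : arr (Y : mor h i) (M ** (N ** Y)) :=
  eqhom (esym (comp1A _ _ _)) \o1 ((f' \o0 idm Y) \o1 lam Y).
have x0E : heq x0 ((f' \o0 idm Y) \o1 lam Y) by exact: heq_eqhoml.
have K1 : heq ((idm M \o0 (brho N \o0 idm Y)) \o1 x0)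
  ((idm (M ** N) \o0 lam Y) \o1 ((f' \o0 idm Y) \o1 lam Y)).
  apply: heq_trans (heq_comp (heqA _ _ _) x0E) _; rewrite !vcompA -whisker_r.
  apply: heq_trans (heq_comp (heq_hcomp_r _ (heq_sym f'r)) (heq_refl _)) _.
  rewrite -whisker_exch whisker_r -!vcompA.
  apply: heq_comp (heq_sym (heq_whisker_rr _ _ _)) _.
  exact: heq_sym (lcoactionA (lamP Y)).
have K2 : heq ((idm M \o0 (idm N \o0 lam Y)) \o1 x0)
  ((idm (M ** N) \o0 lam Y) \o1 ((f' \o0 idm Y) \o1 lam Y)).
  exact: heq_comp (heq_whisker_ll _ _ _) x0E.
have [|x xE] := kernel_lift (kernel_l M (kerP (cotdiff (brho N) (lam Y)))) (v := x0).
  apply/eqP; rewrite hcompBr vcompBl subr_eq0 whisker_l -vcompA; apply/eqP.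
  apply: heq_eq; apply: heq_trans K1 _; apply: heq_sym; apply: heq_trans _ K2.
  have K : heq (idm M \o0 asc N A Y) (idm (M ** (N ** (A ** Y)))).
    by rewrite -hcomp_id; exact: heq_hcomp_l (heq_eqhom _).
  by apply: heq_trans (heq_comp K (heq_refl _)) _; rewrite vcomp1l; exact: heq_refl.
by exists x; rewrite xE.
Qed.

(** The map [Y = A [] Y -> M ** (N [] Y)] induced by [f']. *)
Definition kappa (h : D) (Y : lcomod h A) := sval (cid (kappa_subproof Y)).
Lemma kappaE (h : D) (Y : lcomod h A) :
  heq ((idm M \o0 coti (brho N) (lam Y)) \o1 kappa Y) ((f' \o0 idm Y) \o1 lam Y).
Proof. by rewrite /kappa; case: cid. Qed.

Lemma kappa_nat (h : D) (Y Z : lcomodCat h A) (u : arr Y Z) :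
  kappa Z \o1 shval u = (idm M \o0 cotmap (rcomod_hom1 (brho N)) (shvalP u)) \o1 kappa Y.
Proof.
apply: (mono_l (F := M : mor _ _) (coti_mono (rX := brho N) (lY := lam Z))); apply: heq_eq.
rewrite [X in heq _ X]vcompA -whisker_l cotmapE whisker_l -[X in heq _ X]vcompA [X in heq X _]vcompA.
apply: heq_trans (heq_comp (kappaE Z) (heq_refl _)) _; apply: heq_sym.
apply: heq_trans (heq_comp (heq_whisker_ll _ _ _) (kappaE Y)) _.
rewrite vcompA -whisker_exch -!vcompA; apply: eq_heq; congr (_ \o1 _).
exact: esym (shvalP u).
Qed.

(** Left linearity of [f'] passes to [kappa]. Hence any [e] from [N [] Y] to the identity 1-morphism
    yields a left comodule morphism from [Y] to [M]. *)
Lemma kappa_lin (h : D) (Y : lcomod h A) :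
  heq ((blam M \o0 idm _) \o1 kappa Y) ((idm A \o0 kappa Y) \o1 lam Y).
Proof.
set io := coti (brho N) (lam Y).
apply: heq_sym; apply: heq_trans (heq_sym (heq_eqhoml (comp1A _ _ _) _)) _; apply: eq_heq.
apply: (mono_l (F := (A : mor _ _) ** M) (coti_mono (rX := brho N) (lY := lam Y))); apply: heq_eq.
apply: (heq_trans (g := (idm A \o0 ((f' \o0 idm Y) \o1 lam Y)) \o1 lam Y)).
  have K := heq_sym (heq_whisker_ll A M io).
  apply: heq_trans (heq_comp K (heq_eqhoml _ _)) _.
  rewrite vcompA -whisker_l.
  exact: heq_comp (heq_hcomp_l _ (kappaE Y)) (heq_refl _).
apply: heq_sym; rewrite vcompA -whisker_exch -vcompA.
apply: heq_trans (heq_comp (heq_whisker_rr _ _ _) (kappaE Y)) _.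
rewrite vcompA -whisker_r.
apply: heq_trans (heq_comp (heq_hcomp_r _ (heq_sym f'l)) (heq_refl _)) _.
rewrite whisker_r whisker_l -!vcompA.
exact: heq_comp (heq_sym (heqA _ _ _)) (heq_sym (lcoactionA (lamP Y))).
Qed.

(** Here the compatibility condition [fg] enters: it trades [f'] and the left coaction of [M] for
    [g] and the right coaction. *)
Lemma kappa_M : kappa (LComod (blamP M)) = (idm M \o0 g) \o1 brho M.
Proof.
apply: (mono_l (F := M : mor _ _) (coti_mono (rX := brho N) (lY := blam M))); apply: heq_eq.
apply: heq_trans (kappaE (LComod (blamP M))) _; rewrite vcompA -whisker_l.
exact: heq_sym fg.
Qed.

Hypothesis one_inj : injective_obj (one j).

Lemma morita_left_injective : injective_obj (LComod (blamP M) : lcomodCat j A).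
Proof.
move=> Y Z m h mm; have [g1 [gK Kg]] := g_iso.
have mm' : is_mono (cotmap (rcomod_hom1 (brho N)) (shvalP m)).
  by apply: cotmap_mono; exact/mono_l/lcomod_mono.
(* The map to be extended is the composite [N [] Y -> N [] M -> B -> one j], along the monomorphism
   [N [] m]. *)
have [e eE] := one_inj (counit B \o1 (g1 \o1 cotmap (rcomod_hom1 (brho N)) (shvalP h))) mm'.
pose x : arr (Z : mor j i) M := unr M \o1 ((idm M \o0 e) \o1 kappa Z).
have xE : heq x ((idm M \o0 e) \o1 kappa Z) by exact: heq_eqhoml.
have xP : lcomod_hom (lam Z) (blam M) x.
  apply: heq_eq; apply: (heq_trans (g := ((blam M \o0 idm (one j)) \o1 (idm M \o0 e)) \o1 kappa Z)).
    by rewrite -vcompA; exact: heq_comp (heq_sym (heq1r _)) xE.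
  rewrite whisker_exch -vcompA; apply: heq_sym.
  apply: heq_trans (heq_comp (heq_hcomp_l _ xE) (heq_refl _)) _.
  rewrite whisker_l -vcompA.
  exact: heq_comp (heq_whisker_ll _ _ _) (heq_sym (kappa_lin Z)).
exists (@SHom _ _ (lcomodStruct j A) Z (LComod (blamP M)) x xP); apply: shom_inj => /=.
(* Naturality of [kappa] brings [h] to the right, [kappa_M] cancels [g1] against [g], and the counit
   law of [brho M] leaves [h]. *)
rewrite /x -!vcompA kappa_nat (vcompA (idm M \o0 e)) -whisker_l eE vcompA.
rewrite [counit B \o1 _]vcompA whisker_l -!vcompA -(@kappa_nat _ Y (LComod (blamP M)) h) kappa_M.
rewrite !vcompA -(vcompA (unr M)) -whisker_l -(vcompA (counit B)) gK vcomp1r.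
by rewrite -(vcompA (unr M)) (proj2 (brhoP M)) vcomp1l.
Qed.
End Morita.

(** The regular comodule is cofree on the identity 1-morphism: [h] is recovered from
    [counit A \o1 h] by whiskering with [A] and composing with the coaction. So it suffices to
    extend [counit A \o1 h]. *)
Lemma regular_right_injective (i : D) (A : coalg i) :
  injective_obj (one i) -> injective_obj (RComod (regular_r A) : rcomodCat i A).
Proof.
move=> one_inj Y Z m h mm.
have [e eE] := one_inj _ _ _ (counit A \o1 shval h) (rcomod_mono mm).
pose x : arr (Z : mor i i) A := unl A \o1 ((e \o0 idm A) \o1 rho Z).
have xE : heq x ((e \o0 idm A) \o1 rho Z) by exact: heq_eqhoml.
have xP : rcomod_hom (rho Z) (comul A) x.
  apply: heq_eq.
  apply: (heq_trans (g := ((idm (one i) \o0 comul A) \o1 (e \o0 idm A)) \o1 rho Z)).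
    by rewrite -vcompA; exact: heq_comp (heq_sym (heq1l _)) xE.
  rewrite -whisker_exch -vcompA; apply: heq_sym.
  apply: heq_trans (heq_comp (heq_hcomp_r _ xE) (heq_refl _)) _.
  rewrite whisker_r -vcompA.
  exact: heq_comp (heq_sym (heq_whisker_rr _ _ _)) (rcoactionA (rhoP Z)).
exists (@SHom _ _ (rcomodStruct i A) Z (RComod (regular_r A)) x xP); apply: shom_inj => /=.
rewrite /x -!vcompA (shvalP m) (vcompA (e \o0 idm A)) -whisker_r eE whisker_r -vcompA.
by rewrite -(shvalP h) (vcompA (counit A \o0 _)) vcompA counitl vcomp1l.
Qed.
End Cot.

(** As [m] is monic, its kernel inclusion, represented by an identity, is null. So the identity of
    [abX V] factors through the entries of [abKer t], which are those of [V] and the component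
    [tg t]. Modulo null maps it is therefore [r \o1 tg t], and composing [f] with [r] gives the
    extension. *)
Lemma abEmb_injective (k : fieldType) (L : linCat k) (P : L) :
  injective_obj (abEmb P : abCat L).
Proof.
move=> V W m f mm; pose t := abrep m.
(* Closed under sums, so it can be checked on each summand of the factorization of the identity. *)
pose S (g : arr (abX V) (abX V)) := exists r, @abnull _ _ V V (g - r \o1 tg t).
have S0 : S 0 by exists 0; rewrite vcomp0l subr0; exact: abnull0.
have SD g g' : S g -> S g' -> S (g + g').
  by move=> [r rP] [r' rP']; exists (r + r'); rewrite vcompDl opprD addrACA; exact: abnullD.
have Sker s (q : arr (kerY W s) (abX V)) : S (q \o1 kerf t s).
  case: s q => [a|b] q /=; last by exists q; rewrite subrr; exact: abnull0.
  exists 0; rewrite vcomp0l subr0; exists (fun a' => q \o1 cdelta (@abY _ _ V) a' a).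
  by under eq_bigr do rewrite -vcompA; rewrite -vcomp_sumr cdelta_sum.
have [r rP] : S (idm (abX V)).
  have /abclP /= : abcl (kertup t) = abcl (tzero (abKer t) V).
    exact: (proj1 (mono_kernel (abkerP m)) mm).
  rewrite subr0 => -[q <-]; apply: big_ind => // i _; exact: Sker.
(* [abEmb P] has no entries, so the commutation condition on tuples into it is vacuous. *)
have vac (j : 'I_0) : @abf _ _ (abEmb P) j \o1 (tg (abrep f) \o1 r) =
    \sum_i (0 : arr (@abY _ _ W i) P) \o1 @abf _ _ W i by case: j.
exists (abcl (@AbTuple _ _ W (abEmb P) (tg (abrep f) \o1 r) (fun i j => 0) vac)).
rewrite -[m]abrepK -[RHS]abrepK abcompE; apply/abclP => /=.
rewrite -opprB; apply: abnullN; rewrite -{1}[tg _]vcomp1r -vcompA -vcompBr.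
exact: abnull_compr.
Qed.

(** * The functor [- [] M] *)

Lemma heq_sub (k : fieldType) (L : linCat k) (X Y X' Y' : L) (f g : arr X Y) (f' g' : arr X' Y') :
  heq f f' -> heq g g' -> heq (f - g) (f' - g').
Proof.
case=> e [e']; case: X' / e f' g' => f' g'; case: Y' / e' f' g' => f' g' /=.
by rewrite vcomp1l vcomp1r => -> /heq_eq ->; exact: heq_refl.
Qed.

Lemma nat_iso_sym (k : fieldType) (L L' : linCat k) (F G : L -> L')
    (Fm : forall X Y, arr X Y -> arr (F X) (F Y)) (Gm : forall X Y, arr X Y -> arr (G X) (G Y)) :
  nat_iso_to Fm Gm -> nat_iso_to Gm Fm.
Proof.
move=> [t [ti tn]]; pose s X := sval (cid (ti X)).
have sP X : s X \o1 t X = idm _ /\ t X \o1 s X = idm _ by rewrite /s; case: cid.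
exists s; split=> [X | X Y f]; first by exists (t X); case: (sP X).
apply: (iso_mono (ti Y)); rewrite !vcompA (proj2 (sP Y)) vcomp1l tn -vcompA.
by rewrite (proj2 (sP X)) vcomp1r.
Qed.

(** * Trivial coalgebras *)

Section TrivialCoalgebra.
Variables (k : fieldType) (C : twoCat k).

Section Triv.
Variable l : C.
Let c : arr (one l) (one l ** one l) := eqhom (esym (comp1_1l (one l))).
Lemma trivial_coassoc : asc _ _ _ \o1 ((idm (one l) \o0 c) \o1 c) = (c \o0 idm (one l)) \o1 c.
Proof.
apply: heq_eq; apply: heq_trans (heq_eqhoml _ _) _.
exact: heq_comp (heq_trans (heq1l _) (heq_sym (heq1r _))) (heq_refl _).
Qed.
Lemma trivial_counitl : unl _ \o1 ((idm (one l) \o0 idm (one l)) \o1 c) = idm (one l).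
Proof. by rewrite hcomp_id vcomp1l; exact: eqhomVK. Qed.
Lemma trivial_counitr : unr _ \o1 ((idm (one l) \o0 idm (one l)) \o1 c) = idm (one l).
Proof.
rewrite hcomp_id vcomp1l; apply: heq_eq; apply: heq_trans (heq_eqhoml _ _) _.
exact: heq_eqhom.
Qed.
Definition trivialCoalg : coalg l := Coalg trivial_coassoc trivial_counitl trivial_counitr.
End Triv.

Variables (i l : C) (A : coalg i) (X : rcomod l A).
Let lX : arr (X : mor i l) (trivialCoalg l ** X) := eqhom (esym (comp1_1l (X : mor i l))).

Lemma trivial_lcoaction : is_lcoaction lX.
Proof.
split; last by rewrite hcomp_id vcomp1l; exact: eqhomVK.
apply: heq_eq; apply: heq_trans (heq_eqhoml _ _) _; apply: heq_comp (heq_refl _).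
apply: heq_trans (heq1l _) _; apply: heq_trans (heq_eqhom _) _.
apply: heq_sym; apply: heq_trans (heq_hcomp_r _ (heq_eqhom _)) _.
by rewrite hcomp_id; exact: heq_idm (comp1_1l _).
Qed.

Lemma trivial_bicomod_comm :
  asc _ _ _ \o1 ((idm (trivialCoalg l) \o0 rho X) \o1 lX) = (lX \o0 idm A) \o1 rho X.
Proof.
apply: heq_eq; apply: heq_trans (heq_eqhoml _ _) _.
apply: heq_trans (heq_comp (heq1l _) (heq_eqhom _)) _; rewrite vcomp1r; apply: heq_sym.
apply: heq_trans (heq_comp (heq_hcomp_r _ (heq_eqhom _)) (heq_refl _)) _.
by rewrite hcomp_id vcomp1l; exact: heq_refl.
Qed.

(** A right comodule is a bicomodule over the trivial coalgebra; this makes the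
    bicomodule constructions of cotensor products available for comodules. *)
Definition trivialBicomod : bicomod (trivialCoalg l) A :=
  BiComod trivial_lcoaction (rhoP X) trivial_bicomod_comm.
End TrivialCoalgebra.

Section CotFunctor.
Variables (k : fieldType) (D : lexTwoCat k).

Lemma cot_hom_l (h i j : D) (A : coalg i) (B : coalg j) (E : coalg h) (M : bicomod A B)
    (N : bicomod B E) (X : mor h i) (lX : arr X (A ** X)) (f : arr X (cotensor M N)) :
  lcomod_hom lX (blam (cotensor M N)) f ->
  heq ((idm A \o0 (coti (brho M) (blam N) \o1 f)) \o1 lX)
    ((blam M \o0 idm N) \o1 (coti (brho M) (blam N) \o1 f)).
Proof.
move=> fP; rewrite whisker_l -vcompA -fP !vcompA.
exact: heq_comp (cot_lamE _ _) (heq_refl _).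
Qed.
Lemma cot_hom_r (h i j : D) (A : coalg i) (B : coalg j) (E : coalg h) (M : bicomod A B)
    (N : bicomod B E) (X : mor h i) (rX : arr X (X ** E)) (f : arr X (cotensor M N)) :
  rcomod_hom rX (brho (cotensor M N)) f ->
  heq (((coti (brho M) (blam N) \o1 f) \o0 idm E) \o1 rX)
    ((idm M \o0 brho N) \o1 (coti (brho M) (blam N) \o1 f)).
Proof.
move=> fP; rewrite whisker_r -vcompA -fP !vcompA.
exact: heq_comp (cot_rhoE _ _) (heq_refl _).
Qed.

Section Functor.
Variables (i j : D) (A : coalg i) (B : coalg j) (M : bicomod A B).

Section Hom.
Variable l : D.

Definition cotObj (X : rcomodCat l A) : rcomodCat l B :=
  RComod (cot_rhoP (trivialBicomod X) M).
Definition cotInc (X : rcomodCat l A) : arr (rcmor (cotObj X)) (rcmor X ** M) :=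
  coti (rho X) (blam M).
Lemma cotInc_mono X : is_mono (cotInc X). Proof. exact: coti_mono. Qed.
Lemma cotInc_rho X :
  heq ((cotInc X \o0 idm B) \o1 rho (cotObj X)) ((idm (rcmor X) \o0 brho M) \o1 cotInc X).
Proof. exact: cot_rhoE. Qed.

Section Map.
Variables (X Y : rcomodCat l A) (u : arr X Y).
Definition cotArr : arr (rcmor (cotObj X)) (rcmor (cotObj Y)) :=
  cotmap (shvalP u) (lcomod_hom1 (blam M)).
Lemma cotArrE : cotInc Y \o1 cotArr = (shval u \o0 idm M) \o1 cotInc X.
Proof. exact: cotmapE. Qed.
Lemma cotArrP : rcomod_hom (rho (cotObj X)) (rho (cotObj Y)) cotArr.
Proof.
rewrite /rcomod_hom; apply: (mono_r (F := B : mor _ _) (cotInc_mono (X := Y))); apply: heq_eq.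
rewrite vcompA; apply: heq_trans (heq_comp (cotInc_rho Y) (heq_refl _)) _.
rewrite -vcompA cotArrE [X in heq X _]vcompA -whisker_exch; apply: heq_sym.
rewrite [X in heq X _]vcompA -whisker_r cotArrE whisker_r -vcompA -[X in heq _ X]vcompA.
exact: heq_comp (heq_sym (heq_whisker_rr _ _ _)) (cotInc_rho X).
Qed.
Definition cotHom : arr (cotObj X) (cotObj Y) :=
  @SHom _ _ (rcomodStruct l B) (cotObj X) (cotObj Y) cotArr cotArrP.
End Map.

Lemma cotHomP (X Y : rcomodCat l A) (a : k) (f g : arr X Y) :
  cotHom (a *: f + g) = a *: cotHom f + cotHom g.
Proof.
apply: shom_inj; rewrite shvalE; apply: (cotInc_mono (X := Y)).
rewrite vcompPr [LHS]cotArrE [_ \o1 shval (cotHom f)]cotArrE [_ \o1 shval (cotHom g)]cotArrE.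
by rewrite shvalE hcompPl vcompPl.
Qed.
Lemma cotHom1 (X : rcomodCat l A) : cotHom (idm X) = idm (cotObj X).
Proof.
apply: shom_inj; apply: (cotInc_mono (X := X)).
by rewrite [LHS]cotArrE hcomp_id vcomp1l [RHS]vcomp1r.
Qed.
Lemma cotHomM (X Y Z : rcomodCat l A) (g : arr Y Z) (f : arr X Y) :
  cotHom (g \o1 f) = cotHom g \o1 cotHom f.
Proof.
apply: shom_inj; apply: (cotInc_mono (X := Z)); rewrite [LHS]cotArrE whisker_r -vcompA.
by rewrite -(cotArrE f) vcompA -(cotArrE g) -vcompA.
Qed.
Definition cotFunctor : linFunctor (rcomodCat l A) (rcomodCat l B) :=
  LinFunctor cotHomP cotHom1 cotHomM.
End Hom.

Section Act.
Variables (l m : D) (F : mor l m) (X : rcomodCat l A).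

(** Up to transport, [cotdiff] for [ract F X] is [F] applied to [cotdiff] for [X], and composition
    with [F] preserves kernels. The equation with the inclusions pins the isomorphism down and
    reduces its coherence laws to identities of inclusions. *)
Lemma cotAct_subproof : exists p : arr (rcmor (cotObj (ract F X))) (F ** rcmor (cotObj X)),
  is_iso p /\ heq ((idm F \o0 cotInc X) \o1 p) (cotInc (ract F X)).
Proof.
have K : heq (cotdiff (rho (ract F X)) (blam M)) (idm F \o0 cotdiff (rho X) (blam M)).
  rewrite hcompBr; apply: heq_sub.
    by apply: heq_trans (heq_hcomp_r _ (act_rho_heq _ _)) _; exact: heq_sym (heqA _ _ _).
  apply: heq_trans (heq_eqhoml _ _) _; rewrite whisker_l.
  apply: heq_trans (heq_sym (heq_whisker_ll _ _ _)) _.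
  apply: heq_sym; apply: heq_trans (heq_comp (heq_hcomp_l _ (heq_eqhom _)) (heq_refl _)) _.
  by rewrite hcomp_id vcomp1l; exact: heq_refl.
pose x := eqhom (esym (comp1A F (rcmor X) M)) \o1 cotInc (ract F X).
have xE : heq x (cotInc (ract F X)) by exact: heq_eqhoml.
have kx := heq_kernel K (heq_sym xE) (kerP _).
have [p [ip pE]] := kernel_uniq (kernel_l F (kerP (cotdiff (rho X) (blam M)))) kx.
by exists p; split=> //; apply: heq_trans xE; apply: eq_heq; rewrite pE.
Qed.

Definition cotActVal := sval (cid cotAct_subproof).
Lemma cotActVal_iso : is_iso cotActVal.
Proof. by rewrite /cotActVal; case: cid => p []. Qed.
Lemma cotActE : heq ((idm F \o0 cotInc X) \o1 cotActVal) (cotInc (ract F X)).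
Proof. by rewrite /cotActVal; case: cid => p []. Qed.

Lemma cotActP : rcomod_hom (rho (cotObj (ract F X))) (rho (ract F (cotObj X))) cotActVal.
Proof.
rewrite /rcomod_hom; apply: (mono_r (F := B : mor _ _) (mono_l (F := F) (cotInc_mono (X := X))));
  apply: heq_eq.
apply: (heq_trans (g := (idm F \o0 (idm (rcmor X) \o0 brho M)) \o1 ((idm F \o0 cotInc X) \o1 cotActVal))).
  rewrite [X in heq X _]vcompA [X in heq _ X]vcompA; apply: heq_comp (heq_refl _).
  rewrite -whisker_l.
  apply: heq_trans (heq_comp (heq_sym (heqA _ _ _)) (act_rho_heq _ _)) _.
  by rewrite -whisker_l; exact: heq_hcomp_l (cotInc_rho X).
apply: heq_trans (heq_comp (heq_whisker_ll _ _ _) cotActE) _; apply: heq_sym.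
rewrite vcompA -whisker_r.
apply: heq_trans (heq_comp (heq_hcomp_r _ cotActE) (heq_refl _)) _.
exact: cotInc_rho.
Qed.
Definition cotAct : arr (cotObj (ract F X)) (ract F (cotObj X)) :=
  @SHom _ _ (rcomodStruct m B) (cotObj (ract F X)) (ract F (cotObj X)) cotActVal cotActP.
Lemma cotAct_iso : is_iso cotAct.
Proof. apply: rcomod_iso; exact: cotActVal_iso. Qed.
End Act.

Lemma cotAct_nat (l m : D) (F F' : mor l m) (X X' : rcomodCat l A) (a : arr F F') (f : arr X X') :
  cotAct F' X' \o1 cotHom (ract2 a f) = ract2 a (cotHom f) \o1 cotAct F X.
Proof.
apply: shom_inj; apply: (mono_l (F := F') (cotInc_mono (X := X'))); apply: heq_eq.
apply: (heq_trans (g := ((a \o0 shval f) \o0 idm M) \o1 cotInc (ract F X))).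
  rewrite vcompA; apply: heq_trans (heq_comp (cotActE _ _) (heq_refl _)) _.
  apply: eq_heq; exact: cotArrE.
apply: heq_sym.
rewrite [X in heq X _]vcompA -[X in heq (X \o1 _) _]interchange vcomp1l.
rewrite [cotInc X' \o1 _]cotArrE -[a in X in heq X _]vcomp1r interchange -vcompA.
exact: heq_comp (heqA _ _ _) (cotActE _ _).
Qed.

Lemma cotInc_eqhom (l : D) (X X' : rcomodCat l A) (e : X = X') :
  heq (cotInc X' \o1 shval (cotHom (eqhom e))) (cotInc X).
Proof. by case: X' / e; rewrite cotHom1 vcomp1r; exact: heq_refl. Qed.

Lemma cotActA (l m n : D) (F : mor m n) (G : mor l m) (X : rcomodCat l A) :
  cotAct (F ** G) X \o1 cotHom (eqhom (ractA F G X)) =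
  eqhom (ractA F G (cotObj X)) \o1 (ract2 (idm F) (cotAct G X) \o1 cotAct F (ract G X)).
Proof.
apply: shom_inj; apply: (mono_l (F := F ** G) (cotInc_mono (X := X))); apply: heq_eq.
apply: (heq_trans (g := cotInc (ract F (ract G X)))).
  rewrite vcompA; apply: heq_trans (heq_comp (cotActE _ _) (heq_refl _)) _.
  exact: cotInc_eqhom.
rewrite /= shval_eqhom; apply: heq_sym.
apply: heq_trans (heq_comp (heq_sym (heq_whisker_ll _ _ _)) (heq_eqhoml _ _)) _.
rewrite vcompA -whisker_l.
apply: heq_trans (heq_comp (heq_hcomp_l _ (cotActE _ _)) (heq_refl _)) _.
exact: (cotActE F (ract G X)).
Qed.

Lemma cotAct1 (l : D) (X : rcomodCat l A) :
  eqhom (ract1 (cotObj X)) \o1 cotAct (one l) X = cotHom (eqhom (ract1 X)).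
Proof.
apply: shom_inj; apply: (cotInc_mono (X := X)); apply: heq_eq; apply: heq_sym.
apply: heq_trans (cotInc_eqhom _) _; rewrite /= shval_eqhom; apply: heq_sym.
apply: heq_trans (heq_comp (heq_sym (heq1l _)) (heq_eqhoml _ _)) _.
exact: cotActE.
Qed.

Definition cotRepMor : repMor (comod A) (comod B) :=
  @RepMor k D (comod A) (comod B) cotFunctor (@cotAct) (@cotAct_iso) (@cotAct_nat)
    (@cotActA) (@cotAct1).
End Functor.

(** * The natural isomorphism from X to (X [] M) [] N *)

Section Unit.
Variables (i j : D) (A : coalg i) (B : coalg j) (M : bicomod A B) (N : bicomod B A).
Variable f : arr (regularBicomod A : bicomodCat A A) (cotensor M N).
Hypothesis f_iso : is_iso f.
Variable l : D.
Let f' := coti (brho M) (blam N) \o1 shval f.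
Let T X := cotObj N (cotObj M X : rcomodCat l B).
Let s (X : rcomodCat l A) := (cotInc M X \o0 idm N) \o1 cotInc N (cotObj M X).

(** The composite [X -> X [] A -> X [] (M [] N) -> (X [] M) [] N] of [rhoc], [f] and the inverse
    associator. Its composite with the embedding [s] is recorded because linearity and naturality
    are checked there. *)
Lemma cotUnit_subproof (X : rcomodCat l A) : exists eta : arr (rcmor X) (rcmor (T X)),
  is_iso eta /\ heq (s X \o1 eta) ((idm (rcmor X) \o0 f') \o1 rho X).
Proof.
pose X' := trivialBicomod X.
have [c [cK Kc]] := cotA_iso X' M N.
pose q : arr (cotensor X' (regularBicomod A) : mor i l) (cotensor X' (cotensor M N)) :=
  cotmap (rcomod_hom1 (rho X)) (proj1 (shvalP f)).
pose eta1 : arr (rcmor X : mor i l) (cotensor X' (cotensor M N)) := q \o1 rhoc X'.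
pose eta : arr (rcmor X : mor i l) (cotensor (cotensor X' M) N) := c \o1 eta1.
have eta1_iso : is_iso eta1.
  refine (@iso_comp _ _ _ _ _ q (rhoc X') _ (rhoc_iso X')).
  apply: cotmap_iso; last exact: bicomod_iso_val f_iso.
  exact: eqhom_iso erefl.
have eta_iso : is_iso eta by apply: iso_comp eta1_iso; exists (cotA X' M N).
exists eta; split=> //; rewrite /eta vcompA.
have sc : heq (s X \o1 c) ((idm X' \o0 coti (brho M) (blam N)) \o1 coti (rho X) (blam (cotensor M N))).
  have H := heq_sym (cotA_heq X' M N).
  apply: heq_trans (heq_comp H (heq_refl _)) _.
  by rewrite -vcompA Kc vcomp1r; exact: heq_refl.
apply: heq_trans (heq_comp sc (heq_refl _)) _; apply: eq_heq.
rewrite whisker_l -!vcompA; congr (_ \o1 _).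
rewrite [LHS]vcompA [coti _ _ \o1 q]cotmapE -vcompA; congr (_ \o1 _).
exact: (rhocE X').
Qed.

Definition cotUnitVal X := sval (cid (cotUnit_subproof X)).
Lemma cotUnitVal_iso X : is_iso (cotUnitVal X).
Proof. by rewrite /cotUnitVal; case: cid => p []. Qed.
Lemma cotUnitE X : heq (s X \o1 cotUnitVal X) ((idm (rcmor X) \o0 f') \o1 rho X).
Proof. by rewrite /cotUnitVal; case: cid => p []. Qed.
Lemma cotUnit_mono X : is_mono (s X).
Proof. exact: mono_comp (mono_r (cotInc_mono (X := _))) (cotInc_mono (X := _)). Qed.

Lemma cotUnitP X : rcomod_hom (rho X) (rho (T X)) (cotUnitVal X).
Proof.
rewrite /rcomod_hom; apply: (mono_r (F := A : mor _ _) (cotUnit_mono (X := X))); apply: heq_eq.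
apply: (heq_trans (g := (idm (rcmor X) \o0 ((idm M \o0 brho N) \o1 f')) \o1 rho X)).
  rewrite [Q in heq Q _]vcompA whisker_r -(vcompA (cotInc M X \o0 idm N \o0 idm A)).
  have H := cotInc_rho N (cotObj M X).
  apply: heq_trans (heq_comp (heq_comp (heq_sym (heq_whisker_rr _ _ _)) H) (heq_refl _)) _.
  apply: (heq_trans (g := (idm (rcmor X ** M) \o0 brho N) \o1 (s X \o1 cotUnitVal X))).
    by rewrite /s !vcompA -whisker_exch; exact: heq_refl.
  apply: heq_trans (heq_comp (heq_sym (heq_whisker_ll _ _ _)) (cotUnitE X)) _.
  by rewrite whisker_l -vcompA; exact: heq_refl.
have H := cot_hom_r (proj2 (shvalP f)).
apply: heq_trans (heq_comp (heq_hcomp_l _ (heq_sym H)) (heq_refl _)) _.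
rewrite [Q in heq _ Q]vcompA -whisker_r; apply: heq_sym.
apply: heq_trans (heq_comp (heq_hcomp_r _ (cotUnitE X)) (heq_refl _)) _.
rewrite whisker_r whisker_l -!vcompA.
exact: heq_comp (heq_sym (heqA _ _ _)) (rcoactionA (rhoP X)).
Qed.
Definition cotUnit (X : rcomodCat l A) : arr X (T X : rcomodCat l A) :=
  @SHom _ _ (rcomodStruct l A) X (T X) (cotUnitVal X) (cotUnitP X).

Lemma cotUnit_nat_iso :
  nat_iso_to (fun X Y (u : arr X Y) => fmap (cotFunctor N l) (fmap (cotFunctor M l) u))
    (fun X Y (u : arr X Y) => u).
Proof.
apply: nat_iso_sym; exists cotUnit; split=> [X | X Y u].
  apply: rcomod_iso; exact: cotUnitVal_iso.
apply: shom_inj; apply: (cotUnit_mono (X := Y)); apply: heq_eq.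
apply: (heq_trans (g := (shval u \o0 idm (M ** N)) \o1 ((idm (rcmor X) \o0 f') \o1 rho X))).
  rewrite vcompA; apply: heq_trans (heq_comp (cotUnitE Y) (heq_refl _)) _; apply: eq_heq.
  by rewrite -vcompA [rho Y \o1 _](shvalP u) !vcompA whisker_exch.
apply: heq_sym.
apply: (heq_trans (g := (shval u \o0 idm M \o0 idm N) \o1 (s X \o1 cotUnitVal X))).
  apply: eq_heq; rewrite [LHS]vcompA [RHS]vcompA; congr (_ \o1 _).
  rewrite /s -vcompA [cotInc N _ \o1 _]cotArrE !vcompA -!whisker_r; congr (_ \o0 _ \o1 _).
  exact: cotArrE.
exact: heq_comp (heq_sym (heq_whisker_rr _ _ _)) (cotUnitE X).
Qed.
End Unit.

Lemma morita_rep_equivalent (i j : D) (A : coalg i) (B : coalg j) (M : bicomod A B) (N : bicomod B A)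
    (f : arr (regularBicomod A : bicomodCat A A) (cotensor M N))
    (g : arr (regularBicomod B : bicomodCat B B) (cotensor N M)) :
  is_iso f -> is_iso g -> rep_equivalent (comod A) (comod B).
Proof.
move=> fi gi; exists (cotRepMor M) => l; exists (cotFunctor N l).
(* The second natural isomorphism is the first with [A], [B] and with [M], [N] exchanged. *)
by split; [exact: cotUnit_nat_iso fi l | exact: cotUnit_nat_iso gi l].
Qed.
End CotFunctor.

(** * The bicomodules of an equivalence *)

(** Equalities of 1-morphisms obtained from a 2-representation and those from [comp1A] or [comp1_1l]
    have different proofs; this exchanges them. *)
Lemma eqhom_irrl (k : fieldType) (L : linCat k) (X Y Z : L) (e e' : Y = Z) (u : arr X Y) v :
  eqhom e \o1 u = v -> eqhom e' \o1 u = v.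
Proof. by rewrite (Prop_irrelevance e e'). Qed.

(** * Cotensor equalizers and transposition in 2-representations *)

Section Rep.
Variables (k : fieldType) (C : twoCat k) (R : rep2 C).

Lemma act2_idM (i j : C) (F : mor i j) (X Y Z : R i) (g : arr Y Z) (f : arr X Y) :
  act2 (idm F) (g \o1 f) = act2 (idm F) g \o1 act2 (idm F) f.
Proof. by rewrite -act2M vcomp1l. Qed.
Lemma act2_exch (i j : C) (F F' : mor i j) (X X' : R i) (a : arr F F') (f : arr X X') :
  act2 a (idm X') \o1 act2 (idm F) f = act2 (idm F') f \o1 act2 a (idm X).
Proof. by rewrite -!act2M !vcomp1l !vcomp1r. Qed.
Lemma act2_iso (i j : C) (F : mor i j) (X X' : R i) (f : arr X X') :
  is_iso f -> is_iso (act2 (idm F) f).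
Proof.
by move=> [g [gf fg]]; exists (act2 (idm F) g); rewrite -!act2_idM gf fg !act2_id.
Qed.

(** The analogue of [cotdiff] for the action of a 2-representation. *)
Definition rdiff (j l : C) (B : mor j j) (F : mor j l) (r : arr F (F ** B)) (X : R j)
    (x : arr X (act B X)) : arr (act F X) (act (F ** B) X) :=
  act2 r (idm X) - eqhom (actA F B X) \o1 act2 (idm F) x.

Lemma rdiff_nat (j l : C) (B : mor j j) (F : mor j l) (r : arr F (F ** B)) (X X' : R j)
    (x : arr X (act B X)) (x' : arr X' (act B X')) (f : arr X X') :
  act2 (idm B) f \o1 x = x' \o1 f ->
  act2 (idm (F ** B)) f \o1 rdiff r x = rdiff r x' \o1 act2 (idm F) f.
Proof.
move=> e; rewrite vcompBl vcompBr -act2_exch; congr (_ - _).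
by rewrite vcompA -hcomp_id -act2A -!vcompA -!act2_idM e.
Qed.
End Rep.

Section RepMorphism.
Variables (k : fieldType) (C : twoCat k) (R R' : rep2 C) (Phi : repMor R R').

(** This carries kernels of [rdiff] through [Phi]: up to the coherence isomorphisms, the image of
    such a morphism is again of this form. *)
Lemma rcomm_rdiff (j l : C) (B : mor j j) (F : mor j l) (r : arr F (F ** B)) (X : R j)
    (x : arr X (act B X)) :
  rcomm Phi (F ** B) X \o1 fmap (Phi l) (rdiff r x) =
  rdiff r (rcomm Phi B X \o1 fmap (Phi j) x) \o1 rcomm Phi F X.
Proof.
rewrite fmapB fmapM vcompBr vcompBl rcomm_nat fmap1; congr (_ - _).
by rewrite vcompA rcommA -!vcompA rcomm_nat act2_idM -!vcompA.
Qed.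

Section Hat.
Variables (j : C) (X0 : R j) (Y0 : R' j) (theta : arr (Phi j X0) Y0).
Hypothesis theta_iso : is_iso theta.

(** Transposition along [theta]. When [theta] is invertible and [Phi] is an equivalence, it is a
    bijection, by [hat_inj] and [hat_surj]. *)
Definition hat (l : C) (F : mor j l) (X : R l) (h : arr X (act F X0)) :
    arr (Phi l X) (act F Y0) :=
  act2 (idm F) theta \o1 (rcomm Phi F X0 \o1 fmap (Phi l) h).

Lemma hat_nat (l : C) (F F' : mor j l) (X : R l) (a : arr F F') (h : arr X (act F X0)) :
  hat (act2 a (idm X0) \o1 h) = act2 a (idm Y0) \o1 hat h.
Proof. by rewrite /hat fmapM (vcompA (rcomm _ _ _)) rcomm_nat fmap1 !vcompA act2_exch. Qed.

Lemma hat_pre (l : C) (F : mor j l) (X X' : R l) (h : arr X (act F X0)) (u : arr X' X) :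
  hat (h \o1 u) = hat h \o1 fmap (Phi l) u.
Proof. by rewrite /hat fmapM !vcompA. Qed.

Lemma hat_act (l m : C) (G : mor l m) (F : mor j l) (X : R l) (h : arr X (act F X0)) :
  hat (eqhom (actA G F X0) \o1 act2 (idm G) h) =
  eqhom (actA G F Y0) \o1 (act2 (idm G) (hat h) \o1 rcomm Phi G X).
Proof.
rewrite /hat fmapM (vcompA (rcomm _ _ _)) rcommA !act2_idM -!vcompA rcomm_nat !vcompA.
by rewrite -hcomp_id -act2A.
Qed.

Lemma hat_inj (l : C) (F : mor j l) (X : R l) (h h' : arr X (act F X0)) :
  is_equivalence (Phi l) -> hat h = hat h' -> h = h'.
Proof.
move=> Pe e; apply: (equiv_faithful Pe).
exact: (iso_mono (rcomm_iso Phi F X0)) (iso_mono (act2_iso F theta_iso) e).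
Qed.

Lemma hat_surj (l : C) (F : mor j l) (X : R l) (y : arr (Phi l X) (act F Y0)) :
  is_equivalence (Phi l) -> exists h, hat h = y.
Proof.
move=> Pe; have [c [_ cK]] : is_iso (act2 (idm F) theta \o1 rcomm Phi F X0).
  by apply: iso_comp (rcomm_iso _ _ _); exact: act2_iso.
by have [h hE] := equiv_full Pe (c \o1 y); exists h; rewrite /hat hE !vcompA cK vcomp1l.
Qed.
End Hat.
End RepMorphism.

Lemma rcomod_eta (k : fieldType) (C : twoCat k) (i j : C) (A : coalg i) (X : rcomod j A) :
  RComod (rhoP X) = X.
Proof. by case: X. Qed.

(** * Coactions as morphisms of comodules *)

Section Coaction.
Variables (k : fieldType) (D : lexTwoCat k).

Definition regularComod (i : D) (A : coalg i) : comod A i := RComod (regular_r A).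

Lemma rhoHomP (i l : D) (A : coalg i) (X : rcomodCat l A) :
  rcomod_hom (rho X) (rho (ract (rcmor X) (regularComod A))) (rho X).
Proof. by rewrite /rcomod_hom (proj1 (rhoP X)) vcompA. Qed.
(** Coassociativity makes the coaction a morphism into the cofree comodule on [X]; in this form
    [Phi] can be applied to it. *)
Definition rhoHom (i l : D) (A : coalg i) (X : rcomodCat l A) :
    arr (X : comod A l) (act (rcmor X) (regularComod A)) :=
  @SHom _ _ (rcomodStruct l A) X (ract (rcmor X) (regularComod A)) (rho X) (rhoHomP X).

Section Structure.
Variables (i : D) (A : coalg i).

Lemma shvalB (l : D) (X Y : rcomodCat l A) (f g : arr X Y) :
  shval (f - g) = shval f - shval g :> arr (rcmor X) (rcmor Y).
Proof. by rewrite addrC -scaleN1r shvalE scaleN1r addrC. Qed.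

Lemma rhoHom_nat (l : D) (X Y : comod A l) (f : arr X Y) :
  rhoHom Y \o1 f = act2 (shval f : arr (rcmor X) (rcmor Y)) (idm _) \o1 rhoHom X.
Proof. by apply: shom_inj; exact: (shvalP f). Qed.

Lemma shval_actA (l m n : D) (F : mor m n) (G : mor l m) (X : comod A l) :
  shval (eqhom (actA F G X)) = asc F G (rcmor X).
Proof. by rewrite /= shval_eqhom; congr eqhom; exact: Prop_irrelevance. Qed.

Lemma rhoHom_act (l m : D) (F : mor l m) (X : comod A l) :
  rhoHom (act F X) = eqhom (actA F (rcmor X) (regularComod A)) \o1 act2 (idm F) (rhoHom X).
Proof. by apply: shom_inj; rewrite [RHS]/= shval_actA. Qed.

Lemma shval_rdiff (j l : D) (B : mor j j) (F : mor j l) (r : arr F (F ** B)) (X : comod A j)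
    (x : arr X (act B X)) :
  shval (rdiff r x) = r \o0 idm (rcmor X) - asc _ _ _ \o1
    (idm F \o0 (shval x : arr (rcmor X) (B ** rcmor X))).
Proof. by rewrite /rdiff shvalB; congr (_ - _ \o1 _); exact: shval_actA. Qed.

Lemma rhoHom_kernel (l : D) (X : comod A l) :
  is_kernel (rdiff (rho X) (rhoHom (regularComod A))) (rhoHom X).
Proof. by apply: rcomod_kernel; rewrite shval_rdiff; exact: coaction_kernel (rhoP X). Qed.

Lemma rhoHom_coassoc (l : D) (X : comod A l) :
  act2 (rho X) (idm _) \o1 rhoHom X =
  eqhom (actA (rcmor X) (cmor A) (regularComod A)) \o1
    (act2 (idm (rcmor X)) (rhoHom (regularComod A)) \o1 rhoHom X).
Proof.
apply/eqP; rewrite vcompA -subr_eq0 -vcompBl; apply/eqP; exact: proj1 (rhoHom_kernel X).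
Qed.
End Structure.

Section ComodBicomod.
Variables (i j : D) (A : coalg i) (B : coalg j) (X : comod B i) (x : arr X (act (cmor A) X)).
Hypothesis xP : is_lcoaction (shval x : arr (rcmor X) (A ** rcmor X)).

(** The two coactions commute exactly because [x] is a morphism of right comodules; [M] and [N]
    become bicomodules in this way. *)
Lemma comodBicomod_comm :
  asc _ _ _ \o1 ((idm A \o0 rho X) \o1 shval x) = (shval x \o0 idm B) \o1 rho X.
Proof. by rewrite vcompA; exact: (shvalP x). Qed.
Definition comodBicomod : bicomod A B := BiComod xP (rhoP X) comodBicomod_comm.
End ComodBicomod.

(** The inclusion of [M [] N] is another kernel of [rdiff (brho M) x] among right [A]-comodules, so
    the comparison isomorphism is right linear. Its left linearity is that of [h], tested after the
    monic inclusion. *)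
Lemma cot_kernel_iso (i j : D) (A : coalg i) (B : coalg j) (M : bicomod A B) (X : comod A j)
    (x : arr X (act (cmor B) X)) (xP : is_lcoaction (shval x : arr (rcmor X) (B ** rcmor X)))
    (h : arr (regularComod A) (act (bcmor M) X)) :
  is_kernel (rdiff (brho M) x) h ->
  heq ((idm A \o0 (shval h : arr (A : mor i i) (M ** rcmor X))) \o1 comul A)
    ((blam M \o0 idm (rcmor X)) \o1 shval h) ->
  exists f : arr (regularBicomod A : bicomodCat A A) (cotensor M (comodBicomod xP)),
    is_iso f /\ coti (brho M) (shval x) \o1 shval f = shval h.
Proof.
move=> kh hl; set N := comodBicomod xP.
pose Q : comod A i := RComod (cot_rhoP M N).
have incP : rcomod_hom (rho Q) (rho (ract (bcmor M) X)) (coti (brho M) (blam N)).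
  apply: heq_eq; apply: heq_trans (heq_comp (act_rho_heq _ _) (heq_refl _)) _.
  exact: heq_sym (cot_rhoE M N).
pose inc : arr Q (act (bcmor M) X) := @SHom _ _ (rcomodStruct i A) Q (ract (bcmor M) X) _ incP.
have kinc : is_kernel (rdiff (brho M) x) inc.
  by apply: rcomod_kernel; rewrite shval_rdiff; exact: kerP.
have [p [ip pE]] := kernel_uniq kinc kh.
have pl : lcomod_hom (comul A) (blam (cotensor M N)) (shval p).
  rewrite /lcomod_hom.
  apply: (mono_l (F := A : mor _ _) (coti_mono (rX := brho M) (lY := blam N))); apply: heq_eq.
  rewrite [Q in heq Q _]vcompA.
  apply: heq_trans (heq_comp (cot_lamE M N) (heq_refl _)) _.
  rewrite [Q in heq _ Q]vcompA -[Q in heq _ (Q \o1 _)]whisker_l -vcompA.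
  have E : coti (brho M) (blam N) \o1 shval p = shval h by rewrite pE.
  by rewrite E; exact: heq_sym.
pose f : arr (regularBicomod A : bicomodCat A A) (cotensor M N) :=
  @SHom _ _ (bicomodStruct A A) (regularBicomod A) (cotensor M N) (shval p) (conj pl (shvalP p)).
exists f; split; last by rewrite pE.
by apply: bicomod_iso; exact: rcomod_iso_val ip.
Qed.
End Coaction.

(** * From an equivalence to M, N, f and g *)

Section Equivalence.
Variables (k : fieldType) (D : lexTwoCat k).
Variables (i j : D) (A : coalg i) (B : coalg j) (Phi : repMor (comod A) (comod B)).
Hypothesis Phi_equiv : forall l, is_equivalence (Phi l).

Let A1 := regularComod A.
Let B1 := regularComod B.
Let M0 : comod B i := Phi i A1.

(** The coaction of [X] after [Phi], read as a map into [X ** M]; by [tau_kernel] it presents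
    [Phi X] as [X [] M]. *)
Definition tau (l : D) (X : comod A l) : arr (Phi l X) (act (rcmor X) M0) :=
  rcomm Phi (rcmor X) A1 \o1 fmap (Phi l) (rhoHom X).

Lemma tau_nat (l : D) (X Y : comod A l) (f : arr X Y) :
  tau Y \o1 fmap (Phi l) f = act2 (shval f : arr (rcmor X) (rcmor Y)) (idm M0) \o1 tau X.
Proof.
by rewrite /tau -vcompA -fmapM rhoHom_nat fmapM !vcompA rcomm_nat fmap1.
Qed.

Lemma tau_act (l m : D) (F : mor l m) (X : comod A l) :
  tau (act F X) = eqhom (actA F (rcmor X) M0) \o1 (act2 (idm F) (tau X) \o1 rcomm Phi F X).
Proof.
rewrite /tau rhoHom_act fmapM (vcompA (rcomm _ _ _)) [rcomm Phi (rcmor (act F X)) _ \o1 _]rcommA.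
by rewrite -!vcompA rcomm_nat act2_idM -!vcompA.
Qed.

Definition lamM : arr M0 (act (cmor A) M0) := tau A1.

Lemma tau_kernel (l : D) (X : comod A l) : is_kernel (rdiff (rho X) lamM) (tau X).
Proof.
apply: kernel_isos (equiv_kernel (Phi_equiv l) (rhoHom_kernel X)).
- exact: (rcomm_iso Phi (rcmor X) A1).
- exact: (rcomm_iso Phi (rcmor X ** A) A1).
- exact: eqhom_iso erefl.
- by rewrite rcomm_rdiff.
- by rewrite vcomp1r.
Qed.

Lemma tau_coassoc (l : D) (X : comod A l) :
  eqhom (actA (rcmor X) (cmor A) M0) \o1 (act2 (idm (rcmor X)) lamM \o1 tau X) =
  act2 (rho X) (idm M0) \o1 tau X.
Proof.
apply/esym/eqP; rewrite vcompA -subr_eq0 -vcompBl; apply/eqP; exact: proj1 (tau_kernel X).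
Qed.

Lemma lamMP : is_lcoaction (shval lamM : arr (rcmor M0) (A ** rcmor M0)).
Proof.
split.
  by have /(congr1 shval) := tau_coassoc A1; rewrite /= shval_eqhom => /eqhom_irrl; apply.
(* The counit law of [A] as an identity of comodule morphisms; [Phi] and the coherence [rcomm1] turn
   it into the counit law of [lamM]. *)
have E : act2 (counit A) (idm A1) \o1 rhoHom A1 = eqhom (esym (act1 A1)).
  apply: (iso_mono (eqhom_iso (act1 A1))); rewrite eqhomVK; apply: shom_inj.
  rewrite /= shval_eqhom; exact: eqhom_irrl (counitl A).
have : eqhom (act1 M0) \o1 (act2 (counit A) (idm M0) \o1 lamM) = idm M0.
  rewrite /lamM /tau (vcompA (act2 _ _)) -[idm M0]fmap1 -rcomm_nat -vcompA -fmapM E.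
  by rewrite vcompA rcomm1 -fmapM eqhomVK.
move=> /(congr1 shval); rewrite /= shval_eqhom => /eqhom_irrl; apply.
Qed.

Let M : bicomod A B := comodBicomod lamMP.

Variables (N0 : comod A j) (theta : arr (Phi j N0) B1).
Hypothesis theta_iso : is_iso theta.

Variable lamN : arr N0 (act (cmor B) N0).
Hypothesis lamNE : hat theta lamN = rhoHom B1 \o1 theta.

(** The injective map [hat] turns both laws for [lamN] into the laws for the comultiplication of
    [B], composed with [theta]. *)
Lemma lamNP : is_lcoaction (shval lamN : arr (rcmor N0) (B ** rcmor N0)).
Proof.
split.
  have : eqhom (actA (cmor B) (cmor B) N0) \o1 (act2 (idm (cmor B)) lamN \o1 lamN) =
      act2 (comul B) (idm N0) \o1 lamN.
    apply: (hat_inj theta_iso) (Phi_equiv j) _.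
    transitivity (act2 (rho B1) (idm B1) \o1 rhoHom B1 \o1 theta); last first.
      by rewrite hat_nat lamNE vcompA.
    rewrite rhoHom_coassoc vcompA hat_pre hat_act lamNE.
    rewrite act2_idM -!vcompA; congr (_ \o1 (_ \o1 _)); exact: lamNE.
  move=> /(congr1 shval); rewrite /= shval_eqhom => /eqhom_irrl; apply.
have : act2 (counit B) (idm N0) \o1 lamN = eqhom (esym (act1 N0)).
  apply: (hat_inj theta_iso) (Phi_equiv j) _.
  rewrite hat_nat lamNE; apply: (iso_mono (eqhom_iso (act1 B1))).
  rewrite /hat [RHS]vcompA act2_1 -[RHS]vcompA (vcompA (eqhom _) (rcomm _ _ _)) rcomm1 -fmapM eqhomVK fmap1 vcomp1r.
  rewrite !vcompA -[RHS]vcomp1l; congr (_ \o1 _); apply: shom_inj.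
  rewrite /= shval_eqhom -vcompA; exact: eqhom_irrl (counitl B).
move=> /(congr1 (fun u => shval (eqhom (act1 N0) \o1 u))).
rewrite eqhomVK /= shval_eqhom => /eqhom_irrl; apply.
Qed.

Let N : bicomod B A := comodBicomod lamNP.

Variable f' : arr A1 (act (rcmor M0) N0).
Hypothesis f'E : hat theta f' = rhoHom M0.
Variable g' : arr B1 (act (rcmor N0) M0).
Hypothesis g'E : g' \o1 theta = tau N0.

(** Under [hat] the map [f'] becomes the right coaction of [M0], and the claim becomes right
    linearity of [lamM]. *)
Lemma f'_left :
  heq ((idm A \o0 (shval f' : arr (A : mor i i) (M ** N))) \o1 comul A)
    ((blam M \o0 idm N) \o1 shval f').
Proof.
have : eqhom (actA (cmor A) (rcmor M0) N0) \o1 (act2 (idm (cmor A)) f' \o1 rhoHom A1) =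
    act2 (shval lamM : arr (rcmor M0) (A ** rcmor M0)) (idm N0) \o1 f'.
  apply: (hat_inj theta_iso) (Phi_equiv i) _.
  rewrite vcompA hat_pre hat_act hat_nat f'E -!vcompA -/(tau A1) -/lamM.
  apply: shom_inj; rewrite [LHS]/= shval_eqhom; exact: eqhom_irrl (comodBicomod_comm lamM).
move=> /(congr1 shval); rewrite /= shval_eqhom => E.
by apply: heq_trans (eq_heq E); apply: heq_sym; exact: heq_eqhoml.
Qed.

(** After composition with [theta], [g'] becomes [tau N0], and the identity is naturality of [tau]
    along [lamN] combined with [tau_act]. *)
Lemma g'_left :
  heq ((idm B \o0 (shval g' : arr (B : mor j j) (N ** M))) \o1 comul B)
    ((blam N \o0 idm M) \o1 shval g').
Proof.
have : eqhom (actA (cmor B) (rcmor N0) M0) \o1 (act2 (idm (cmor B)) g' \o1 rhoHom B1) =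
    act2 (shval lamN : arr (rcmor N0) (B ** rcmor N0)) (idm M0) \o1 g'.
  apply: (iso_cancel_r theta_iso); rewrite -!vcompA -lamNE g'E -(tau_nat lamN) tau_act -!vcompA.
  by rewrite /hat (vcompA (act2 _ _)) -act2_idM g'E.
move=> /(congr1 shval); rewrite /= shval_eqhom => E.
by apply: heq_trans (eq_heq E); apply: heq_sym; exact: heq_eqhoml.
Qed.

(** [Phi] reflects kernels, and up to the isomorphisms induced by [theta] the image of [f'] is the
    coaction of [M0], a kernel by [rhoHom_kernel]. *)
Lemma f'_kernel : is_kernel (rdiff (rho M0) lamN) f'.
Proof.
apply: (equiv_kernel_reflect (Phi_equiv i)).
have [x' [xK Kx]] : is_iso (act2 (idm (rcmor M0)) theta \o1 rcomm Phi (rcmor M0) N0).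
  by apply: iso_comp (rcomm_iso _ _ _); exact: act2_iso.
have [y' [yK Ky]] : is_iso (act2 (idm (rcmor M0 ** B)) theta \o1 rcomm Phi (rcmor M0 ** B) N0).
  by apply: iso_comp (rcomm_iso _ _ _); exact: act2_iso.
apply: kernel_isos (rhoHom_kernel M0).
- by exists (act2 (idm (rcmor M0)) theta \o1 rcomm Phi (rcmor M0) N0); split; [exact: Kx | exact: xK].
- by exists (act2 (idm (rcmor M0 ** B)) theta \o1 rcomm Phi (rcmor M0 ** B) N0); split;
  [exact: Ky | exact: yK].
- exact: eqhom_iso erefl.
- apply: (iso_mono (f := act2 (idm (rcmor M0 ** B)) theta \o1 rcomm Phi (rcmor M0 ** B) N0));
  first by exists y'.
  rewrite (vcompA _ y') Ky vcomp1l !vcompA -(vcompA _ (rcomm _ _ _)) rcomm_rdiff vcompA.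
  rewrite (rdiff_nat _ (x' := rhoHom B1)); last by rewrite -lamNE /hat.
  by rewrite -!vcompA (vcompA (act2 _ theta)) Kx vcomp1r.
- by rewrite vcomp1r -f'E /hat (vcompA (act2 _ _)) (vcompA x') xK vcomp1l.
Qed.

Lemma g'_kernel : is_kernel (rdiff (rho N0) lamM) g'.
Proof.
have [t [tK Kt]] := theta_iso.
have -> : g' = tau N0 \o1 t by rewrite -g'E -vcompA Kt vcomp1r.
by apply: iso_kernel (tau_kernel N0); exists theta.
Qed.

(** Both sides equal [tau] of [act (rcmor M0) N0] after the image of [f']: one by naturality, the
    other by [tau_act], where [tau N0] is [g' \o1 theta] and [theta] completes the image of [f'] to
    [hat f']. *)
Lemma equiv_morita_condM :
  heq ((idm M \o0 (shval g' : arr (B : mor j j) (N ** M))) \o1 brho M)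
    (((shval f' : arr (A : mor i i) (M ** N)) \o0 idm M) \o1 blam M).
Proof.
have : eqhom (actA (rcmor M0) (rcmor N0) M0) \o1 (act2 (idm (rcmor M0)) g' \o1 rhoHom M0) =
    act2 (shval f' : arr (A : mor i i) (rcmor M0 ** rcmor N0)) (idm M0) \o1 lamM.
  by rewrite -(tau_nat f') tau_act -g'E -f'E /hat act2_idM -!vcompA.
move=> /(congr1 shval); rewrite /= shval_eqhom => E.
by apply: heq_trans (eq_heq E); apply: heq_sym; exact: heq_eqhoml.
Qed.

(** After [hat] both sides end in [theta]; what remains is right linearity of [g'], as naturality of
    [rhoHom]. *)
Lemma equiv_morita_condN :
  heq ((idm N \o0 (shval f' : arr (A : mor i i) (M ** N))) \o1 brho N)
    (((shval g' : arr (B : mor j j) (N ** M)) \o0 idm N) \o1 blam N).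
Proof.
have : eqhom (actA (rcmor N0) (rcmor M0) N0) \o1 (act2 (idm (rcmor N0)) f' \o1 rhoHom N0) =
    act2 (shval g' : arr (B : mor j j) (rcmor N0 ** rcmor M0)) (idm N0) \o1 lamN.
  apply: (hat_inj theta_iso) (Phi_equiv j) _.
  rewrite vcompA hat_pre hat_act hat_nat lamNE f'E -!vcompA -/(tau N0) -g'E.
  rewrite !vcompA -(rhoHom_nat g'); congr (_ \o1 _).
  by rewrite rhoHom_act.
move=> /(congr1 shval); rewrite /= shval_eqhom => E.
by apply: heq_trans (eq_heq E); apply: heq_sym; exact: heq_eqhoml.
Qed.
End Equivalence.

(** * Assembly and conclusion *)

Lemma rep_equivalent_morita (k : fieldType) (D : lexTwoCat k) (i j : D) (A : coalg i) (B : coalg j) :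
  injective_obj (one i) -> injective_obj (one j) -> rep_equivalent (comod A) (comod B) ->
  exists (M : bicomodCat A B) (N : bicomodCat B A)
      (f : arr (regularBicomod A : bicomodCat A A) (cotensor M N))
      (g : arr (regularBicomod B : bicomodCat B B) (cotensor N M)),
    [/\ biinjective M, biinjective N, is_iso f, is_iso g &
      cotm (idm M) g \o1 rhoc M = cotA M N M \o1 (cotm f (idm M) \o1 lamc M) /\
      cotm (idm N) f \o1 rhoc N = cotA N M N \o1 (cotm g (idm N) \o1 lamc N)].
Proof.
move=> inj_i inj_j [Phi Pe].
have [N0 [theta theta_iso]] := equiv_esurj (Pe j) (regularComod B).
have [theta' [thK Kth]] := theta_iso.
have [lamN lamNE] := hat_surj theta_iso (rhoHom (regularComod B) \o1 theta) (Pe j).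
pose M0 : comod B i := Phi i (regularComod A).
have [f' f'E] := hat_surj theta_iso (rhoHom M0) (Pe i).
pose g' := tau Phi N0 \o1 theta'.
have g'E : g' \o1 theta = tau Phi N0 by rewrite /g' -vcompA thK vcomp1r.
pose MP := lamMP Pe; pose NP := lamNP Pe theta_iso lamNE.
pose M : bicomod A B := comodBicomod MP; pose N : bicomod B A := comodBicomod NP.
have fl := f'_left Pe theta_iso lamNE f'E.
have gl := g'_left Pe theta_iso lamNE g'E.
have [f [f_iso fE]] := @cot_kernel_iso _ _ _ _ _ _ M N0 lamN NP f' (f'_kernel Pe theta_iso lamNE f'E) fl.
have [g [g_iso gE]] := @cot_kernel_iso _ _ _ _ _ _ N M0 (lamM Phi) MP g' (g'_kernel Pe theta_iso g'E) gl.
have cM := equiv_morita_condM Pe theta_iso lamNE f'E g'E.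
have cN := equiv_morita_condN Pe theta_iso lamNE f'E g'E.
have eM : cotm (idm (M : bicomodCat A B)) g \o1 rhoc M =
  cotA M N M \o1 (cotm f (idm (M : bicomodCat A B)) \o1 lamc M).
  by apply/morita_condP; rewrite gE fE.
have eN : cotm (idm (N : bicomodCat B A)) f \o1 rhoc N =
  cotA N M N \o1 (cotm g (idm (N : bicomodCat B A)) \o1 lamc N).
  by apply/morita_condP; rewrite gE fE.
have [fl' fr'] := shvalP f; have [gl' gr'] := shvalP g.
exists M, N, f, g; split=> //; split.
- apply: (morita_left_injective (cot_hom_l fl') (cot_hom_r fr') _ _ inj_j); last exact: bicomod_iso_val g_iso.
  by apply/morita_condP.
- have -> : RComod (brhoP M) = M0 := rcomod_eta M0.
  by apply: equiv_injective (Pe i) _; exact: regular_right_injective.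
- apply: (morita_left_injective (cot_hom_l gl') (cot_hom_r gr') _ _ inj_i); last exact: bicomod_iso_val f_iso.
  by apply/morita_condP.
- have -> : RComod (brhoP N) = N0 := rcomod_eta N0.
  apply: (equiv_injective_reflect (Pe j)).
  apply: (injective_iso (f := theta')) (regular_right_injective inj_j).
  by exists theta.
Qed.

Theorem theorem5p1 (k : closedFieldType) (C : twoCat k) (hC : finitary2 C)
    (i j : abelianization C) (A : coalg i) (B : coalg j) :
  rep_equivalent (comod A) (comod B) <->
  exists (M : bicomodCat A B) (N : bicomodCat B A)
      (f : arr (regularBicomod A : bicomodCat A A) (cotensor M N))
      (g : arr (regularBicomod B : bicomodCat B B) (cotensor N M)),
    [/\ biinjective M, biinjective N, is_iso f, is_iso g &
      cotm (idm M) g \o1 rhoc M = cotA M N M \o1 (cotm f (idm M) \o1 lamc M) /\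
      cotm (idm N) f \o1 rhoc N = cotA N M N \o1 (cotm g (idm N) \o1 lamc N)].
Proof.
split; last by move=> [M [N [f [g [_ _ fi gi _]]]]]; exact: morita_rep_equivalent fi gi.
(* The identity 1-morphisms of the abelianization are embedded objects, hence injective. *)
by apply: rep_equivalent_morita; exact: abEmb_injective.
Qed.
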